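(* Let $d>2$, let $W=[0,1]^d$, $W_R=RW$, and let $\Lambda=\sum_{i=1}^d\int_{-\infty}^{+\infty}\delta_{re_i+e_i^{\perp}}\,dr$, where $e_1,\dots,e_d$ is the standard orthonormal basis of $\mathbb R^d$ and $\delta_{re_i+e_i^\perp}$ is the unit point mass at the hyperplane orthogonal to $e_i$ at signed distance $r$ from the origin. Then $$R^{-(d-1)}\Big[\mathrm{Vol}_{d-1}(Y(1,W_R))-\mathbb E\,\mathrm{Vol}_{d-1}(Y(1,W_R))\Big]$$ converges in law, as $R\to\infty$, to a non-Gaussian square-integrable random variable $\Xi(W)$ with $$\mathrm{Var}(\Xi(W))=\int_{[W]}\int_{W\cap H}\int_{W\cap H}\frac{1}{\Lambda([xy])}\,dx\,dy\,\Lambda(dH),$$ where $[xy]$ is the set of hyperplanes hitting the segment with endpoints $x,y$ and $dx,dy$ denote $(d-1)$-dimensional Lebesgue measure on $H$.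
   Context: $\mathcal H$ is the space of affine hyperplanes in $\mathbb R^d$; for a compact convex set $c$, $[c]=\{H\in\mathcal H:H\cap c\ne\emptyset\}$. STIT tessellation via the MNW-construction: for compact convex $W$ with interior points and $t>0$, $Y(t,W)=Y(t\Lambda,W)$ is the state at time $t$ of the following continuous-time random cell-splitting process. At time $0$ there is the single cell $W$. Each existing cell $c$, independently of all other cells, lives for an exponentially distributed time with parameter $\Lambda([c])$; at the end of its lifetime it is split into the two cells $c\cap H^+$ and $c\cap H^-$ (intersections with the two closed half-spaces bounded by $H$), where $H$ is a random hyperplane with law $\Lambda(\cdot\cap[c])/\Lambda([c])$ independent of everything else; the two new cells then evolve in the same way. Each split creates a $(d-1)$-dimensional facet $c\cap H$; $\mathrm{Vol}_{d-1}(Y(t,W))$ denotes the sum of the $(d-1)$-volumes of all facets created during $[0,t]$ (the total surface area of cell boundaries in the interior of $W$). *)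

(* Defs.v *)
From HB Require Import structures.
From mathcomp Require Import all_boot all_order all_algebra.
From mathcomp Require Import all_classical all_reals all_analysis.
Set Implicit Arguments. Unset Strict Implicit. Unset Printing Implicit Defensive.
Import Order.TTheory GRing.Theory Num.Theory.
Import numFieldNormedType.Exports.
Local Open Scope classical_set_scope.
Local Open Scope ring_scope.

(* Points of R^d are functions 'I_d -> R.  An axis-parallel hyperplane
   {x | x_i = r} = r e_i + e_i^perp is encoded by the pair (i, r). *)
Section Defs.
Variables (R : realType) (d : nat).

Definition hyp (H : 'I_d * R) : set ('I_d -> R) := [set x | x H.1 = H.2].

Definition hits (c : set ('I_d -> R)) : set ('I_d * R) :=
  [set H | hyp H `&` c !=set0].

Definition Lam (A : set ('I_d * R)) : \bar R :=
  (\sum_(i < d) lebesgue_measure [set r | A (i, r)])%E.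

Definition Lam_int (A : set ('I_d * R)) (g : 'I_d * R -> \bar R) : \bar R :=
  (\sum_(i < d) \int[lebesgue_measure]_(r in [set r | A (i, r)]) g (i, r))%E.

Definition segment (x y : 'I_d -> R) : set ('I_d -> R) :=
  [set z | exists2 t, 0 <= t <= 1 & z = (fun k => (1 - t) * x k + t * y k)].

Fixpoint iter_int (s : seq 'I_d) (f : ('I_d -> R) -> \bar R)
    (x : 'I_d -> R) : \bar R :=
  match s with
  | [::] => f x
  | j :: s' => (\int[lebesgue_measure]_(t in [set: R])
                  iter_int s' f (fun k => if k == j then t else x k))%E
  end.

Definition hyp_int (H : 'I_d * R) (f : ('I_d -> R) -> \bar R) : \bar R :=
  iter_int [seq j <- enum 'I_d | j != H.1] f
    (fun k => if k == H.1 then H.2 else 0).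

Definition var_formula (W : set ('I_d -> R)) : \bar R :=
  Lam_int (hits W) (fun H =>
    hyp_int H (fun y => hyp_int H (fun x =>
      ((\1_W x)%:E * (\1_W y)%:E * (Lam (hits (segment x y)))^-1)%E))).

(* ---- the STIT (MNW) construction; all cells are boxes ---- *)
Definition box := (('I_d -> R) * ('I_d -> R))%type.
Definition box_set (c : box) : set ('I_d -> R) :=
  [set x | forall i, c.1 i <= x i <= c.2 i].
Definition cube_box (a : R) : box := (fun _ => 0, fun _ => a).

(* Inverse-cdf sampling of Lambda(. cap [c]) / Lambda([c]) from a number
   s in [0, Lambda([c])]: for a box c this law chooses direction i with
   probability (side i)/(sum of sides) and then r uniformly on the side. *)
Fixpoint pick (c : box) (l : seq 'I_d) (s : R) : option ('I_d * R) :=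
  match l with
  | [::] => None
  | j :: l' => if (s < c.2 j - c.1 j) || nilp l' then Some (j, c.1 j + s)
               else pick c l' (s - (c.2 j - c.1 j))
  end.

Definition choose_hyp (c : box) (u : R) : option ('I_d * R) :=
  pick c (enum 'I_d) (u * \sum_(i < d) (c.2 i - c.1 i)).

Definition split_box (c : box) (H : option ('I_d * R)) (b : bool) : box :=
  match H with
  | None => c
  | Some (i, r) =>
      if b then (c.1, fun k => if k == i then r else c.2 k)
      else (fun k => if k == i then r else c.1 k, c.2)
  end.

(* exponential lifetime with parameter Lambda([c]) from a standard
   exponential variable e *)
Definition death (st : box * R) (e : R) : R :=
  st.2 + e / fine (Lam (hits (box_set st.1))).

(* state (cell, birth time) of the node reached by the path v, the random
   inputs of node p being E p (Exp(1)) and U p (Unif[0,1]) *)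
Fixpoint walk (E U : seq bool -> R) (pre : seq bool) (st : box * R)
    (v : seq bool) : box * R :=
  match v with
  | [::] => st
  | b :: v' => walk E U (rcons pre b)
                 (split_box st.1 (choose_hyp st.1 (U pre)) b, death st (E pre)) v'
  end.

Definition node_state (E U : seq bool -> R) (W : box) (v : seq bool) :=
  walk E U [::] (W, 0) v.

Definition facet_vol (c : box) (H : option ('I_d * R)) : \bar R :=
  match H with
  | None => 0%E
  | Some H => hyp_int H (fun x => (\1_(box_set c) x)%:E)
  end.

Definition stit_surface (E U : seq bool -> R) (W : box) (t : R) : \bar R :=
  (\esum_(v in [set v | (death (node_state E U W v) (E v) <= t)%R])
     facet_vol (node_state E U W v).1 (choose_hyp (node_state E U W v).1 (U v)))%E.

End Defs.

Definition mutually_independent {d0} {T : measurableType d0} {R : realType}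
    (P : probability T R) {I : eqType} (X : I -> T -> R) : Prop :=
  forall (J : seq I) (B : I -> set R), uniq J -> (forall j, measurable (B j)) ->
    P (\bigcap_(j in [set j | j \in J]) (X j @^-1` B j)) =
    (\prod_(j <- J) P (X j @^-1` B j))%E.

Definition variance_of {R : realType} (mu : probability R R) : \bar R :=
  (\int[mu]_x ((x - fine (\int[mu]_y y%:E)) ^+ 2)%:E)%E.

(* Main.v *)
(* By the scaling of STIT tessellations, R^-(d-1) times the surface of Y(1, W_R) is the surface
   S_R of Y(R, W), W the unit cube, and E S_t = d t.  Let a node v of the splitting tree have
   cell c, birth time b, facet volume F and exponential clock e, and put
   s := (t - b)^+ Lambda([c]) and
   Q_v(t) := F - (d vol(c) / Lambda([c])) (e - s) if s < e, and 0 otherwise.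
   The node splits by time t when e <= s, and Q_v(0) - Q_v(t) is its contribution to S_t minus
   d vol(c) times the time its cell lives before t.  The lifetimes of the cells fill W x [0, t],
   so S_t - d t = M - N(t) with M := sum_v Q_v(0) and N(t) := sum_v Q_v(t).  The Q_v(t) are
   centred and pairwise orthogonal, and E Q_v(t)^2 is the mean of
   beta(c) := (sum_i side_i face_i^2) / Lambda([c]) over the cells that die after time t.
   As d > 2, beta is dominated by vol(c) Lambda([c]), whose sum over a generation decays
   geometrically in mean.  So M exists in L^2, N(t) tends to 0, and M has the limit law.

   Variance: beta(c) is the integral over x, y in a common hyperplane section of the kernel
   1[x, y in c] / Lambda([c]).  If p_n and q_n are the mean sums over generation n of this
   kernel and of 1[x, y in c], then q_(n+1) = q_n - |x - y|_1 p_n, which telescopes to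
   sum_n p_n = 1 / |x - y|_1 = 1 / Lambda([xy]).

   Non-Gaussianity: the root contributes 1 - e to M, and the remaining terms are independent
   of e since cells do not depend on exponential clocks.  As E exp(e) is infinite, so is
   E exp(-M), unlike for a Gaussian law. *)
From HB Require Import structures.
From mathcomp Require Import all_boot all_order all_algebra.
From mathcomp Require Import all_classical all_reals all_analysis.
From mathcomp Require Import measurable_realfun.
From mathcomp Require Import ring lra.
Require Import Defs.
Set Implicit Arguments. Unset Strict Implicit. Unset Printing Implicit Defensive.
Import Order.TTheory GRing.Theory Num.Theory.
Import numFieldNormedType.Exports.
Local Open Scope classical_set_scope.
Local Open Scope ring_scope.

(** Probability enters by integrating out one input at a time. For a chosen input, [without] gives
    the sample space the sigma-algebra generated by all the others; what they determine is
    measurable there and stays frozen by Fubini while the chosen input is averaged. Measurability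
    along the tree is therefore tracked relative to the inputs actually read.

    The form of Q_v rests on two facts: F has conditional mean kappa(c) = d vol(c) / Lambda([c]),
    and on s < e the excess e - s is again standard exponential, with moments 1 and 2. The mean
    cancels; in the second moment the cross term - 2 kappa^2 cancels the square term 2 kappa^2,
    leaving beta.

    The identity for S_t - d t is obtained for finitely many generations, with the space-time volume
    not yet filled as an error; weighting cells by exp(-birth) makes that error decay in mean with
    ratio d / (1 + d). The variance tails are bounded uniformly in t, so N(t) -> 0 reduces to
    finitely many nodes.

    The laws constrain the inputs only almost surely, so the argument runs on clamped inputs,
    compared with the given ones off one null set. *)

Lemma cvg_EFin_comp {R : realType} {I : Type} (F : set_system I) (FF : Filter F)
    (u : I -> R) (a : R) : u @ F --> a -> (u x)%:E @[x --> F] --> a%:E.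
Proof. by move=> ua; apply: cvg_EFin; [exact: nearW|exact: ua]. Qed.

Lemma integral_cst_probability d (T : measurableType d) (R : realType)
    (P : probability T R) (r : R) : (\int[P]_w r%:E = r%:E)%E.
Proof.
rewrite integral_cst// [X in (_ * X)%E](_ : _ = 1%E) ?mule1//.
exact: probability_setT.
Qed.

(** * Integration against a density *)

Section density.
Local Open Scope ereal_scope.
Context d (T : measurableType d) (R : realType).
Variables (mu nu : {measure set T -> \bar R}) (g : T -> R).
Hypothesis mg : measurable_fun setT g.
Hypothesis g0 : forall x, (0 <= g x)%R.
Hypothesis nuE : forall A, measurable A -> nu A = \int[mu]_(x in A) (g x)%:E.
Import HBNNSimple.

(** Both sides commute with increasing limits and finite sums, so indicators suffice, and there the
    claim is [nuE]. *)
Lemma ge0_integral_density f : measurable_fun setT f -> (forall x, 0 <= f x) ->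
  \int[nu]_x f x = \int[mu]_x (f x * (g x)%:E).
Proof.
move=> mf f0; pose h := nnsfun_approx measurableT mf.
have hf x : (EFin \o h n) x @[n --> \oo] --> f x.
  exact: cvg_nnsfun_approx.
have hnd x : {homo (fun n => (h n x)%:E) : a b / (a <= b)%N >-> a <= b}.
  by move=> a b ab; rewrite lee_fin; exact/lefP/nd_nnsfun_approx.
transitivity (limn (fun n => \int[nu]_x (h n x)%:E)).
  rewrite -monotone_convergence//; last 2 first.
  - by move=> n; exact/measurable_EFinP.
  - by move=> n x _; rewrite lee_fin.
  by apply: eq_integral => x _; apply/esym/cvg_lim => //; exact: hf.
transitivity (limn (fun n => \int[mu]_x ((h n x)%:E * (g x)%:E))); last first.
  rewrite -monotone_convergence//; last 3 first.
  - by move=> n; apply: emeasurable_funM; exact/measurable_EFinP.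
  - by move=> n x _; rewrite mule_ge0// lee_fin.
  - by move=> x _ a b ab; rewrite lee_wpmul2r ?lee_fin//; exact: hnd.
  apply: eq_integral => x _; apply/cvg_lim => //.
  by apply: cvgeZr => //; exact: hf.
congr (limn _); apply/funext => n.
have mind r : measurable_fun setT (fun x => (r * \1_(h n @^-1` [set r]) x)%:E).
  by apply/measurable_EFinP; exact: measurable_funM.
transitivity (\int[nu]_x (\sum_(y \in range (h n)) (y * \1_(h n @^-1` [set y]) x)%:E)).
  by apply: eq_integral => t tE; rewrite /= fimfunE -fsumEFin.
rewrite ge0_integral_fsum//; last by move=> m y Ey; exact: nnfun_muleindic_ge0.
transitivity (\int[mu]_x (\sum_(y \in range (h n))
    (y * \1_(h n @^-1` [set y]) x)%:E * (g x)%:E)); last first.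
  apply: eq_integral => x _.
  rewrite -ge0_mule_fsuml => [|y]; last exact: nnfun_muleindic_ge0.
  by rewrite fsumEFin // -(fimfunE _ x).
rewrite ge0_integral_fsum//; last 2 first.
  - by move=> y; apply: emeasurable_funM => //; exact/measurable_EFinP.
  - by move=> m y Ey; rewrite mule_ge0 ?lee_fin// -lee_fin nnfun_muleindic_ge0.
apply: eq_fsbigr => r rhn.
under eq_integral do rewrite EFinM.
rewrite integralZl_indic_nnsfun//.
under [RHS]eq_integral do rewrite EFinM -muleA.
rewrite ge0_integralZl//.
- congr (_ * _); rewrite integral_indic// setIT nuE//.
  rewrite [LHS]integral_mkcond; apply: eq_integral => x _.
  by rewrite epatch_indic muleC.
- by apply: emeasurable_funM; exact/measurable_EFinP.
- by move=> t Et; rewrite mule_ge0 ?lee_fin.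
- by move: rhn; rewrite inE => -[t _ <-]; rewrite lee_fin.
Qed.
End density.

(** * Lebesgue measure under translations and dilations *)

Section lebesgue_affine.
Local Open Scope ereal_scope.
Context {R : realType}.
Local Notation mu := (@lebesgue_measure R).

(** The translated measure gives each interval its length, which characterizes Lebesgue measure.
    Dilations are treated in the same way below, after rescaling the image measure. *)
Lemma lebesgue_measureD (a : R) (A : set R) : measurable A ->
  mu ((fun x => x + a)%R @^-1` A) = mu A.
Proof.
have ma : @measurable_fun _ _ (measurableTypeR R) (measurableTypeR R) setT (fun x => x + a)%R.
  exact: measurable_funD.
move=> mA; apply/esym.
pose fm : {mfun measurableTypeR R >-> measurableTypeR R} := @mfun_Sub _ _ (measurableTypeR R) (measurableTypeR R) _ (mem_set ma).
apply: (@lebesgue_measure_unique _ (pushforward mu fm)) => // _ [[x y]] _ <-.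
rewrite [RHS](_ : _ = mu `](x - a)%R, (y - a)%R]%classic); last first.
  by congr (mu _); apply/seteqP; split => z/=; rewrite !in_itv/= ltrBlDr lerBrDr.
rewrite !lebesgue_measure_itv/= !lte_fin ltrD2r; case: ifPn => // _.
by rewrite -!EFinB; congr EFin; ring.
Qed.

Lemma ge0_integral_shift (f : R -> \bar R) (a : R) : measurable_fun setT f ->
  (forall x, 0 <= f x) -> \int[mu]_x f (x + a)%R = \int[mu]_x f x.
Proof.
move=> mf f0.
have ma : @measurable_fun _ _ (measurableTypeR R) (measurableTypeR R) setT (fun x => x + a)%R.
  exact: measurable_funD.
rewrite -(@ge0_integral_pushforward _ _ _ _ _ _ ma mu setT f)//.
by apply: eq_measure_integral => A mA _; exact: lebesgue_measureD.
Qed.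

Lemma lebesgue_measureM (k : R) (A : set R) : (0 < k)%R -> measurable A ->
  mu ((fun x => k * x)%R @^-1` A) = (k^-1)%:E * mu A.
Proof.
have mk : @measurable_fun _ _ (measurableTypeR R) (measurableTypeR R) setT (fun x => k * x)%R.
  exact: measurable_funM.
move=> k0 mA; have k0' := ltW k0.
suff -> : mu A = k%:E * mu ((fun x => k * x)%R @^-1` A).
  by rewrite muleA -EFinM mulVf ?gt_eqF// mul1e.
pose fm : {mfun measurableTypeR R >-> measurableTypeR R} := @mfun_Sub _ _ (measurableTypeR R) (measurableTypeR R) _ (mem_set mk).
apply: (@lebesgue_measure_unique _ (mscale (NngNum k0') (pushforward mu fm))) => // _ [[x y]] _ <-.
rewrite [RHS](_ : _ = k%:E * mu `](x / k)%R, (y / k)%R]%classic); last first.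
  by congr (_ * mu _); apply/seteqP; split => z/=; rewrite !in_itv/= ltr_pdivrMr// ler_pdivlMr// [(z * _)%R]mulrC.
rewrite !lebesgue_measure_itv/= !lte_fin ltr_pM2r ?invr_gt0//.
case: ifPn => _; last by rewrite mule0.
by rewrite -!EFinB -EFinM -mulrBl mulrCA divff ?gt_eqF// mulr1.
Qed.

Lemma ge0_integral_scale (f : R -> \bar R) (k : R) : (0 < k)%R -> measurable_fun setT f ->
  (forall x, 0 <= f x) -> \int[mu]_x f (k * x)%R = (k^-1)%:E * \int[mu]_x f x.
Proof.
move=> k0 mf f0.
have mk : @measurable_fun _ _ (measurableTypeR R) (measurableTypeR R) setT (fun x => k * x)%R.
  exact: measurable_funM.
rewrite -(@ge0_integral_pushforward _ _ _ _ _ _ mk mu setT f)//.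
have k0' : (0 <= k^-1)%R by rewrite invr_ge0 ltW.
transitivity (\int[mscale (NngNum k0') mu]_x f x); last exact: ge0_integral_mscale.
by apply: eq_measure_integral => A mA _; exact: lebesgue_measureM.
Qed.
End lebesgue_affine.

(** * Independence of one input from all the others *)

Section indep.
Local Open Scope ereal_scope.
Context d (T : measurableType d) (R : realType) (P : probability T R).
Context (I : eqType) (X : I -> T -> R).
Hypothesis mX : forall i, measurable_fun setT (X i).
Hypothesis indX : mutually_independent P X.
Variable i : I.

Definition cylinder_without : set (set T) :=
  [set A | exists (J : seq I) (B : I -> set R),
    [/\ i \notin J, forall j, measurable (B j) &
        A = [set w | forall j, j \in J -> B j (X j w)]]].

(** The same space [T] with a coarser sigma-algebra: a function measurable on [without] is one
    determined by the inputs other than [X i]. *)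
Definition without := g_sigma_algebraType cylinder_without.

Lemma measurable_cylinder (J : seq I) (B : I -> set R) :
  (forall j, measurable (B j)) ->
  measurable [set w | forall j, j \in J -> B j (X j w)].
Proof.
move=> mB; elim: J => [|a J IH].
  rewrite (_ : [set _ | _] = setT)//.
  by apply/seteqP; split => // x _ j; rewrite in_nil.
rewrite (_ : [set _ | _] = X a @^-1` B a `&` [set w | forall j, j \in J -> B j (X j w)]).
  by apply: measurableI => //; rewrite -[X in measurable X]setTI; exact: mX.
apply/seteqP; split => x /=.
  by move=> h; split=> [|j jJ]; apply: h; rewrite inE ?eqxx// jJ orbT.
by move=> [h1 h2] j; rewrite inE => /orP[/eqP->//|]; exact: h2.
Qed.

Lemma measurable_withoutW (A : set without) : measurable A -> measurable (A : set T).
Proof.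
apply: smallest_sub; first exact: sigma_algebra_measurable.
by move=> _ [J [B [_ mB ->]]]; exact: measurable_cylinder.
Qed.

Lemma measurable_fun_without j : j != i -> measurable_fun setT (X j : without -> R).
Proof.
move=> ji _ B mB; rewrite setTI; apply: sub_sigma_algebra.
exists [:: j], (fun=> B); split => //; first by rewrite inE eq_sym.
apply/seteqP; split => x /=; first by move=> h k; rewrite inE => /eqP ->.
by apply; rewrite inE.
Qed.

Lemma measurable_fun_withoutW d' (T' : measurableType d') (f : without -> T') :
  measurable_fun setT f -> measurable_fun setT (f : T -> T').
Proof.
move=> mf _ B mB; rewrite setTI; apply: measurable_withoutW.
by rewrite -[X in measurable X]setTI; exact: mf.
Qed.

(** For fixed [C] both sides are finite measures in [A]. Mutual independence makes them agree on the
    cylinders, which are stable under intersection and generate the sigma-algebra. *)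
Lemma without_independent (A : set without) (C : set R) :
  measurable A -> measurable C ->
  P (A `&` X i @^-1` C) = P A * P (X i @^-1` C).
Proof.
move=> mA mC.
have mXC : measurable (X i @^-1` C).
  by rewrite -[X in measurable X]setTI; exact: mX.
have mid : measurable_fun setT (idfun : T -> without).
  by move=> _ B mB; rewrite setTI; exact: measurable_withoutW.
pose fm : {mfun T >-> without} := mfun_Sub (mem_set mid).
have p0 : (0 <= fine (P (X i @^-1` C)))%R by rewrite fine_ge0.
pose m1_ : {measure set without -> \bar R} := pushforward (mrestr P mXC) fm.
pose m2 : {measure set without -> \bar R} := mscale (NngNum p0) (distribution P fm).
pose m1 := m1_ mid.
suff h : m1 A = m2 A.
  transitivity ((fine (P (X i @^-1` C)))%:E * P A); first exact: h.
  by rewrite fineK ?fin_num_measure// muleC.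
apply: (@measure_unique _ R without cylinder_without (fun=> setT) _ _ _ _ m1 m2) => //.
- move=> _ _ [J [B [iJ mB ->]]] [J' [B' [iJ' mB' ->]]].
  exists (J ++ J'), (fun j => (if j \in J then B j else setT) `&`
    (if j \in J' then B' j else setT)); split.
  + by rewrite mem_cat negb_or iJ.
  + by move=> j; apply: measurableI; case: ifP.
  + apply/seteqP; split => x /=.
      by move=> [h1 h2] j _; split; case: ifPn => // ?; [exact: h1|exact: h2].
    by move=> h; split => j jJ; have := h j; rewrite mem_cat jJ ?orbT => /(_ isT)[].
- move=> _; exists [::], (fun=> setT); split => //.
  by apply/seteqP; split => // x _ j; rewrite in_nil.
- by rewrite bigcup_const.
- move=> _ [J [B [iJ mB ->]]].
  (* [X i] joins the cylinder as one more constraint [C]. Independence is assumed for lists without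
     repetition, hence the passage to [undup J]. *)
  pose B' j := if j == i then C else B j.
  have e1 : [set w | forall j, j \in J -> B j (X j w)] =
            \bigcap_(j in [set j | j \in undup J]) (X j @^-1` B j).
    by apply/seteqP; split => x /= h j; [move=> /=; rewrite mem_undup; exact: h|
       move=> jJ; apply: (h j); rewrite /= mem_undup].
  have e2 : [set w | forall j, j \in J -> B j (X j w)] `&` X i @^-1` C =
            \bigcap_(j in [set j | j \in i :: undup J]) (X j @^-1` B' j).
    apply/seteqP; split => x /=.
      move=> [h1 h2] j /=; rewrite inE mem_undup /B'; case: eqVneq => [->//|_ /=].
      exact: h1.
    move=> h; split => [j jJ|].
      have := h j; rewrite /= inE mem_undup jJ orbT /B' => /(_ isT).
      by case: eqVneq => // ji; move: iJ; rewrite -ji jJ.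
    by have := h i; rewrite /= inE eqxx /B' eqxx; exact.
  set D := [set w | _] in e1 e2 *.
  transitivity (P (D `&` X i @^-1` C)); first by [].
  transitivity ((fine (P (X i @^-1` C)))%:E * P D); last by [].
  rewrite fineK ?fin_num_measure// e2 e1 !indX ?undup_uniq//; last 2 first.
  + by rewrite /= mem_undup iJ undup_uniq.
  + by move=> j; rewrite /B'; case: ifP.
  rewrite big_cons /B' eqxx; congr (_ * _).
  rewrite !big_seq; apply: eq_bigr => j; rewrite mem_undup => jJ.
  by case: eqVneq => // ji; move: iJ; rewrite -ji jJ.
- move=> k; rewrite (_ : m1 setT = P (setT `&` X i @^-1` C))//.
  by rewrite setTI ltey_eq fin_num_measure.
Qed.

(** The joint law of the identity into [without] and of [X i] is the product of the marginals, since
    they agree on rectangles; Tonelli then lets [X i] be averaged with everything else frozen. *)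
Lemma integral_without (F : without * R -> \bar R) :
  measurable_fun setT F -> (forall z, 0 <= F z) ->
  \int[P]_w F (w, X i w) = \int[P]_w \int[P]_w' F (w, X i w').
Proof.
move=> mF F0.
have mid : measurable_fun setT (idfun : T -> without).
  by move=> _ B mB; rewrite setTI; exact: measurable_withoutW.
have mXi : measurable_fun setT (X i : T -> measurableTypeR R) by exact: mX.
pose fm : {mfun T >-> without} := mfun_Sub (mem_set mid).
pose gm : {mfun T >-> measurableTypeR R} := @mfun_Sub _ _ T (measurableTypeR R) _ (mem_set mXi).
pose P1 := distribution P fm.
pose P2 := distribution P gm.
have mpair : measurable_fun setT (fun w : T => (w : without, X i w : measurableTypeR R)).
  exact: measurable_fun_pair.
pose hm : {mfun T >-> (without * measurableTypeR R)%type} :=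
  @mfun_Sub _ _ T (without * measurableTypeR R)%type _ (mem_set mpair).
have prodE A : measurable A -> (P1 \x P2) A = distribution P hm A.
  move=> mA; apply: product_measure_unique => // B C mB mC.
  rewrite -[RHS]without_independent//.
have mF' : measurable_fun setT (F : (without * measurableTypeR R) -> \bar R) by [].
transitivity (\int[distribution P hm]_z F z).
  by rewrite ge0_integral_pushforward.
transitivity (\int[P1 \x P2]_z F z).
  by apply: eq_measure_integral => A mA _; exact/esym/prodE.
transitivity (\int[P1]_x fubini_F P2 (F : without * measurableTypeR R -> \bar R) x).
  exact: fubini_tonelli1.
rewrite ge0_integral_pushforward//; last 2 first.
- exact: measurable_fun_fubini_tonelli_F.
- by move=> z _; apply: integral_ge0.
apply: eq_integral => w _ /=; rewrite /fubini_F.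
by rewrite ge0_integral_pushforward//; exact: measurable_fun_pair2.
Qed.

Lemma measurable_integral_without (F : without * R -> \bar R) :
  measurable_fun setT F -> (forall z, 0 <= F z) ->
  measurable_fun setT (fun w => \int[P]_w' F (w, X i w')).
Proof.
move=> mF F0.
have mG : measurable_fun setT (fun z : without * T => F (z.1, X i z.2)).
  apply: (measurableT_comp mF); apply: measurable_fun_pair => //.
  exact: (measurableT_comp (mX i) measurable_snd).
rewrite (_ : (fun w => _) = fubini_F P (fun z : without * T => F (z.1, X i z.2)))//.
by apply: measurable_fun_fubini_tonelli_F => // z.
Qed.

End indep.

(** * Truncated moments and Laplace transform of the exponential clock *)

Section exponential_law.
Local Open Scope ereal_scope.
Context d (T : measurableType d) (R : realType) (P : probability T R).
Variable X : T -> R.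
Hypothesis mX : measurable_fun setT X.
Hypothesis lawX : forall A, measurable A -> P (X @^-1` A) = exponential_prob 1 A.
Local Notation mu := (@lebesgue_measure R).

Lemma exponential_integral (f : R -> \bar R) : measurable_fun setT f ->
  (forall x, 0 <= f x) ->
  \int[P]_w f (X w) = \int[mu]_(x in `[0%R, +oo[) (f x * (expR (- x))%:E).
Proof.
move=> mf f0.
have mX' : measurable_fun setT (X : T -> measurableTypeR R) by exact: mX.
pose gm : {mfun T >-> measurableTypeR R} := @mfun_Sub _ _ T (measurableTypeR R) _ (mem_set mX').
transitivity (\int[distribution P gm]_x f x).
  by rewrite ge0_integral_pushforward.
have mpdf : @measurable_fun _ _ (measurableTypeR R) (measurableTypeR R) setT (exponential_pdf (1:R)).
  exact: measurable_exponential_pdf.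
rewrite (@ge0_integral_density _ _ _ mu (distribution P gm) (exponential_pdf 1) mpdf)//.
- rewrite [RHS]integral_mkcond; apply: eq_integral => x _.
  rewrite patchE; case: ifPn => [|/negP x0].
    by rewrite inE/= in_itv/= andbT => x0; rewrite exponential_pdfE// mul1r mulN1r.
  rewrite lt0_exponential_pdf ?mule0// ltNge; apply/negP => x0'.
  by apply: x0; rewrite inE/= in_itv/= x0'.
- by move=> x; rewrite exponential_pdf_ge0.
Qed.

Lemma exponential_integral_gt (s : R) (g : R -> R) : (0 <= s)%R ->
  measurable_fun setT g -> (forall x, (s <= x)%R -> (0 <= g x)%R) ->
  \int[P]_w (if (s < X w)%R then g (X w) else 0%R)%:E =
  \int[mu]_(x in `[s, +oo[) (g x * expR (- x))%:E.
Proof.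
move=> s0 mg g0.
have mif : measurable_fun setT (fun x => (if (s < x)%R then g x else 0%R)%:E).
  apply/measurable_EFinP; apply: measurable_fun_ifT => //.
  exact: measurable_fun_ltr.
rewrite (exponential_integral mif); last first.
  by move=> x; rewrite lee_fin; case: ifPn => // /ltW; exact: g0.
rewrite -[RHS]integral_itv_obnd_cbnd; last first.
  apply/measurable_EFinP/measurable_funTS/measurable_funM => //.
  exact/measurableT_comp.
rewrite integral_mkcond [RHS]integral_mkcond; apply: eq_integral => x _.
rewrite !patchE; have [xs|xs] := ltP s x.
  by rewrite !ifT ?EFinM// inE/= in_itv/= ?andbT ?xs// (le_trans s0)// ltW.
rewrite mul0e [RHS]ifF; first by case: ifP.
by apply/negP; rewrite inE/= in_itv/= andbT ltNge xs.
Qed.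

(** Half of the exponent absorbs the polynomial: exp(x/2) >= x^2/8, so 5 x^2 exp(-x) <= 40
    exp(-x/2). *)
Lemma cvg_sqr_expRN (s : R) (p : R -> R) :
  (forall x, (1 <= x)%R -> (s <= x)%R -> (`|p x| <= 5 * x ^+ 2)%R) ->
  (0 <= s)%R -> ((p x * expR (- x))%R @[x --> +oo%R] --> (0:R)%R)%classic.
Proof.
move=> hp s0.
have h40 : (40 * expR (- (2^-1 * x)))%R @[x --> +oo%R] --> (0:R)%R.
  rewrite -[X in _ --> X](mulr0 40%R); apply: cvgM; first exact: cvg_cst.
  apply: (@cvg_comp _ _ _ (fun x => 2^-1 * x)%R (fun z => expR (- z)) _ (pinfty_nbhs R)); last exact: cvgr_expR.
  by apply: gt0_cvgMry => //; rewrite invr_gt0.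
apply/cvgr0Pnorm_le => e e0.
have /cvgr0_norm_le/(_ _ e0) h := h40.
near=> x; apply: le_trans (_ : `|40 * expR (- (2^-1 * x))| <= e)%R; last by near: x.
have x1 : (1 <= x)%R by near: x; apply: nbhs_pinfty_ge; exact: num_real.
have xs : (s <= x)%R by near: x; apply: nbhs_pinfty_ge; exact: num_real.
rewrite normrM (ger0_norm (expR_ge0 _)) [leRHS]ger0_norm ?mulr_ge0 ?expR_ge0//.
have -> : (- x = - (2^-1 * x) + - (2^-1 * x))%R by field.
rewrite expRD mulrA ler_wpM2r ?expR_ge0//.
apply: (@le_trans _ _ (5 * x ^+ 2 * expR (- (2^-1 * x)))%R).
  by rewrite ler_wpM2r ?expR_ge0// hp.
rewrite expRN ler_pdivrMr ?expR_gt0//.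
have x20 : (0 <= 2^-1 * x)%R by rewrite mulr_ge0// (le_trans ler01 x1).
have := @expR_ge1Dxn R (2^-1 * x) 1 x20.
rewrite /= (_ : 2`!%:R = 2%R)//; nra.
Unshelve. all: by end_near. Qed.

(** When p' = p - g, the function - p exp(-x) is an antiderivative of g exp(-x), so only its value
    at [s] remains. The bound 5 x^2 is large enough for the biggest [p] used, (x - s)^2 + 2 (x - s)
    + 2 with 1 + 2 + 2 = 5. *)
Lemma exponential_FTC (s : R) (g p : R -> R) (c : R) : (0 <= s)%R ->
  continuous g -> (forall x, (s <= x)%R -> (0 <= g x)%R) ->
  (forall x : R, is_derive x (1:R)%R p (p x - g x)%R) ->
  (forall x, (1 <= x)%R -> (s <= x)%R -> (`|p x| <= 5 * x ^+ 2)%R) ->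
  p s = c ->
  \int[P]_w (if (s < X w)%R then g (X w) else 0%R)%:E = (c * expR (- s))%:E.
Proof.
move=> s0 cg g0 dp hp ps.
have dF (x : R) : is_derive x (1:R)%R (fun x => - (p x * expR (- x)))%R (g x * expR (- x))%R.
  have dpx := dp x.
  apply: is_derive_eq.
  rewrite /GRing.scale/=; ring.
rewrite exponential_integral_gt//; last exact: continuous_measurable_fun.
rewrite (@ge0_continuous_FTC2y _ _ (fun x => - (p x * expR (- x)))%R _ 0%R).
- by rewrite ps EFinN oppeK add0e.
- by move=> x sx; rewrite mulr_ge0 ?expR_ge0// g0.
- apply: continuous_subspaceT => x; apply: cvgM; first exact: cg.
  by apply: continuous_comp; [exact: continuousN|exact: continuous_expR].
- by rewrite -oppr0; apply: cvgN; exact: (cvg_sqr_expRN hp).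
- by move=> x sx; have [] := dF x.
- have : derivable (fun x => - (p x * expR (- x)))%R s 1 by have [] := dF s.
  move/derivable1_diffP/differentiable_continuous => cF.
  exact: cvg_at_right_filter.
- by move=> x sx; rewrite derive1E; have [_ ->] := dF x.
Qed.

(** Lack of memory, here and in the next two lemmas: beyond [s] the excess [X - s] is again standard
    exponential, with moments m! for m = 0, 1, 2, and exp(-s) is the probability of getting beyond
    [s]. *)
Lemma exponential_tail (s : R) : (0 <= s)%R ->
  \int[P]_w (if (s < X w)%R then 1%R else 0%R)%:E = (expR (- s))%:E.
Proof.
move=> s0; rewrite -[expR _]mul1r.
refine (@exponential_FTC s (fun=> 1%R) (fun=> 1%R) 1%R s0 _ _ _ _ _) => //.
- by move=> x; exact: cvg_cst.
- by move=> x; rewrite subrr; exact: is_derive_cst.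
- move=> x x1 _; rewrite normr1; nra.
Qed.

Lemma exponential_tail1 (s : R) : (0 <= s)%R ->
  \int[P]_w (if (s < X w)%R then X w - s else 0%R)%:E = (expR (- s))%:E.
Proof.
move=> s0; rewrite -[expR _]mul1r.
refine (@exponential_FTC s (fun x => x - s)%R (fun x => x - s + 1)%R 1%R s0 _ _ _ _ _).
- by move=> x; apply: cvgB; [exact: cvg_id|exact: cvg_cst].
- by move=> x; rewrite subr_ge0.
- move=> x; apply: is_derive_eq; ring.
- move=> x x1 sx; rewrite ger0_norm; nra.
- by rewrite subrr add0r.
Qed.

Lemma exponential_tail2 (s : R) : (0 <= s)%R ->
  \int[P]_w (if (s < X w)%R then (X w - s) ^+ 2 else 0%R)%:E = (2 * expR (- s))%:E.
Proof.
move=> s0; refine (@exponential_FTC s (fun x => (x - s) ^+ 2)%R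
  (fun x => (x - s) ^+ 2 + 2 * (x - s) + 2)%R 2%R s0 _ _ _ _ _).
- move=> x; rewrite /continuous_at; under eq_fun do rewrite expr2; rewrite expr2.
  by apply: cvgM; (apply: cvgB; [exact: cvg_id|exact: cvg_cst]).
- by move=> x _; exact: sqr_ge0.
- move=> x; apply: is_derive_eq.
  rewrite /GRing.scale/=; ring.
- move=> x x1 sx; rewrite ger0_norm; nra.
- by rewrite subrr; ring.
Qed.

(** Up to the factor 1 / (1 + a), the integrand times the density is the exponential density of rate
    1 + a. *)
Lemma exponential_laplace (a : R) : (0 <= a)%R ->
  \int[P]_w (expR (- (a * X w)))%:E = ((1 + a)^-1)%:E.
Proof.
move=> a0; have a1 : (0 < 1 + a)%R by rewrite ltr_wpDr.
rewrite (@exponential_integral (fun x => (expR (- (a * x)))%:E)); last 2 first.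
- apply/measurable_EFinP/measurableT_comp => //; apply/measurableT_comp => //.
- by move=> x; rewrite lee_fin expR_ge0.
transitivity (\int[mu]_x (((1 + a)^-1)%:E * (exponential_pdf (1 + a) x)%:E)).
  rewrite integral_mkcond; apply: eq_integral => x _.
  rewrite patchE; case: ifPn => [|/negP x0].
    rewrite inE/= in_itv/= andbT => x0; rewrite exponential_pdfE// -!EFinM -expRD.
    by rewrite mulrA mulVf ?gt_eqF// mul1r; congr (expR _)%:E; ring.
  rewrite lt0_exponential_pdf ?mule0// ltNge; apply/negP => x0'.
  by apply: x0; rewrite inE/= in_itv/= x0'.
rewrite ge0_integralZl//; last 3 first.
- by apply/measurable_EFinP; exact: measurable_exponential_pdf.
- by move=> x _; rewrite lee_fin exponential_pdf_ge0// ltW.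
- by rewrite lee_fin invr_ge0 ltW.
by rewrite integral_exponential_pdf// mule1.
Qed.


Lemma exponential_moment_infinite : \int[P]_w (expR (X w))%:E = +oo.
Proof.
rewrite (@exponential_integral (fun x => (expR x)%:E)); last 2 first.
- exact/measurable_EFinP.
- by move=> x; rewrite lee_fin expR_ge0.
under eq_integral do rewrite -EFinM expRxMexpNx_1.
transitivity (1%:E * mu `[0%R, +oo[); last by rewrite lebesgue_measure_itv/= ltry ?oppr0 ?adde0 mul1e.
by rewrite -integral_cst.
Qed.
End exponential_law.

(** * Convergence in mean implies convergence in law *)

Section weak_convergence.
Context d (T : measurableType d) (R : realType) (P : probability T R).

(** Compactness of [-K, K]. The point [y] may leave the segment, so the neighbourhoods of the cover
    are used at half their radius. *)
Lemma unif_continuous_segment (f : R -> R) (K e : R) : continuous f -> 0 < e ->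
  exists2 dl : R, 0 < dl &
    forall x y, `|x| <= K -> `|y - x| < dl -> `|f y - f x| <= e.
Proof.
move=> cf e0.
have /compact_near_coveringP cK : compact `[- K, K]%classic by exact: segment_compact.
pose Q (dl x : R) := forall y, `|y - x| < dl -> `|f y - f x| <= e.
have : \forall dl \near 0^'+, `[- K, K]%classic `<=` Q dl.
  apply: cK => x _.
  have e2 : 0 < e / 2 by rewrite divr_gt0.
  have /cvgrPdist_lt/(_ _ e2) := cf x.
  move=> /nbhs_ballP[eta /= eta0 h].
  have eta2 : 0 < eta / 2 by rewrite divr_gt0.
  near=> x' dl => y /= yx'.
  have dl2 : dl < eta / 2 by near: dl; exact: nbhs_right_lt.
  have x'x : `|x - x'| < eta / 2.
    by near: x'; apply/nbhs_ballP; exists (eta / 2).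
  have h1 : `|f x - f x'| < e / 2 by apply: h => /=; rewrite /ball/=; lra.
  have h2 : `|f x - f y| < e / 2.
    apply: h; rewrite /ball/= (_ : x - y = (x - x') - (y - x')); last by ring.
    by rewrite (le_lt_trans (ler_normB _ _))//; lra.
  rewrite (_ : f y - f x' = (f x - f x') - (f x - f y)); last by ring.
  by rewrite (le_trans (ler_normB _ _))//; lra.
move=> h; near (0:R)^'+ => dl; exists dl => //.
move=> x y xK yx; have : `[- K, K]%classic `<=` Q dl by near: dl.
by apply => //=; rewrite in_itv/= -ler_norml.
Unshelve. all: by end_near. Qed.

(** A bounded continuous [f] is uniformly continuous only on segments. If |Y| <= K and |X - Y| < dl
    the difference of values is at most e/3; otherwise it is at most 2M, which is dominated by
    (2M/K) |Y| or by (2M/dl) |X - Y|, as in Markov's inequality. *)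
Lemma cvg_in_law_of_L1 (X : R -> T -> R) (Y : T -> R) :
  (forall L, measurable_fun setT (X L)) -> measurable_fun setT Y ->
  (\int[P]_w (`|Y w|)%:E < +oo)%E ->
  (\int[P]_w (`|X L w - Y w|)%:E)%E @[L --> +oo] --> 0%E ->
  forall f : R -> R, continuous f -> (exists M : R, forall x, `|f x| <= M) ->
  (\int[P]_w (f (X L w))%:E)%E @[L --> +oo] --> (\int[P]_w (f (Y w))%:E)%E.
Proof.
move=> mX mY iY h f cf [M fM].
have M0 : 0 <= M by exact: le_trans (fM 0).
have mf : measurable_fun setT f by exact: continuous_measurable_fun.
have ifZ (Z : T -> R) : measurable_fun setT Z -> P.-integrable setT (EFin \o (f \o Z)).
  move=> mZ; apply: measurable_bounded_integrable => //.
  - by rewrite ltey_eq fin_num_measure.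
  - exact: measurableT_comp.
  - exists M; split; first exact: num_real.
    by move=> x Mx z _ /=; rewrite (le_trans (fM _))// ltW.
have fin (Z : T -> R) : measurable_fun setT Z -> (\int[P]_w (f (Z w))%:E)%E \is a fin_num.
  by move=> mZ; apply: (integrable_fin_num measurableT (ifZ _ mZ)).
pose mu1 := fine (\int[P]_w (`|Y w|)%:E)%E.
have mu1E : (\int[P]_w (`|Y w|)%:E)%E = mu1%:E.
  by rewrite fineK// ge0_fin_numE//; apply: integral_ge0 => w _; rewrite lee_fin.
have mu10 : 0 <= mu1.
  by rewrite fine_ge0//; apply: integral_ge0 => w _; rewrite lee_fin.
rewrite -(fineK (fin _ mY)); apply/fine_cvgP; split.
  by near=> L; exact: fin.
apply/cvgrPdist_le => e e0.
have e3 : 0 < e / 3 by rewrite divr_gt0.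
(* [K] brings the term (2M/K) E|Y| below e/3, and [eta] does the same for the term in |X - Y|; the
   added 1 in each keeps the denominators positive when M vanishes. *)
pose K := (2 * M * mu1) / (e / 3) + 1.
have K0 : 0 < K by rewrite ltr_wpDl// divr_ge0 ?mulr_ge0// ltW.
have [dl dl0 hdl] := unif_continuous_segment K cf e3.
pose eta := (e / 3) * dl / (2 * M + 1).
have eta0 : 0 < eta by rewrite !divr_gt0 ?mulr_gt0// ltr_wpDl// mulr_ge0.
have near_eta : \forall L \near +oo, (\int[P]_w (`|X L w - Y w|)%:E < eta%:E)%E.
  move/fine_cvgP : h => [hf /cvgrPdist_lt/(_ _ eta0) h].
  near=> L'.
  rewrite -(@fineK _ (\int[P]_w _)%E); last by near: L'.
  rewrite lte_fin; have : `|0 - fine (\int[P]_w (`|X L' w - Y w|)%:E)%E| < eta by near: L'.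
  rewrite sub0r normrN; exact/le_lt_trans/ler_norm.
near=> L.
have hL : (\int[P]_w (`|X L w - Y w|)%:E <= eta%:E)%E by apply: ltW; near: L.
rewrite /= -lee_fin -abse_EFin EFinB !fineK ?fin//.
rewrite -integralB_EFin//; [|exact: (ifZ _ mY)|exact: (ifZ _ (mX L))].
apply: (le_trans (le_abse_integral _ _ _)) => //.
  by apply: emeasurable_funB; apply/measurable_EFinP; exact: measurableT_comp.
have mXY : measurable_fun setT (fun w => `|X L w - Y w|).
  by apply: measurableT_comp => //; exact: measurable_funB.
have maY : measurable_fun setT (fun w => `|Y w|) by exact: measurableT_comp.
apply: (@le_trans _ _ (\int[P]_w ((e / 3)%:E + ((2 * M / K)%:E * (`|Y w|)%:E +
   (2 * M / dl)%:E * (`|X L w - Y w|)%:E)))%E).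
  apply: ge0_le_integral => //.
  - apply: measurableT_comp => //.
    by apply: emeasurable_funB; apply/measurable_EFinP; exact: measurableT_comp.
  - apply: emeasurable_funD => //; apply: emeasurable_funD.
      by apply/measurable_EFinP; exact: measurable_funM.
    by apply/measurable_EFinP; exact: measurable_funM.
  move=> w _; rewrite -EFinB abse_EFin -!EFinM -!EFinD lee_fin.
  have t1 : 0 <= 2 * M / K * `|Y w| by rewrite !mulr_ge0// invr_ge0 ltW.
  have t2 : 0 <= 2 * M / dl * `|X L w - Y w| by rewrite !mulr_ge0// invr_ge0 ltW.
  have t0 := ltW e3.
  have t3 : `|f (Y w) - f (X L w)| <= 2 * M.
    by rewrite (le_trans (ler_normB _ _))// mulr2n mulrDl !mul1r lerD.
  have [YK|YK] := leP `|Y w| K; last first.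
    rewrite (le_trans t3)//; have : 2 * M <= 2 * M / K * `|Y w|; last by lra.
    by rewrite -mulrA ler_peMr ?mulr_ge0// mulrC ler_pdivlMr// mul1r ltW.
  have [XY|XY] := ltP `|X L w - Y w| dl; last first.
    rewrite (le_trans t3)//; have : 2 * M <= 2 * M / dl * `|X L w - Y w|; last by lra.
    by rewrite -mulrA ler_peMr ?mulr_ge0// mulrC ler_pdivlMr// mul1r.
  by rewrite distrC (le_trans (hdl _ _ YK XY))//; lra.
have MK0 : 0 <= 2 * M / K by rewrite !mulr_ge0// invr_ge0 ltW.
have Mdl0 : 0 <= 2 * M / dl by rewrite !mulr_ge0// invr_ge0 ltW.
rewrite ge0_integralD//; last 3 first.
- by move=> w _; rewrite lee_fin ltW.
- by move=> w _; rewrite -!EFinM -!EFinD lee_fin addr_ge0//; apply: mulr_ge0.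
- by apply: emeasurable_funD; apply/measurable_EFinP; exact: measurable_funM.
rewrite ge0_integralD//; last 4 first.
- by move=> w _; rewrite -!EFinM lee_fin mulr_ge0.
- by apply/measurable_EFinP; exact: measurable_funM.
- by move=> w _; rewrite -!EFinM lee_fin mulr_ge0.
- by apply/measurable_EFinP; exact: measurable_funM.
rewrite !ge0_integralZl_EFin//; last 2 first.
- exact/measurable_EFinP.
- exact/measurable_EFinP.
rewrite integral_cst_probability mu1E.
apply: (@le_trans _ _ ((e / 3)%:E + ((2 * M / K * mu1)%:E + (2 * M / dl * eta)%:E))%E).
  apply: leeD2l; rewrite -EFinM; apply: leeD2l.
  by rewrite [X in (_ <= X)%E]EFinM lee_wpmul2l.
rewrite -!EFinD lee_fin.
have h1 : 2 * M / K * mu1 <= e / 3.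
  rewrite mulrAC ler_pdivrMr// /K mulrDr mulr1.
  rewrite [leRHS](_ : _ = 2 * M * mu1 + e / 3); last by field; rewrite gt_eqF.
  by rewrite lerDl ltW.
have h2 : 2 * M / dl * eta <= e / 3.
  rewrite /eta [leLHS](_ : _ = (2 * M / (2 * M + 1)) * (e / 3)); last first.
    by field; rewrite !gt_eqF//= ltr_wpDl// mulr_ge0.
  rewrite ler_piMl ?(ltW e3)// ler_pdivrMr ?ltr_wpDl ?mulr_ge0// mul1r.
  by rewrite lerDl.
lra.
Unshelve. all: by end_near. Qed.
End weak_convergence.

(** * Limits of geometrically Cauchy sequences in mean square *)

Section L2_limit.
Context d (T : measurableType d) (R : realType) (P : probability T R).
Variables (N : nat -> T -> R) (C rho : R).
Hypotheses (mN : forall n, measurable_fun setT (N n)) (C0 : 0 <= C)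
  (rho0 : 0 < rho) (rho1 : rho < 1).
Hypothesis hN : forall n m, (n <= m)%N ->
  (\int[P]_w ((N m w - N n w) ^+ 2)%:E <= (C * rho ^+ n)%:E)%E.

(** A limit superior is defined at every point, so it is measurable for any sigma-algebra that makes
    all [N n] measurable. This is used later for a coarse one of the form [without]. *)
Definition L2_lim (w : T) : R := fine (limn_esup (fun n => (N n w)%:E)).

Lemma measurable_L2_lim : measurable_fun setT L2_lim.
Proof.
apply: (measurableT_comp (fine_measurable measurableT)).
by apply: measurable_fun_limn_esup => n; exact/measurable_EFinP.
Qed.

Let s := Num.sqrt rho.
Let s0 : 0 < s. Proof. by rewrite sqrtr_gt0. Qed.
Let s1 : s < 1. Proof. by rewrite -sqrtr1 ltr_sqrt. Qed.
Let ss : s ^+ 2 = rho. Proof. by rewrite sqr_sqrtr// ltW. Qed.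

(** The inequality |x| <= a + x^2 / a with a = s^n replaces Cauchy-Schwarz; as s^2 = rho, both terms
    are of order s^n. *)
Let increment_le n :
  (\int[P]_w (`|N n.+1 w - N n w|)%:E <= ((1 + C) * s ^+ n)%:E)%E.
Proof.
have sn0 : 0 < s ^+ n by rewrite exprn_gt0.
have mD : measurable_fun setT (fun w => N n.+1 w - N n w) by exact: measurable_funB.
apply: (@le_trans _ _ (\int[P]_w ((s ^+ n)%:E + (s ^- n)%:E * ((N n.+1 w - N n w) ^+ 2)%:E))%E).
  apply: ge0_le_integral => //.
  - by apply/measurable_EFinP; exact: measurableT_comp.
  - apply: emeasurable_funD => //; apply/measurable_EFinP/measurable_funM => //.
    exact: measurable_funX.
  move=> w _; rewrite -EFinM -EFinD lee_fin.
  set x := N n.+1 w - N n w; rewrite -(real_normK (num_real x)).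
  rewrite -(ler_pM2l sn0) mulrDr mulrA divff ?gt_eqF// mul1r.
  have := sqr_ge0 (s ^+ n - `|x|); have := normr_ge0 x; nra.
rewrite ge0_integralD//; last 3 first.
- by move=> w _; rewrite lee_fin ltW.
- by move=> w _; rewrite -EFinM lee_fin mulr_ge0 ?sqr_ge0// invr_ge0 ltW.
- by apply/measurable_EFinP/measurable_funM => //; exact: measurable_funX.
rewrite integral_cst_probability ge0_integralZl_EFin//; last 3 first.
- by move=> w _; rewrite lee_fin sqr_ge0.
- by apply/measurable_EFinP; exact: measurable_funX.
- by rewrite invr_ge0 ltW.
apply: (@le_trans _ _ ((s ^+ n)%:E + (s ^- n)%:E * (C * rho ^+ n)%:E)%E).
  by rewrite leeD2l// lee_wpmul2l ?lee_fin ?invr_ge0 ?(ltW sn0)// hN.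
rewrite -EFinM -EFinD lee_fin mulrDl mul1r lerD2l -ss exprAC.
by rewrite mulrCA expr2 mulKf// gt_eqF.
Qed.

Let increments_finite : {ae P, forall w, (\sum_(n <oo) (`|N n.+1 w - N n w|)%:E < +oo)%E}.
Proof.
have mD n : measurable_fun setT (fun w => (`|N n.+1 w - N n w|)%:E).
  by apply/measurable_EFinP/measurableT_comp => //; exact: measurable_funB.
have : P.-integrable setT (fun w => \sum_(n <oo) (`|N n.+1 w - N n w|)%:E)%E.
  apply/integrableP; split.
    by apply: ge0_emeasurable_sum => // n w _ _; rewrite lee_fin.
  rewrite (eq_integral (fun w => \sum_(n <oo) (`|N n.+1 w - N n w|)%:E)%E); last first.
    by move=> w _; rewrite gee0_abs//; apply: nneseries_ge0 => n _ _; rewrite lee_fin.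
  rewrite integral_nneseries//.
  apply: (@le_lt_trans _ _ (((1 + C) * (1 - s)^-1)%:E)%E); last exact: ltry.
  apply: lime_le.
    by apply: is_cvg_nneseries => n _ _; apply: integral_ge0 => w _; rewrite lee_fin.
  apply: nearW => k; rewrite /=.
  apply: (@le_trans _ _ (\sum_(0 <= n < k) ((1 + C) * s ^+ n)%:E)%E).
    by apply: lee_sum => n _; exact: increment_le.
  rewrite sumEFin lee_fin -mulr_sumr ler_wpM2l ?addr_ge0//.
  rewrite -[leRHS]mul1r ler_pdivlMr ?subr_gt0// big_mkord mulrC.
  have := subrX1 s k; have := exprn_ge0 k (ltW s0); nra.
move=> /(integrable_ae measurableT); apply: filterS => w /(_ I).
by rewrite ge0_fin_numE//; apply: nneseries_ge0 => n _ _; rewrite lee_fin.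
Qed.

Let cvg_L2_lim : {ae P, forall w, N n w @[n --> \oo] --> L2_lim w}.
Proof.
move: increments_finite; apply: filterS => w h.
have cN : cvgn (fun n => N n w).
  have : cvgn (series (fun n => N n.+1 w - N n w)).
    apply: normed_cvg.
    apply: nondecreasing_is_cvgn.
      apply/nondecreasing_seqP => n.
      change (series (fun k => `|N k.+1 w - N k w|) n <= series (fun k => `|N k.+1 w - N k w|) n.+1).
      by rewrite seriesSr lerDl.
    exists (fine (\sum_(n <oo) (`|N n.+1 w - N n w|)%:E)%E) => _ [n _ <-].
    rewrite -lee_fin fineK; last first.
      by rewrite ge0_fin_numE//; apply: nneseries_ge0 => k _ _; rewrite lee_fin.
    rewrite /series/= -sumEFin.
    by apply: nneseries_lim_ge => k _ _; rewrite lee_fin.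
  move=> cs; rewrite (_ : (fun n => N n w) = (fun n => N 0%N w + series (fun n => N n.+1 w - N n w) n)).
    by apply: is_cvgD => //; exact: is_cvg_cst.
  by apply/funext => n; rewrite /series/= telescope_sumr// addrC subrK.
rewrite /L2_lim is_cvg_limn_esupE; last first.
  by apply/cvg_ex; exists (limn (fun n => N n w))%:E; exact: cvg_EFin_comp.
rewrite EFin_lim//.
Qed.

(** Summable increments give almost sure convergence; Fatou's lemma then passes the Cauchy estimate
    to the limit in its larger index. *)
Lemma L2_lim_le n : (\int[P]_w ((L2_lim w - N n w) ^+ 2)%:E <= (C * rho ^+ n)%:E)%E.
Proof.
pose g m w := ((N (m + n)%N w - N n w) ^+ 2)%:E.
have mg m : measurable_fun setT (g m).
  by apply/measurable_EFinP/measurable_funX/measurable_funB.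
have g0 m w : (0 <= g m w)%E by rewrite lee_fin sqr_ge0.
apply: (@le_trans _ _ (\int[P]_w limn_einf (g^~ w))%E).
  apply: ae_ge0_le_integral => //.
  - by move=> w _; rewrite lee_fin sqr_ge0.
  - by apply/measurable_EFinP/measurable_funX/measurable_funB => //; exact: measurable_L2_lim.
  - move=> w _; rewrite limn_einf_lim; apply: lime_ge; first exact: is_cvg_einfs.
    by apply: nearW => m; apply: le_ereal_inf_tmp => _ [k _ <-]; exact: g0.
  - apply: (emeasurable_fun_cvg (fun k w => einfs (g^~ w) k)) => [k|w _].
      exact: measurable_fun_einfs.
    by rewrite limn_einf_lim; exact: is_cvg_einfs.
  move: cvg_L2_lim; apply: filterS => w cw _.
  suff : g^~ w @ \oo --> ((L2_lim w - N n w) ^+ 2)%:E.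
    by move=> cg; rewrite is_cvg_limn_einfE; [rewrite (cvg_lim _ cg)|apply/cvg_ex; eexists; exact: cg].
  rewrite expr2.
  apply: (@cvg_EFin_comp _ _ _ _ (fun m => (N (m + n)%N w - N n w) * (N (m + n)%N w - N n w))).
  by apply: cvgM; (apply: cvgB; [rewrite (cvg_shiftn n (fun m => N m w))|exact: cvg_cst]).
apply: (le_trans (fatou _ _ _ _)) => //.
rewrite limn_einf_lim; apply: lime_le; first exact: is_cvg_einfs.
apply: nearW => m; apply: (@le_trans _ _ (\int[P]_w g m w)%E).
  by apply: ereal_inf_lbound; exists m => /=.
by apply: hN; rewrite leq_addl.
Qed.
End L2_limit.

(** * Exponential moments of normal laws *)

Section gaussian.
Context (R : realType).

(** Completing the square: the weight exp(-x) turns the normal density of mean m into exp(s^2/2 - m)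
    times the one of mean m - s^2. *)
Lemma normal_exp_moment (m s : R) : s != 0 ->
  (\int[normal_prob m s]_x (expR (- x))%:E < +oo)%E.
Proof.
move=> s0.
rewrite (@ge0_integral_density _ _ _ lebesgue_measure (normal_prob m s) (normal_pdf m s))//; last 3 first.
- exact: measurable_normal_pdf.
- by move=> x; rewrite normal_pdf_ge0.
- by apply/measurable_EFinP/measurableT_comp.
pose m' := m - s ^+ 2.
apply: (@le_lt_trans _ _ (\int[lebesgue_measure]_x ((expR (s ^+ 2 / 2 - m))%:E * (normal_pdf m' s x)%:E))%E).
  rewrite le_eqVlt; apply/orP; left; apply/eqP; apply: eq_integral => x _; rewrite -!EFinM !normal_pdfE// /normal_fun/=; congr EFin.
  rewrite mulrCA [RHS]mulrCA; congr (_ * _); rewrite -!expRD; congr expR.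
  by rewrite /m'; field.
rewrite ge0_integralZl_EFin//; last 2 first.
- by move=> x _; rewrite lee_fin normal_pdf_ge0.
- by apply/measurable_EFinP; exact: measurable_normal_pdf.
by rewrite integral_normal_pdf mule1 ltry.
Qed.
End gaussian.

(** * Iterated integrals over a list of coordinates *)

Section iterated_integral.
Context (R : realType) (d : nat).
Implicit Types (s : seq 'I_d) (x : 'I_d -> R).

(* Measurability is tested along measurable parametrizations of the point:
   this stands in for a product sigma-algebra on 'I_d -> R. *)
Definition coord_measurable {d1} {S : measurableType d1}
    (f : S -> ('I_d -> R) -> \bar R) : Prop :=
  forall d' (T' : measurableType d') (p : T' -> S) (x : 'I_d -> T' -> R),
    measurable_fun setT p -> (forall k, measurable_fun setT (x k)) ->
    measurable_fun setT (fun t => f (p t) (fun k => x k t)).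

Context {d1} {S : measurableType d1}.
Implicit Types f g : S -> ('I_d -> R) -> \bar R.

Lemma iter_int_ge0 s (h : ('I_d -> R) -> \bar R) x : (forall z, 0 <= h z)%E ->
  (0 <= iter_int s h x)%E.
Proof. by move=> h0; elim: s x => //= j s IH x; apply: integral_ge0. Qed.

(** Since [coord_measurable] quantifies over every parameter space, the integration variable can be
    adjoined to it as one more factor, and the induction goes through with Tonelli. *)
Lemma coord_measurable_iter_int s f : coord_measurable f ->
  (forall w z, 0 <= f w z)%E -> coord_measurable (fun w => iter_int s (f w)).
Proof.
move=> mf f0; elim: s => [|j s IH] //= d' T' p x mp mx.
pose F (z : T' * measurableTypeR R) :=
  iter_int s (f (p z.1)) (fun k => if k == j then z.2 else x k z.1).
apply: (@measurable_fun_fubini_tonelli_F _ _ _ _ _ lebesgue_measure F).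
  apply: (IH _ _ (p \o fst) (fun k z => if k == j then z.2 else x k z.1)).
    exact: measurableT_comp.
  move=> k; case: (k == j); first exact: measurable_snd.
  by apply: (measurableT_comp (mx k)); exact: measurable_fst.
by move=> z; apply: iter_int_ge0.
Qed.

Lemma coord_measurable_slice f j w x : coord_measurable f ->
  @measurable_fun _ _ (measurableTypeR R) _ setT
    (fun t => f w (fun k => if k == j then t else x k)).
Proof.
move=> mf; apply: (mf _ _ (fun=> w) (fun k t => if k == j then t else x k)).
  exact: measurable_cst.
by move=> k; case: (k == j); [exact: measurable_id|exact: measurable_cst].
Qed.

Lemma iter_int_tonelli (m : {sigma_finite_measure set S -> \bar R}) s f x :
  coord_measurable f -> (forall w z, 0 <= f w z)%E ->
  (\int[m]_w iter_int s (f w) x = iter_int s (fun z => \int[m]_w f w z) x)%E.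
Proof.
move=> mf f0; elim: s x => [|j s IH]//= x.
pose F (z : S * measurableTypeR R) :=
  iter_int s (f z.1) (fun k => if k == j then z.2 else x k).
have mF : measurable_fun setT F.
  apply: (@coord_measurable_iter_int s f mf f0 _ _ fst
    (fun k z => if k == j then z.2 else x k)); first exact: measurable_fst.
  by move=> k; case: (k == j); [exact: measurable_snd|exact: measurable_cst].
transitivity (\int[m]_w \int[lebesgue_measure]_t F (w, t))%E; first by [].
rewrite (fubini_tonelli F mF); last by move=> z; apply: iter_int_ge0.
by apply: eq_integral => t _; rewrite -IH.
Qed.

Lemma iter_int_ext s (h1 h2 : ('I_d -> R) -> \bar R) x :
  (forall z, (forall k, k \notin s -> z k = x k) -> h1 z = h2 z) ->
  iter_int s h1 x = iter_int s h2 x.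
Proof.
elim: s x => [|j s IH] x h /=; first exact: h.
apply: eq_integral => t _; apply: IH => z hz; apply: h => k.
rewrite inE negb_or => /andP[/negbTE kj ks]; rewrite hz//; exact: ifF.
Qed.

(** One value of the first integrated coordinate is Lebesgue-null. This discards the diagonal, where
    the kernel of the variance formula is infinite. *)
Lemma iter_int_ext_off j s f g w x (a : R) : uniq (j :: s) ->
  coord_measurable f -> coord_measurable g ->
  (forall w z, 0 <= f w z)%E -> (forall w z, 0 <= g w z)%E ->
  (forall z, (forall k, k \notin j :: s -> z k = x k) -> z j != a -> f w z = g w z) ->
  iter_int (j :: s) (f w) x = iter_int (j :: s) (g w) x.
Proof.
move=> /= /andP[js _] mf mg f0 g0 h.
have mTa : measurable ([set: R] `\ a) by exact: measurableD.
rewrite -(@integral_setD1 R _ a setT)//; last first.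
  by apply: measurable_funTS; apply: (coord_measurable_slice j w x (coord_measurable_iter_int s mf f0)).
rewrite -[RHS](@integral_setD1 R _ a setT)//; last first.
  by apply: measurable_funTS; apply: (coord_measurable_slice j w x (coord_measurable_iter_int s mg g0)).
apply: eq_integral => t; rewrite inE => -[_ /= ta].
apply: iter_int_ext => z hz; apply: h => [k|].
  by rewrite inE negb_or => /andP[/negbTE kj ks]; rewrite hz//; exact: ifF.
by rewrite hz// eqxx; apply/eqP.
Qed.

Lemma iter_intZl s f w x (k : R) : coord_measurable f ->
  (forall w z, 0 <= f w z)%E -> 0 <= k ->
  (iter_int s (fun z => k%:E * f w z) x = k%:E * iter_int s (f w) x)%E.
Proof.
move=> mf f0 k0; elim: s x => //= j s IH x.
under eq_integral do rewrite IH.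
rewrite ge0_integralZl_EFin//; first by move=> t _; apply: iter_int_ge0.
exact: (coord_measurable_slice j w x (coord_measurable_iter_int s mf f0)).
Qed.

Lemma iter_int_sum (I : Type) (r : seq I) (f : I -> S -> ('I_d -> R) -> \bar R) s w x :
  (forall i, coord_measurable (f i)) -> (forall i w z, 0 <= f i w z)%E ->
  (iter_int s (fun z => \sum_(i <- r) f i w z) x = \sum_(i <- r) iter_int s (f i w) x)%E.
Proof.
move=> mf f0; elim: s x => //= j s IH x.
under eq_integral do rewrite IH.
rewrite ge0_integral_sum//; last by move=> i t _; apply: iter_int_ge0.
move=> i.
exact: (coord_measurable_slice j w x (coord_measurable_iter_int s (mf i) (f0 i))).
Qed.

Lemma iter_int_nneseries (f : nat -> S -> ('I_d -> R) -> \bar R) s w x :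
  (forall i, coord_measurable (f i)) -> (forall i w z, 0 <= f i w z)%E ->
  (iter_int s (fun z => \sum_(i <oo) f i w z) x = \sum_(i <oo) iter_int s (f i w) x)%E.
Proof.
move=> mf f0; elim: s x => //= j s IH x.
under eq_integral do rewrite IH.
rewrite integral_nneseries//; last by move=> i t _; apply: iter_int_ge0.
move=> i.
exact: (coord_measurable_slice j w x (coord_measurable_iter_int s (mf i) (f0 i))).
Qed.

End iterated_integral.

(** * Double iterated integrals *)

Section iterated_double.
Context (R : realType) (d : nat).
Implicit Types (s : seq 'I_d) (b : 'I_d -> R).

Definition iter_int2 s (h : ('I_d -> R) -> ('I_d -> R) -> \bar R) b : \bar R :=
  iter_int s (fun y => iter_int s (h y) b) b.

Definition coord_measurable2 {d1} {S : measurableType d1}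
    (f : S -> ('I_d -> R) -> ('I_d -> R) -> \bar R) : Prop :=
  forall d' (T' : measurableType d') (p : T' -> S) (y x : 'I_d -> T' -> R),
    measurable_fun setT p -> (forall k, measurable_fun setT (y k)) ->
    (forall k, measurable_fun setT (x k)) ->
    measurable_fun setT (fun t => f (p t) (fun k => y k t) (fun k => x k t)).

Context {d1} {S : measurableType d1}.
Implicit Types f g : S -> ('I_d -> R) -> ('I_d -> R) -> \bar R.

Lemma coord_measurable2_slice f y : coord_measurable2 f -> coord_measurable (fun w => f w y).
Proof.
by move=> mf d' T' p x mp mx; apply: (mf _ _ p (fun k _ => y k) x mp).
Qed.

Lemma coord_measurable2_iter s f d2 (S2 : measurableType d2) (p : S2 -> S) (b : 'I_d -> S2 -> R) :
  coord_measurable2 f -> (forall w y x, 0 <= f w y x)%E ->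
  measurable_fun setT p -> (forall k, measurable_fun setT (b k)) ->
  coord_measurable (fun t y => iter_int s (f (p t) y) (fun k => b k t)).
Proof.
move=> mf f0 mp mb d' T' q y mq my.
have mg : coord_measurable (fun t => f (p (q t)) (fun k => y k t)).
  move=> d3 T3 r x mr mx.
  apply: (mf _ _ (fun t => p (q (r t))) (fun k t => y k (r t)) x) => //.
  - exact: (measurableT_comp mp (measurableT_comp mq mr)).
  - by move=> k; exact: (measurableT_comp (my k) mr).
apply: (coord_measurable_iter_int s mg (fun _ _ => f0 _ _ _) (p := id) (x := fun k t => b k (q t))).
- exact: measurable_id.
- by move=> k; exact: (measurableT_comp (mb k) mq).
Qed.

Lemma coord_measurable2_iter_cst s f b : coord_measurable2 f ->
  (forall w y x, 0 <= f w y x)%E -> coord_measurable (fun w y => iter_int s (f w y) b).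
Proof.
by move=> mf f0; apply: (@coord_measurable2_iter s f _ S id (fun k _ => b k) mf f0).
Qed.

Lemma measurable_iter_int2 s f d2 (S2 : measurableType d2) (p : S2 -> S) (b : 'I_d -> S2 -> R) :
  coord_measurable2 f -> (forall w y x, 0 <= f w y x)%E ->
  measurable_fun setT p -> (forall k, measurable_fun setT (b k)) ->
  measurable_fun setT (fun t => iter_int2 s (f (p t)) (fun k => b k t)).
Proof.
move=> mf f0 mp mb.
have mg := coord_measurable2_iter s mf f0 mp mb.
have g0 t y : (0 <= iter_int s (f (p t) y) (fun k => b k t))%E by exact: iter_int_ge0.
exact: (coord_measurable_iter_int s mg g0 (p := id) (x := b)).
Qed.

Lemma iter_int2_ge0 s h b : (forall y x, 0 <= h y x)%E -> (0 <= iter_int2 s h b)%E.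
Proof. by move=> h0; apply: iter_int_ge0 => y; exact: iter_int_ge0. Qed.

Lemma iter_int2_tonelli (m : {sigma_finite_measure set S -> \bar R}) s f b :
  coord_measurable2 f -> (forall w y x, 0 <= f w y x)%E ->
  (\int[m]_w iter_int2 s (f w) b = iter_int2 s (fun y x => \int[m]_w f w y x) b)%E.
Proof.
move=> mf f0; rewrite /iter_int2 iter_int_tonelli.
- apply: iter_int_ext => y _; rewrite iter_int_tonelli//.
  exact: coord_measurable2_slice.
- exact: coord_measurable2_iter_cst.
- by move=> w y; exact: iter_int_ge0.
Qed.

Lemma coord_measurable2_integral (m : {sigma_finite_measure set S -> \bar R}) f
    d2 (S2 : measurableType d2) :
  coord_measurable2 f -> (forall w y x, 0 <= f w y x)%E ->
  coord_measurable2 (fun (_ : S2) y x => \int[m]_w f w y x)%E.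
Proof.
move=> mf f0 d' T' p y x _ my mx.
pose F (z : T' * S) := f z.2 (fun k => y k z.1) (fun k => x k z.1).
apply: (@measurable_fun_fubini_tonelli_F _ _ _ _ _ m F); last by move=> z; exact: f0.
apply: (mf _ _ snd (fun k z => y k z.1) (fun k z => x k z.1)); first exact: measurable_snd.
- by move=> k; exact: (measurableT_comp (my k) measurable_fst).
- by move=> k; exact: (measurableT_comp (mx k) measurable_fst).
Qed.

Lemma iter_int2_sum (I : Type) (r : seq I) (f : I -> S -> _) s w b :
  (forall i, coord_measurable2 (f i)) -> (forall i w y x, 0 <= f i w y x)%E ->
  (iter_int2 s (fun y x => \sum_(i <- r) f i w y x) b = \sum_(i <- r) iter_int2 s (f i w) b)%E.
Proof.
move=> mf f0; rewrite /iter_int2.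
rewrite -(iter_int_sum r (f := fun i w y => iter_int s (f i w y) b) s w b).
- by apply: iter_int_ext => y _; apply: (iter_int_sum r (f := fun i w => f i w y)) => // i;
    exact: coord_measurable2_slice.
- by move=> i; exact: coord_measurable2_iter_cst.
- by move=> i w' y; exact: iter_int_ge0.
Qed.

Lemma iter_int2_nneseries (f : nat -> S -> _) s w b :
  (forall i, coord_measurable2 (f i)) -> (forall i w y x, 0 <= f i w y x)%E ->
  (iter_int2 s (fun y x => \sum_(i <oo) f i w y x) b = \sum_(i <oo) iter_int2 s (f i w) b)%E.
Proof.
move=> mf f0; rewrite /iter_int2.
rewrite -(iter_int_nneseries (f := fun i w y => iter_int s (f i w y) b) s w b).
- by apply: iter_int_ext => y _; apply: (iter_int_nneseries (f := fun i w => f i w y)) => // i;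
    exact: coord_measurable2_slice.
- by move=> i; exact: coord_measurable2_iter_cst.
- by move=> i w' y; exact: iter_int_ge0.
Qed.

Lemma iter_int0 s b : iter_int s (fun=> 0%E) b = 0%E :> \bar R.
Proof. by elim: s b => //= j s IH b; rewrite integral0_eq// => t _; exact: IH. Qed.

End iterated_double.

(** * Measure of hyperplanes hitting boxes and segments; volumes of sections *)

Section boxes.
Context (R : realType) (d : nat).
Implicit Types (c : box R d) (i j : 'I_d).

Definition side c i : R := c.2 i - c.1 i.
Definition proper_box c := forall i, c.1 i <= c.2 i.
Definition lam c : R := \sum_i side c i.
Definition vol c : R := \prod_i side c i.
Definition face c i : R := \prod_(j | j != i) side c j.
Definition in_box c (x : 'I_d -> R) := [forall i, c.1 i <= x i <= c.2 i].

Lemma indic_box_set c x : \1_(box_set c) x = (in_box c x)%:R :> R.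
Proof.
rewrite indicE; congr (nat_of_bool _)%:R; apply/idP/idP => [|/forallP h].
  by rewrite inE => h; apply/forallP.
by rewrite inE.
Qed.

Lemma side_ge0 c i : proper_box c -> 0 <= side c i.
Proof. by move=> pc; rewrite subr_ge0. Qed.

Lemma lam_ge0 c : proper_box c -> 0 <= lam c.
Proof. by move=> pc; apply: sumr_ge0 => i _; exact: side_ge0. Qed.

Lemma vol_ge0 c : proper_box c -> 0 <= vol c.
Proof. by move=> pc; apply: prodr_ge0 => i _; exact: side_ge0. Qed.

Lemma face_ge0 c i : proper_box c -> 0 <= face c i.
Proof. by move=> pc; apply: prodr_ge0 => j _; exact: side_ge0. Qed.

Lemma vol_face c i : vol c = side c i * face c i.
Proof. by rewrite /vol (bigD1 i). Qed.

Lemma Lam_box c : proper_box c -> Lam (hits (box_set c)) = (lam c)%:E.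
Proof.
move=> pc; rewrite /Lam /lam -sumEFin; apply: eq_bigr => i _.
rewrite (_ : [set r | _] = `[c.1 i, c.2 i]%classic).
  rewrite lebesgue_measure_itv/= lte_fin; case: ltgtP (pc i) => // e _.
  by rewrite /side e subrr.
apply/seteqP; split => r /=; rewrite in_itv/=.
  by move=> [z []]; rewrite /hyp/= => <-; exact.
move=> rc; exists (fun k => if k == i then r else c.1 k); split => /=.
  by rewrite /hyp/= eqxx.
by move=> k; case: eqVneq => [->//|_]; rewrite lexx/=; exact: pc.
Qed.

(** In direction [i] the i-th coordinate along the segment sweeps exactly the interval between [x i]
    and [y i]. *)
Lemma Lam_segment (x y : 'I_d -> R) :
  Lam (hits (segment x y)) = (\sum_i `|x i - y i|)%:E.
Proof.
rewrite /Lam -sumEFin; apply: eq_bigr => i _.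
rewrite (_ : [set r | _] = `[Num.min (x i) (y i), Num.max (x i) (y i)]%classic).
  rewrite lebesgue_measure_itv/= lte_fin.
  case: (ltgtP (x i) (y i)) => xy.
  - by rewrite xy -EFinB ltr0_norm ?subr_lt0// opprB.
  - by rewrite xy -EFinB gtr0_norm ?subr_gt0.
  - by rewrite ltxx xy subrr normr0.
apply/seteqP; split => r /=; rewrite in_itv/=.
  move=> [z []]; rewrite /hyp/= => <- [t /andP[t0 t1] ->].
  by rewrite ge_min le_max; case: (ltgtP (x i) (y i)) => xy; apply/andP; split; apply/orP;
    [left|right|right|left|left|left]; nra.
move=> /andP[]; rewrite ge_min le_max => h1 h2.
(* For equal coordinates the parameter [t] below would divide by 0; the interval is then a single
   point, attained at the end [x]. *)
have [xy|xy] := eqVneq (x i) (y i).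
  exists x; split => /=; last first.
    by exists 0; [rewrite lexx ler01|apply/funext => k; rewrite subr0 mul1r mul0r addr0].
  by rewrite /hyp/=; move: h1 h2; rewrite -xy !orbb => h1 h2; apply/eqP; rewrite eq_le h1 h2.
pose t := (r - x i) / (y i - x i).
have yx0 : y i - x i != 0 by rewrite subr_eq0 eq_sym.
exists (fun k => (1 - t) * x k + t * y k); split => /=.
  by rewrite /hyp/= /t; field.
exists t => //; rewrite /t; case: (ltgtP (x i) (y i)) xy => // xy _.
- have yx : 0 < y i - x i by rewrite subr_gt0.
  rewrite divr_ge0 ?(ltW yx)/= ?ler_pdivrMr// ?mul1r; first by lra.
  by lra.
- have yx : 0 < x i - y i by rewrite subr_gt0.
  rewrite -[_ / _]mulrNN -invrN opprB opprB divr_ge0 ?(ltW yx)/= ?ler_pdivrMr// ?mul1r; first by lra.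
  by lra.
Qed.

(** The induction needs an arbitrary base point: each integration releases the constraint on one
    coordinate in exchange for the factor [side], while the coordinates outside [s] stay
    constrained. *)
Lemma iter_int_box s c x : uniq s -> proper_box c ->
  iter_int s (fun z => (\1_(box_set c) z)%:E) x =
  (\prod_(j <- s) side c j *
   [forall k, (k \in s) || (c.1 k <= x k <= c.2 k)]%:R)%:E.
Proof.
move=> + pc; elim: s x => [|j s IH] x /= => [_|/andP[js us]].
  rewrite big_nil mul1r indic_box_set; congr (nat_of_bool _)%:R%:E.
under eq_integral do rewrite IH//.
pose B := [forall k, (k \in j :: s) || (c.1 k <= x k <= c.2 k)].
transitivity (\int[lebesgue_measure]_t ((\prod_(j <- s) side c j * B%:R)%:E *
    (\1_(`[c.1 j, c.2 j]%classic) t)%:E))%E.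
  apply: eq_integral => t _; rewrite -EFinM -mulrA; congr (_ * _)%:E.
  rewrite indicE -natrM mulnb; congr (nat_of_bool _)%:R.
  rewrite mem_setE in_itv/=; apply/forallP/andP.
    move=> h; split; last by have := h j; rewrite (negbTE js) eqxx.
    apply/forallP => k; rewrite inE; have := h k; case: eqVneq => //= kj.
  move=> [/forallP h tj] k; have := h k; rewrite inE; case: eqVneq => [->|//].
  by rewrite tj orbT.
rewrite ge0_integralZl_EFin//; last 2 first.
- exact/measurable_EFinP/measurable_indic.
- by rewrite mulr_ge0// prodr_ge0// => k _; exact: side_ge0.
have -> : (\int[lebesgue_measure]_t (\1_(`[c.1 j, c.2 j]%classic) t)%:E)%E = (side c j)%:E.
  rewrite integral_indic// setIT -[LHS]/(lebesgue_measure _) lebesgue_measure_itv/= lte_fin.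
  by case: ltgtP (pc j) => // e _; rewrite /side e subrr.
by rewrite big_cons -/B -EFinM; congr EFin; ring.
Qed.

Lemma hyp_int_box i (r : R) c : proper_box c ->
  hyp_int (i, r) (fun x => (\1_(box_set c) x)%:E) =
  (face c i * (c.1 i <= r <= c.2 i)%R%:R)%:E.
Proof.
move=> pc; rewrite /hyp_int iter_int_box//; last by rewrite filter_uniq// enum_uniq.
congr (_ * _)%:E; first by rewrite big_filter big_enum_cond.
congr (nat_of_bool _)%:R; apply/forallP/idP => /= [/(_ i)|h k].
  by rewrite mem_filter !eqxx.
by rewrite mem_filter mem_enum andbT; case: eqVneq => // ->.
Qed.

Lemma facet_volE c i r : proper_box c -> c.1 i <= r <= c.2 i ->
  facet_vol c (Some (i, r)) = (face c i)%:E.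
Proof. by move=> pc rc; rewrite /facet_vol hyp_int_box// rc mulr1. Qed.

End boxes.

(** * Shifting and splitting integrals over segments *)

Section lebesgue_segments.
Local Open Scope ereal_scope.
Context (R : realType).
Local Notation mu := (@lebesgue_measure R).

Lemma ge0_integral_itv_shift (f : R -> \bar R) (a b k : R) : measurable_fun setT f ->
  (forall x, 0 <= f x) ->
  \int[mu]_(x in `[a, b]) f (x + k)%R = \int[mu]_(x in `[(a + k)%R, (b + k)%R]) f x.
Proof.
move=> mf f0; rewrite integral_mkcond [RHS]integral_mkcond.
rewrite -[RHS](@ge0_integral_shift _ _ k); last 2 first.
- by apply/(measurable_restrictT _ _).1 => //; exact: measurable_funTS.
- by move=> x; rewrite patchE; case: ifP.
apply: eq_integral => x _; rewrite !patchE; congr (if _ then _ else _).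
by apply/idP/idP; rewrite !inE/= !in_itv/= !lerD2r.
Qed.

Lemma ge0_integral_itv_split (f : R -> \bar R) (a b c : R) : (a <= b <= c)%R ->
  measurable_fun setT f -> (forall x, 0 <= f x) ->
  \int[mu]_(x in `[a, c]) f x =
  \int[mu]_(x in `[a, b]) f x + \int[mu]_(x in `[b, c]) f x.
Proof.
move=> /andP[ab bc] mf f0.
rewrite -(@integral_itv_bndo_bndc _ _ b); last exact: measurable_funTS.
rewrite -ge0_integral_setU//=.
- congr (integral _ _ _); apply/seteqP; split => x /=; rewrite !in_itv/=.
    by move=> /andP[ax xc]; have [xb|xb] := ltP x b; [left; rewrite ax|right; rewrite xc].
  by move=> [/andP[-> /ltW xb]|/andP[bx ->]]; [rewrite (le_trans xb)|rewrite (le_trans ab)].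
- exact: measurable_funTS.
- apply/disj_setPS => x /= []; rewrite !in_itv/= => /andP[_ xb] /andP[bx _].
  by move: xb; rewrite ltNge bx.
Qed.

Lemma integral_itv_cst (a b k : R) : (a <= b)%R ->
  \int[mu]_(x in `[a, b]) k%:E = (k * (b - a))%:E.
Proof.
move=> ab; rewrite integral_cst//= lebesgue_measure_itv/= lte_fin.
by case: ltgtP ab => // -> _; rewrite ?subrr ?mulr0 ?mule0.
Qed.

End lebesgue_segments.

(** * The law of a single split and its first consequences *)

Section one_split.
Context (R : realType) (d : nat).
Implicit Types (c : box R d) (i j : 'I_d) (l : seq 'I_d).

(** [pick] is a finite cascade of comparisons, each ending in [Some (j, r)] with [r] measurable.
    Testing [G] on these branches replaces a sigma-algebra on [option ('I_d * R)]. *)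
Lemma measurable_pick d1 d2 (S : measurableType d1) (V : measurableType d2)
    (G : S -> option ('I_d * R) -> V) (c : S -> box R d) (s : S -> R) l :
  (forall j (r : S -> R), measurable_fun setT r ->
     measurable_fun setT (fun t => G t (Some (j, r t)))) ->
  measurable_fun setT (fun t => G t None) ->
  (forall k, measurable_fun setT (fun t => (c t).1 k)) ->
  (forall k, measurable_fun setT (fun t => (c t).2 k)) ->
  measurable_fun setT s ->
  measurable_fun setT (fun t => G t (pick (c t) l (s t))).
Proof.
move=> mG mN m1 m2; elim: l s => [|j l IH] s ms //=.
case: (nilp l).
  under eq_fun do rewrite orbT.
  by apply: (mG j (fun t => (c t).1 j + s t)); exact: measurable_funD.
under eq_fun do rewrite orbF.
rewrite (_ : (fun t => _) = (fun t => if s t < (c t).2 j - (c t).1 j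
  then G t (Some (j, (c t).1 j + s t)) else G t (pick (c t) l (s t - ((c t).2 j - (c t).1 j))))).
  apply: measurable_fun_ifT.
  - by apply: measurable_fun_ltr => //; exact: measurable_funB.
  - by apply: (mG j (fun t => (c t).1 j + s t)); exact: measurable_funD.
  - by apply: IH; apply: measurable_funB => //; exact: measurable_funB.
by apply/funext => t; case: ifP.
Qed.

Lemma pick_inP c l (s : R) : proper_box c -> l != [::] -> 0 <= s <= \sum_(j <- l) side c j ->
  exists j r, pick c l s = Some (j, r) /\ c.1 j <= r <= c.2 j.
Proof.
move=> pc; elim: l s => [//|j l IH] s _ /andP[s0 sl] /=.
case: ifPn => [h|].
  exists j, (c.1 j + s); split=> //; rewrite lerDl s0/=.
  (* The last side also receives the right end, where [s] is the total length. *)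
  case/orP: h => [/ltW|/nilP l0]; first by rewrite lerBrDl.
  by move: sl; rewrite l0 big_seq1 /side lerBrDl.
rewrite negb_or -leNgt => /andP[h l0].
have l0' : l != [::] by rewrite -size_eq0.
by apply: IH => //; rewrite subr_ge0 h/= lerBlDr; move: sl; rewrite big_cons addrC.
Qed.

Lemma measurable_pick_fixed (F : option ('I_d * R) -> \bar R) c l :
  (forall j, measurable_fun setT (fun r => F (Some (j, r)))) ->
  measurable_fun setT (fun s => F (pick c l s)).
Proof.
move=> mF; apply: (@measurable_pick _ _ _ _ (fun=> F) (fun=> c) id) => //.
by move=> j r mr; exact: (measurableT_comp (mF j)).
Qed.

(** As [s] runs over the total length, [pick] runs through the sides one after the other at unit
    speed. *)
Lemma pick_integral (F : option ('I_d * R) -> \bar R) c l :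
  proper_box c -> l != [::] -> (forall H, 0 <= F H)%E ->
  (forall j, measurable_fun setT (fun r => F (Some (j, r)))) ->
  (\int[lebesgue_measure]_(s in `[0%R, (\sum_(j <- l) side c j)%R]) F (pick c l s) =
   \sum_(j <- l) \int[lebesgue_measure]_(r in `[c.1 j, c.2 j]) F (Some (j, r)))%E.
Proof.
move=> pc + F0 mF; elim: l => [//|j l IH] _.
have first_int : (\int[lebesgue_measure]_(s in `[0%R, side c j]) F (Some (j, (c.1 j + s)%R)) =
    \int[lebesgue_measure]_(r in `[c.1 j, c.2 j]) F (Some (j, r)))%E.
  under eq_integral do rewrite addrC.
  rewrite (@ge0_integral_itv_shift _ (fun r => F (Some (j, r))))//.
  by rewrite add0r /side subrK.
have [l0|l0] := eqVneq l [::].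
  by rewrite l0 !big_seq1 -first_int; apply: eq_integral => s _ /=; rewrite orbT.
have sl0 : 0 <= \sum_(k <- l) side c k by apply: sumr_ge0 => k _; exact: side_ge0.
rewrite !big_cons [LHS](@ge0_integral_itv_split _ _ _ (side c j)); last 3 first.
- by rewrite side_ge0//= lerDl.
- exact: measurable_pick_fixed.
- by [].
congr (_ + _)%E.
  (* The end [s = side c j] already selects the next direction; this null point is removed on both
     sides. *)
  rewrite -first_int -(@integral_itv_bndo_bndc _ _ (side c j)); last first.
    by apply: measurable_funTS; exact: (measurable_pick_fixed c (j :: l) mF).
  rewrite -[RHS](@integral_itv_bndo_bndc _ _ (side c j)); last first.
    apply: measurable_funTS; apply: (measurableT_comp (mF j)).
    exact: measurable_funD.
  by apply: eq_integral => s; rewrite inE/= in_itv/= => /andP[_ ->].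
rewrite -IH//.
transitivity (\int[lebesgue_measure]_(s in `[(0 + side c j)%R, (\sum_(k <- l) side c k + side c j)%R])
   F (pick c l (s - side c j)))%E.
  rewrite add0r addrC; apply: eq_integral => s; rewrite inE/= in_itv/= => /andP[hs _].
  by rewrite ltNge hs/= ifF//; apply/negbTE; rewrite -size_eq0 in l0.
rewrite -(@ge0_integral_itv_shift _ (fun s => F (pick c l (s - side c j))))//.
  by apply: eq_integral => s _; rewrite addrK.
apply: (measurableT_comp (measurable_pick_fixed c l mF)).
exact: measurable_funB.
Qed.

Context d1 (T : measurableType d1) (P : probability T R) (U : T -> R).
Hypothesis mU : measurable_fun setT U.
Hypothesis lawU : forall A, measurable A ->
  P (U @^-1` A) = lebesgue_measure (A `&` `[0, 1]).

Lemma uniform_integral (f : R -> \bar R) : measurable_fun setT f ->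
  (forall x, 0 <= f x)%E ->
  (\int[P]_w f (U w) = \int[lebesgue_measure]_(u in `[0%R, 1%R]) f u)%E.
Proof.
move=> mf f0.
have mU' : measurable_fun setT (U : T -> measurableTypeR R) by exact: mU.
pose gm : {mfun T >-> measurableTypeR R} := @mfun_Sub _ _ T (measurableTypeR R) _ (mem_set mU').
transitivity (\int[distribution P gm]_x f x)%E.
  by rewrite ge0_integral_pushforward.
rewrite (@ge0_integral_density _ _ _ lebesgue_measure (distribution P gm) (\1_(`[0%R, 1%R]%classic)))//.
- rewrite [RHS]integral_mkcond; apply: eq_integral => x _.
  by rewrite epatch_indic.
- move=> A mA; rewrite -[LHS]/(P (U @^-1` A)) lawU// integral_indic//.
  by rewrite setIC.
Qed.

(** Stretching the uniform mark by [lam c] turns it into the parameter of [pick], so the chosen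
    hyperplane has the normalized restriction of Lambda as its law. *)
Lemma choose_integral (F : option ('I_d * R) -> \bar R) c :
  proper_box c -> 0 < lam c -> (forall H, 0 <= F H)%E ->
  (forall j, measurable_fun setT (fun r => F (Some (j, r)))) ->
  (\int[P]_w F (choose_hyp c (U w)) =
   ((lam c)^-1)%:E *
   \sum_j \int[lebesgue_measure]_(r in `[c.1 j, c.2 j]) F (Some (j, r)))%E.
Proof.
move=> pc l0 F0 mF.
have en0 : enum 'I_d != [::].
  apply: contraTneq l0 => e; rewrite /lam -big_enum e big_nil ltxx//.
have mG : measurable_fun setT (fun s => F (pick c (enum 'I_d) s)) by exact: measurable_pick_fixed.
pose G := (fun s => F (pick c (enum 'I_d) s)) \_ `[0, lam c]%classic.
have mG' : measurable_fun setT G.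
  by apply/(measurable_restrictT _ _).1 => //; exact: measurable_funTS.
have G0 x : (0 <= G x)%E by rewrite /G patchE; case: ifP.
rewrite (@uniform_integral (fun u => F (choose_hyp c u)))//; last first.
  apply: (measurableT_comp mG); exact: measurable_funM.
transitivity (\int[lebesgue_measure]_u G (lam c * u)%R)%E.
  rewrite integral_mkcond; apply: eq_integral => u _; rewrite /G !patchE.
  rewrite /choose_hyp -/(lam c) mulrC; congr (if _ then _ else _).
  apply/idP/idP; rewrite !inE/= !in_itv/= pmulr_rge0// -[X in _ * u <= X]mulr1 ler_pM2l//.
rewrite ge0_integral_scale//; congr (_ * _)%E.
rewrite /G -integral_mkcond -[in RHS]big_enum -pick_integral//.
by congr (integral _ _ _); rewrite /lam -big_enum.
Qed.

Local Notation d0 := (d%:R : R).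

(** The position of the hyperplane is ignored: this equals [facet_vol] when the hyperplane meets a
    proper box [c], as every chosen one does. *)
Definition facet c (H : option ('I_d * R)) : R := if H is Some (i, _) then face c i else 0.
(** [kappa] and [beta] are the first and second moments of the facet volume in a split of [c]. Both
    are 0 when [lam c = 0], division by 0 giving 0. *)
Definition kappa c : R := d0 * vol c / lam c.
Definition beta c : R := (\sum_i side c i * face c i ^+ 2) / lam c.
Definition psi c : R := vol c * lam c.

Lemma side_eq0 c i : proper_box c -> lam c = 0 -> side c i = 0.
Proof.
move=> pc; move/eqP; rewrite psumr_eq0; last by move=> k _; exact: side_ge0.
by move/allP/(_ i); rewrite mem_index_enum => /(_ isT)/eqP.
Qed.

(** Nothing pointwise prevents a cell from shrinking to a point. All formulas must then give 0,
    which for a face takes a second vanishing side. *)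
Lemma face_eq0 c i : (1 < d)%N -> proper_box c -> lam c = 0 -> face c i = 0.
Proof.
move=> d2 pc l0; have [j ji] : exists j : 'I_d, j != i.
  have [i0|i0] := eqVneq (val i) 0%N.
    by exists (Ordinal d2); apply/eqP => /(congr1 val); rewrite i0.
  by exists (Ordinal (ltnW d2)); apply/eqP => /(congr1 val)/= e; case/negP: i0; apply/eqP/esym; exact: e.
by rewrite /face (bigD1 j)//= side_eq0// mul0r.
Qed.

Lemma split_box_proper c j r b : proper_box c -> c.1 j <= r <= c.2 j ->
  proper_box (split_box c (Some (j, r)) b).
Proof.
by move=> pc /andP[r1 r2] k; case: b => /=; case: eqVneq => [->|_].
Qed.

Lemma side_split c j r b k :
  side (split_box c (Some (j, r)) b) k =
  if k == j then (if b then r - c.1 j else c.2 j - r) else side c k.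
Proof. by rewrite /side; case: b => /=; case: eqVneq => // ->. Qed.

Lemma vol_split c j r b :
  vol (split_box c (Some (j, r)) b) = (if b then r - c.1 j else c.2 j - r) * face c j.
Proof.
rewrite (vol_face _ j) side_split eqxx; congr (_ * _).
by apply: eq_bigr => k /negbTE kj; rewrite side_split kj.
Qed.

Lemma lam_split c j r b :
  lam (split_box c (Some (j, r)) b) = lam c - side c j + (if b then r - c.1 j else c.2 j - r).
Proof.
rewrite /lam (bigD1 j)//= side_split eqxx [in RHS](bigD1 j)//= addrC.
congr (_ + _); rewrite [side c j + _]addrC addrK.
by apply: eq_bigr => k /negbTE kj; rewrite side_split kj.
Qed.

Lemma vol_splitD c j r :
  vol (split_box c (Some (j, r)) true) + vol (split_box c (Some (j, r)) false) = vol c.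
Proof. by rewrite !vol_split -mulrDl (vol_face c j) /side; congr (_ * _); ring. Qed.

Lemma choose_integral_cst (f : 'I_d -> R) c : proper_box c -> 0 < lam c ->
  (forall i, 0 <= f i) ->
  (\int[P]_w (if choose_hyp c (U w) is Some (i, _) then f i else 0)%:E =
   ((\sum_i side c i * f i) / lam c)%:E)%E.
Proof.
move=> pc l0 f0.
rewrite (@choose_integral (fun H => (if H is Some (i, _) then f i else 0)%:E))//.
  rewrite [RHS]EFinM muleC; congr (_ * _)%E; rewrite -sumEFin; apply: eq_bigr => i _.
  by rewrite integral_itv_cst// mulrC.
by move=> [[i r]|]; rewrite lee_fin.
Qed.

Lemma sum_side_face c : \sum_i side c i * face c i = d0 * vol c.
Proof.
under eq_bigr do rewrite -vol_face.
by rewrite sumr_const card_ord mulr_natl.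
Qed.

Lemma facet_integral c : (1 < d)%N -> proper_box c ->
  (\int[P]_w (facet c (choose_hyp c (U w)))%:E = (kappa c)%:E)%E.
Proof.
move=> d1' pc; have := lam_ge0 pc; rewrite le_eqVlt => /orP[/eqP l0|l0].
  rewrite /kappa -l0 invr0 mulr0 integral0_eq// => w _.
  by rewrite /facet; case: choose_hyp => // -[i r]; rewrite face_eq0.
rewrite choose_integral_cst//; last by move=> i; exact: face_ge0.
by rewrite sum_side_face.
Qed.

Lemma facet_sqr_integral c : (1 < d)%N -> proper_box c ->
  (\int[P]_w (facet c (choose_hyp c (U w)) ^+ 2)%:E = (beta c)%:E)%E.
Proof.
move=> d1' pc; have := lam_ge0 pc; rewrite le_eqVlt => /orP[/eqP l0|l0].
  rewrite /beta -l0 invr0 mulr0 integral0_eq// => w _.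
  by rewrite /facet; case: choose_hyp => [[i r]|]; rewrite ?face_eq0// expr0n.
rewrite -(choose_integral_cst pc l0 (f := fun i => face c i ^+ 2)); last first.
  by move=> i; exact: sqr_ge0.
by apply: eq_integral => w _; rewrite /facet; case: choose_hyp => [[]|]//; rewrite expr0n.
Qed.

Lemma integral_sqr_sides (a b : R) : a <= b ->
  (\int[lebesgue_measure]_(r in `[a, b]) ((r - a) ^+ 2 + (b - r) ^+ 2)%:E =
   (2 / 3 * (b - a) ^+ 3)%:E)%E.
Proof.
rewrite le_eqVlt => /orP[/eqP ->|ab].
  by rewrite set_itv1 integral_set1 subrr expr0n mulr0.
pose F (r : R) := ((r - a) ^+ 3 - (b - r) ^+ 3) / 3.
have dF (r : R) : is_derive r (1:R) F ((r - a) ^+ 2 + (b - r) ^+ 2).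
  by apply: is_derive_eq; rewrite /GRing.scale/=; field.
have cF (r : R) : F x @[x --> r] --> F r.
  have : derivable F r 1 by have [] := dF r.
  by move/derivable1_diffP/differentiable_continuous.
rewrite (@continuous_FTC2 _ _ F)//.
- by rewrite -EFinB /F !subrr !expr0n/=; congr EFin; field.
- apply: continuous_subspaceT => r.
  rewrite /continuous_at; under eq_fun do rewrite !expr2; rewrite !expr2.
  by apply: cvgD; apply: cvgM; apply: cvgB; (exact: cvg_id || exact: cvg_cst).
- split; [|exact: cvg_at_right_filter|exact: cvg_at_left_filter].
  by move=> r _; have [] := dF r.
- by move=> r _; rewrite derive1E; have [_ ->] := dF r.
Qed.

Hypothesis U01 : forall w, 0 <= U w <= 1.

Lemma chooseP c (u : R) : (0 < d)%N -> proper_box c -> 0 <= u <= 1 ->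
  exists j r, choose_hyp c u = Some (j, r) /\ c.1 j <= r <= c.2 j.
Proof.
move=> dp pc /andP[u0 u1]; apply: pick_inP => //.
  by apply/eqP => e; have := mem_enum 'I_d (Ordinal dp); rewrite e.
by rewrite big_enum -/(lam c) mulr_ge0 ?lam_ge0//= ler_piMl ?lam_ge0.
Qed.

(** [psi] of a part can be negative for a hyperplane missing the box. Replacing [F] by 0 at such
    hyperplanes leaves the integral unchanged, because none of them is ever chosen. *)
Lemma choose_integral_in (F : option ('I_d * R) -> \bar R) c :
  proper_box c -> 0 < lam c ->
  (forall j r, c.1 j <= r <= c.2 j -> (0 <= F (Some (j, r)))%E) ->
  (forall j, measurable_fun setT (fun r => F (Some (j, r)))) ->
  (\int[P]_w F (choose_hyp c (U w)) =
   ((lam c)^-1)%:E *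
   \sum_j \int[lebesgue_measure]_(r in `[c.1 j, c.2 j]) F (Some (j, r)))%E.
Proof.
move=> pc l0 F0 mF.
have dp : (0 < d)%N.
  case: (posnP d) => // dz; move: l0; rewrite /lam big1 ?ltxx// => i _.
  by have := ltn_ord i; rewrite [X in (_ < X)%N -> _]dz.
pose F' H := (if H is Some (j, r) then if (c.1 j <= r <= c.2 j)%R then F H else 0 else 0)%E.
transitivity (\int[P]_w F' (choose_hyp c (U w)))%E.
  apply: eq_integral => w _; have [j [r [-> rc]]] := chooseP dp pc (U01 w).
  by rewrite /F' rc.
rewrite choose_integral//.
- congr (_ * _)%E; apply: eq_bigr => j _; apply: eq_integral => r.
  by rewrite inE/= in_itv/= => ->.
- by move=> [[j r]|]//=; case: ifP => // /F0.
- move=> j; apply: measurable_fun_ifT => //.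
  by apply: measurable_and; exact: measurable_fun_ler.
Qed.

(** Cauchy-Schwarz, read off from the squared deviations of the sides from their mean
    [lam c / d]. *)
Lemma sum_sqr_side c : lam c ^+ 2 / d0 <= \sum_i side c i ^+ 2.
Proof.
have [dz|dp] := posnP d.
  have e : d0 = 0 by rewrite dz.
  by rewrite e invr0 mulr0 sumr_ge0// => i _; exact: sqr_ge0.
have dn0 : d0 != 0 by rewrite pnatr_eq0 -lt0n.
have : 0 <= \sum_i (side c i - lam c / d0) ^+ 2 by apply: sumr_ge0 => i _; exact: sqr_ge0.
under eq_bigr do rewrite sqrrB.
rewrite big_split/= sumrB sumr_const card_ord sumrMnl -mulr_suml -/(lam c).
rewrite -[X in _ + X]mulr_natl [X in _ + X](_ : _ = lam c ^+ 2 / d0); last by field.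
have -> : lam c * (lam c / d0) *+ 2 = 2 * (lam c ^+ 2 / d0) by field.
by lra.
Qed.

(** Cutting side j at the fraction u gives vol (lam - side_j + side_j (u^2 + (1 - u)^2)), and u^2 +
    (1 - u)^2 has mean 2/3: a loss of vol side_j / 3. Averaging over j with weights side_j / lam
    gives the loss vol (sum of side_j^2) / (3 lam), which is at least psi / (3d) by
    [sum_sqr_side]. *)
Lemma psi_split_le c : (1 < d)%N -> proper_box c ->
  (\int[P]_w (psi (split_box c (choose_hyp c (U w)) true) +
     psi (split_box c (choose_hyp c (U w)) false))%:E <=
   ((1 - (3 * d0)^-1) * psi c)%:E)%E.
Proof.
move=> d2 pc; have dp := ltnW d2.
have := lam_ge0 pc; rewrite le_eqVlt => /orP[/eqP l0|l0].
  rewrite /psi -l0 !mulr0 integral0_eq// => w _.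
  have [j [r [-> rc]]] := chooseP dp pc (U01 w).
  by rewrite !vol_split face_eq0// !mulr0 !mul0r addr0.
(* [h] collects what does not depend on the position of the cut, already integrated over the
   side. *)
pose h j := face c j * (lam c - side c j) * side c j.
have FE j r : psi (split_box c (Some (j, r)) true) + psi (split_box c (Some (j, r)) false) =
    h j + face c j * ((r - c.1 j) ^+ 2 + (c.2 j - r) ^+ 2).
  by rewrite /psi !vol_split !lam_split /h /side; ring.
rewrite (@choose_integral_in (fun H => (psi (split_box c H true) + psi (split_box c H false))%:E))//.
- rewrite [X in (_ * X)%E](_ : _ = (vol c * (lam c ^+ 2 - (\sum_j side c j ^+ 2) / 3))%:E).
    rewrite -EFinM lee_fin.
    have -> : (1 - (3 * d0)^-1) * psi c =
        (lam c)^-1 * (vol c * (lam c ^+ 2 - (lam c ^+ 2 / d0) / 3)).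
      by rewrite /psi; field; rewrite pnatr_eq0 -lt0n dp gt_eqF.
    rewrite ler_wpM2l ?invr_ge0 ?(ltW l0)// ler_wpM2l ?vol_ge0//.
    by rewrite lerD2l lerN2 ler_pM2r ?invr_gt0// sum_sqr_side.
  have -> : vol c * (lam c ^+ 2 - (\sum_j side c j ^+ 2) / 3) =
      \sum_j vol c * (lam c * side c j - side c j ^+ 2 / 3).
    rewrite -mulr_sumr sumrB -mulr_sumr -mulr_suml -/(lam c); ring.
  rewrite -sumEFin; apply: eq_bigr => j _.
  under eq_integral do rewrite FE EFinD.
  rewrite ge0_integralD//=.
  - under [X in (_ + X)%E]eq_integral do rewrite EFinM.
    rewrite integral_itv_cst// ge0_integralZl_EFin//=.
    + rewrite integral_sqr_sides// -EFinM -EFinD (vol_face c j) /h /side; congr EFin.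
      by field.
    + by move=> r _; rewrite lee_fin addr_ge0// sqr_ge0.
    + apply/measurable_EFinP/measurable_funTS.
      by apply: measurable_funD; apply: measurable_funX; exact: measurable_funB.
    + exact: face_ge0.
  - move=> r _; rewrite lee_fin !mulr_ge0 ?face_ge0 ?side_ge0// subr_ge0.
    by rewrite /lam (bigD1 j)//= lerDl sumr_ge0// => k _; exact: side_ge0.
  - by move=> r _; rewrite lee_fin mulr_ge0 ?face_ge0// addr_ge0// sqr_ge0.
  - apply/measurable_EFinP/measurable_funTS/measurable_funM => //.
    by apply: measurable_funD; apply: measurable_funX; exact: measurable_funB.
- move=> j r rc; rewrite lee_fin /psi.
  by rewrite addr_ge0// mulr_ge0 ?vol_ge0 ?lam_ge0//; exact: split_box_proper.
- move=> j; apply/measurable_EFinP; under eq_fun do rewrite FE.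
  apply: measurable_funD => //; apply: measurable_funM => //.
  by apply: measurable_funD; apply: measurable_funX; exact: measurable_funB.
Qed.

Lemma integral_itv_ge (a b m : R) : a <= m <= b ->
  (\int[lebesgue_measure]_(r in `[a, b]) ((m <= r)%R%:R)%:E = (b - m)%:E :> \bar R)%E.
Proof.
move=> amb; case/andP: (amb) => am mb.
have mle : measurable_fun setT (fun r : R => ((m <= r)%R%:R : R)%:E).
  apply/measurable_EFinP.
  rewrite (_ : (fun r : R => _) = (fun r : R => if m <= r then 1 else 0 : R)).
    by apply: measurable_fun_ifT => //; exact: measurable_fun_ler.
  by apply/funext => r; case: (m <= r).
rewrite (@ge0_integral_itv_split _ _ _ m)//.
rewrite -(@integral_itv_bndo_bndc _ _ m); last exact: measurable_funTS.
rewrite integral0_eq ?add0e; last first.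
  by move=> r /=; rewrite in_itv/= => /andP[_]; rewrite ltNge => /negbTE ->.
rewrite -[b - m]mul1r -integral_itv_cst//; apply: eq_integral => r.
by rewrite inE/= in_itv/= => /andP[-> _].
Qed.

Lemma integral_itv_le (a b m : R) : a <= m <= b ->
  (\int[lebesgue_measure]_(r in `[a, b]) ((r <= m)%R%:R)%:E = (m - a)%:E :> \bar R)%E.
Proof.
move=> amb; case/andP: (amb) => am mb.
have mle : measurable_fun setT (fun r : R => ((r <= m)%R%:R : R)%:E).
  apply/measurable_EFinP.
  rewrite (_ : (fun r : R => _) = (fun r : R => if r <= m then 1 else 0 : R)).
    by apply: measurable_fun_ifT => //; exact: measurable_fun_ler.
  by apply/funext => r; case: (r <= m).
rewrite (@ge0_integral_itv_split _ _ _ m)//.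
rewrite -(@integral_itv_obnd_cbnd _ m); last exact: measurable_funTS.
rewrite [X in (_ + X)%E]integral0_eq ?adde0; last first.
  by move=> r /=; rewrite in_itv/= => /andP[]; rewrite ltNge => /negbTE ->.
rewrite -[m - a]mul1r -integral_itv_cst//; apply: eq_integral => r.
by rewrite inE/= in_itv/= => /andP[_ ->].
Qed.

Lemma in_box_split c j r b x : in_box c x ->
  in_box (split_box c (Some (j, r)) b) x = if b then x j <= r else r <= x j.
Proof.
move=> /forallP xc; case: b => /=; apply/forallP/idP => [/(_ j)|h k] /=.
- by rewrite eqxx => /andP[].
- by case: eqVneq => [->|_]; [have /andP[-> _] := xc j|exact: xc].
- by rewrite eqxx => /andP[].
- by case: eqVneq => [->|_]; [have /andP[_ ->] := xc j; rewrite h|exact: xc].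
Qed.

(** Both points stay in a common part when the cut avoids the segment between them, up to cuts
    through an end point, which form a null set. By [Lam_segment] the segment is cut with
    probability |x - y|_1 / lam. *)
Lemma same_cell_integral c (x y : 'I_d -> R) : proper_box c -> 0 < lam c ->
  in_box c x -> in_box c y ->
  (\int[P]_w (\sum_(b <- [:: true; false])
     (in_box (split_box c (choose_hyp c (U w)) b) x &&
      in_box (split_box c (choose_hyp c (U w)) b) y)%:R)%:E =
   (1 - (\sum_i `|x i - y i|) / lam c)%:E)%E.
Proof.
move=> pc l0 xc yc.
pose G H : R := \sum_(b <- [:: true; false])
     (in_box (split_box c H b) x && in_box (split_box c H b) y)%:R.
have GE j r : G (Some (j, r)) = (Num.max (x j) (y j) <= r)%R%:R + (r <= Num.min (x j) (y j))%R%:R.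
  by rewrite /G 2!big_cons big_nil addr0 !in_box_split// ge_max le_min.
have mle m : measurable_fun setT (fun r : R => ((m <= r)%R%:R : R)).
  rewrite (_ : (fun r : R => _) = (fun r : R => if m <= r then 1 else 0 : R)).
    by apply: measurable_fun_ifT => //; exact: measurable_fun_ler.
  by apply/funext => r; case: (m <= r).
have mge m : measurable_fun setT (fun r : R => ((r <= m)%R%:R : R)).
  rewrite (_ : (fun r : R => _) = (fun r : R => if r <= m then 1 else 0 : R)).
    by apply: measurable_fun_ifT => //; exact: measurable_fun_ler.
  by apply/funext => r; case: (r <= m).
rewrite (@choose_integral (fun H => (G H)%:E))//.
- rewrite [X in (_ * X)%E](_ : _ = (lam c - \sum_i `|x i - y i|)%:E).
    by rewrite -EFinM; congr EFin; field; rewrite gt_eqF.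
  rewrite /lam -sumrB -sumEFin; apply: eq_bigr => j _.
  under eq_integral do rewrite GE EFinD.
  rewrite ge0_integralD//=.
  + have /forallP/(_ j) /andP[x1 x2] := xc; have /forallP/(_ j) /andP[y1 y2] := yc.
    rewrite integral_itv_ge ?integral_itv_le.
    * rewrite -EFinD; congr EFin; rewrite /side.
      case: (ltgtP (x j) (y j)) => xy.
      - by rewrite ltr0_norm ?subr_lt0//; ring.
      - by rewrite gtr0_norm ?subr_gt0//; ring.
      - by rewrite xy subrr normr0; ring.
    * by rewrite le_min x1 y1 ge_min x2.
    * by rewrite le_max x1 ge_max x2 y2.
  + by apply/measurable_EFinP/measurable_funTS; exact: mle.
  + by apply/measurable_EFinP/measurable_funTS; exact: mge.
- by move=> H; rewrite lee_fin /G sumr_ge0.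
- move=> j; apply/measurable_EFinP; under eq_fun do rewrite GE.
  by apply: measurable_funD; [exact: mle|exact: mge].
Qed.

End one_split.

(** * Mean-square estimates *)

Section square_integrable.
Context d (T : measurableType d) (R : realType) (P : probability T R).
Implicit Types f g : T -> R.

Lemma ge0_integrable_lty f : measurable_fun setT f -> (forall w, 0 <= f w) ->
  (\int[P]_w (f w)%:E < +oo)%E -> P.-integrable setT (EFin \o f).
Proof.
move=> mf f0 hf; apply/integrableP; split; first exact/measurable_EFinP.
by under eq_integral do rewrite /= ger0_norm//.
Qed.

Lemma L2_sum_integrable f g : measurable_fun setT f -> measurable_fun setT g ->
  (\int[P]_w (f w ^+ 2)%:E < +oo)%E -> (\int[P]_w (g w ^+ 2)%:E < +oo)%E ->
  P.-integrable setT (fun w => (f w ^+ 2 + g w ^+ 2)%:E).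
Proof.
move=> mf mg hf hg; apply: ge0_integrable_lty.
- by apply: measurable_funD; exact: measurable_funX.
- by move=> w; rewrite addr_ge0 ?sqr_ge0.
under eq_integral do rewrite EFinD.
rewrite ge0_integralD//; first exact: lte_add_pinfty.
- by move=> w _; rewrite lee_fin sqr_ge0.
- by apply/measurable_EFinP; exact: measurable_funX.
- by move=> w _; rewrite lee_fin sqr_ge0.
- by apply/measurable_EFinP; exact: measurable_funX.
Qed.

Lemma L2_mul_integrable f g : measurable_fun setT f -> measurable_fun setT g ->
  (\int[P]_w (f w ^+ 2)%:E < +oo)%E -> (\int[P]_w (g w ^+ 2)%:E < +oo)%E ->
  P.-integrable setT (fun w => (f w * g w)%:E).
Proof.
move=> mf mg hf hg.
apply: (le_integrable measurableT _ _ (L2_sum_integrable mf mg hf hg)).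
  by apply/measurable_EFinP; exact: measurable_funM.
move=> w _; rewrite !abse_EFin lee_fin [leRHS]ger0_norm ?addr_ge0 ?sqr_ge0//.
rewrite normrM -(real_normK (num_real (f w))) -(real_normK (num_real (g w))).
by have := sqr_ge0 (`|f w| - `|g w|); have := normr_ge0 (f w); have := normr_ge0 (g w); nra.
Qed.

Lemma L2_integrable f : measurable_fun setT f -> (\int[P]_w (f w ^+ 2)%:E < +oo)%E ->
  P.-integrable setT (EFin \o f).
Proof.
move=> mf hf; rewrite (_ : EFin \o f = fun w => (f w * cst 1 w)%:E).
  apply: L2_mul_integrable => //.
  by under eq_integral do rewrite expr1n; rewrite integral_cst_probability ltry.
by apply/funext => w /=; rewrite mulr1.
Qed.

Lemma sqr_sum_orthogonal (I : eqType) (s : seq I) (Q : I -> T -> R) (b : I -> R) :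
  uniq s -> (forall i, measurable_fun setT (Q i)) ->
  (forall i, (\int[P]_w (Q i w ^+ 2)%:E = (b i)%:E)%E) ->
  (forall i j, i != j -> (\int[P]_w (Q i w * Q j w)%:E = 0)%E) ->
  (\int[P]_w ((\sum_(i <- s) Q i w) ^+ 2)%:E = (\sum_(i <- s) b i)%:E)%E.
Proof.
move=> + mQ hb orth; elim: s => [_|i s IH /= /andP[i_s us]].
  by rewrite big_nil integral0_eq// => w _; rewrite big_nil expr0n.
have {}IH := IH us.
have mS : measurable_fun setT (fun w => \sum_(j <- s) Q j w) by apply: measurable_sum.
have fQ j : (\int[P]_w (Q j w ^+ 2)%:E < +oo)%E by rewrite hb ltry.
have iij j : P.-integrable setT (fun w => (Q i w * Q j w)%:E) by exact: L2_mul_integrable.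
have cross : (\int[P]_w (\sum_(j <- s) (Q i w * Q j w)%:E) = 0)%E.
  rewrite (integral_sum measurableT iij).
  rewrite big_seq big1// => j js; apply: orth.
  by apply: contra i_s => /eqP ->.
have icross : P.-integrable setT (fun w => (\sum_(j <- s) (Q i w * Q j w)%:E)%E).
  exact: integrable_sum.
have iS : P.-integrable setT (fun w => ((\sum_(j <- s) Q j w) ^+ 2)%:E).
  apply: (ge0_integrable_lty (f := fun w => (\sum_(j <- s) Q j w) ^+ 2)).
  - exact: measurable_funX.
  - by move=> w; exact: sqr_ge0.
  - by rewrite IH ltry.
have iQ : P.-integrable setT (fun w => (Q i w ^+ 2)%:E).
  apply: (ge0_integrable_lty (f := fun w => Q i w ^+ 2)) => //.
  - exact: measurable_funX.
  - by move=> w; exact: sqr_ge0.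
transitivity (\int[P]_w ((Q i w ^+ 2)%:E + (2%:E * (\sum_(j <- s) (Q i w * Q j w)%:E) +
    ((\sum_(j <- s) Q j w) ^+ 2)%:E)))%E.
  apply: eq_integral => w _; rewrite big_cons sumEFin -EFinM -!EFinD -mulr_sumr.
  by congr EFin; ring.
rewrite integralD//; last first.
  by apply: integrableD => //; exact: integrableZl.
rewrite integralD//; last exact: integrableZl.
by rewrite integralZl// cross mule0 add0e hb IH -EFinD big_cons.
Qed.

(** The pointwise bound |f| <= (e + f^2 / e) / 2 is Cauchy-Schwarz without square roots; the
    parameter [e] is left to be optimized. *)
Lemma L1_le_L2 f (q e : R) : measurable_fun setT f -> 0 < e ->
  (\int[P]_w (f w ^+ 2)%:E <= q%:E)%E -> (\int[P]_w (`|f w|)%:E <= ((e + q / e) / 2)%:E)%E.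
Proof.
move=> mf e0 hq; apply: (@le_trans _ _ (\int[P]_w ((e / 2)%:E + (2 * e)^-1%:E * (f w ^+ 2)%:E))%E).
  apply: ge0_le_integral => //.
  - by apply/measurable_EFinP; exact: measurableT_comp.
  - apply: emeasurable_funD => //; apply: emeasurable_funM => //.
    by apply/measurable_EFinP; exact: measurable_funX.
  - move=> w _; rewrite -EFinM -EFinD lee_fin -(real_normK (num_real (f w))).
    rewrite -subr_ge0 (_ : _ - _ = (2 * e)^-1 * (`|f w| - e) ^+ 2); last by field; rewrite gt_eqF.
    by rewrite mulr_ge0 ?sqr_ge0// invr_ge0 mulr_ge0// ltW.
have e2 : 0 <= (2 * e)^-1 by rewrite invr_ge0 mulr_ge0// ltW.
rewrite ge0_integralD//; last 3 first.
- by move=> w _; rewrite lee_fin divr_ge0// ltW.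
- by move=> w _; rewrite -EFinM lee_fin mulr_ge0 ?sqr_ge0.
- apply: emeasurable_funM => //; by apply/measurable_EFinP; exact: measurable_funX.
rewrite integral_cst_probability ge0_integralZl//; last 2 first.
- by apply/measurable_EFinP; exact: measurable_funX.
- by move=> w _; rewrite lee_fin sqr_ge0.
rewrite (_ : (e + q / e) / 2 = e / 2 + (2 * e)^-1 * q); last by field; rewrite gt_eqF.
by rewrite [X in (_ <= X)%E]EFinD leeD2l// [X in (_ <= X)%E]EFinM lee_wpmul2l// lee_fin.
Qed.

(** Young's inequality 2ab <= e a^2 + b^2 / e for a = g and b = f - g. *)
Lemma L2_perturb f g (a b e : R) : measurable_fun setT f -> measurable_fun setT g -> 0 < e ->
  (\int[P]_w (g w ^+ 2)%:E <= a%:E)%E -> (\int[P]_w ((f w - g w) ^+ 2)%:E <= b%:E)%E ->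
  (\int[P]_w (f w ^+ 2)%:E <= ((1 + e) * a + (1 + e^-1) * b)%:E)%E.
Proof.
move=> mf mg e0 ha hb.
have e1 : 0 <= 1 + e by rewrite addr_ge0// ltW.
have e2 : 0 <= 1 + e^-1 by rewrite addr_ge0// invr_ge0 ltW.
have mg2 : measurable_fun setT (fun w => g w ^+ 2) by exact: measurable_funX.
have md2 : measurable_fun setT (fun w => (f w - g w) ^+ 2).
  by apply: measurable_funX; exact: measurable_funB.
apply: (@le_trans _ _ (\int[P]_w ((1 + e)%:E * (g w ^+ 2)%:E +
    (1 + e^-1)%:E * ((f w - g w) ^+ 2)%:E))%E).
  apply: ge0_le_integral => //.
  - by move=> w _; rewrite lee_fin sqr_ge0.
  - by apply/measurable_EFinP; exact: measurable_funX.
  - by apply: emeasurable_funD; apply: emeasurable_funM => //; exact/measurable_EFinP.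
  - move=> w _; rewrite -!EFinM -EFinD lee_fin -subr_ge0.
    rewrite (_ : _ - _ = (e * g w - (f w - g w)) ^+ 2 / e); last by field; rewrite gt_eqF.
    by rewrite divr_ge0 ?sqr_ge0// ltW.
rewrite ge0_integralD//; last 4 first.
- by move=> w _; rewrite -EFinM lee_fin mulr_ge0 ?sqr_ge0.
- by apply: emeasurable_funM => //; exact/measurable_EFinP.
- by move=> w _; rewrite -EFinM lee_fin mulr_ge0 ?sqr_ge0.
- by apply: emeasurable_funM => //; exact/measurable_EFinP.
rewrite !ge0_integralZl//; last 4 first.
- exact/measurable_EFinP.
- by move=> w _; rewrite lee_fin sqr_ge0.
- exact/measurable_EFinP.
- by move=> w _; rewrite lee_fin sqr_ge0.
rewrite [X in (_ <= X)%E]EFinD leeD// [X in (_ <= X)%E]EFinM lee_wpmul2l// lee_fin//.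
Qed.

Lemma L2_mean0 (N : nat -> T -> R) f (e : nat -> R) : measurable_fun setT f ->
  (forall n, measurable_fun setT (N n)) ->
  (forall n, (\int[P]_w (N n w ^+ 2)%:E < +oo)%E) ->
  (forall n, \int[P]_w (N n w)%:E = 0)%E ->
  (forall n, (\int[P]_w ((f w - N n w) ^+ 2)%:E <= (e n)%:E)%E) ->
  e n @[n --> \oo] --> 0 -> (\int[P]_w (f w)%:E = 0)%E.
Proof.
move=> mf mN fN N0 he e0.
have md n : measurable_fun setT (fun w => f w - N n w) by exact: measurable_funB.
have iN n : P.-integrable setT (fun w => (N n w)%:E) by exact: L2_integrable.
have id n : P.-integrable setT (fun w => (f w - N n w)%:E).
  by apply: L2_integrable => //; apply: le_lt_trans (he n) _; exact: ltry.
have bound n (x : R) : 0 < x -> (`|\int[P]_w (f w)%:E| <= ((x + e n / x) / 2)%:E)%E.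
  move=> x0; rewrite (_ : (\int[P]_w (f w)%:E = \int[P]_w (f w - N n w)%:E)%E); last first.
    transitivity (\int[P]_w ((f w - N n w)%:E + (N n w)%:E))%E.
      by apply: eq_integral => w _; rewrite -EFinD subrK.
    by rewrite integralD// N0 adde0.
  apply: le_trans (le_abse_integral _ _ _) _ => //; first exact/measurable_EFinP.
  exact: L1_le_L2.
have fin : (\int[P]_w (f w)%:E)%E \is a fin_num.
  by rewrite fin_num_abs; apply: le_lt_trans (bound 0%N 1 ltr01) _; exact: ltry.
rewrite -(fineK fin); congr EFin; apply/eqP; rewrite -normr_le0; apply/ler_addgt0Pr => x x0.
rewrite add0r; near \oo => n.
have := bound n x x0; rewrite -{1}(fineK fin) abse_EFin lee_fin => /le_trans; apply.
have : e n <= x ^+ 2.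
  near: n; have /cvgr0Pnorm_le/(_ (x ^+ 2)) := e0; rewrite exprn_gt0// => /(_ isT).
  by apply: filterS => n; apply: le_trans; exact: ler_norm.
move=> h; have : e n / x <= x by rewrite ler_pdivrMr// -expr2.
by lra.
Unshelve. all: by end_near. Qed.

(** [L2_perturb] is used in both directions: first the index goes to infinity for a fixed parameter,
    then the parameter goes to 0. *)
Lemma L2_norm_cvg (N : nat -> T -> R) f (e s : nat -> R) (S : R) : measurable_fun setT f ->
  (forall n, measurable_fun setT (N n)) ->
  (forall n, (\int[P]_w ((f w - N n w) ^+ 2)%:E <= (e n)%:E)%E) -> e n @[n --> \oo] --> 0 ->
  (forall n, (\int[P]_w (N n w ^+ 2)%:E = (s n)%:E)%E) -> s n @[n --> \oo] --> S ->
  (\int[P]_w (f w ^+ 2)%:E = S%:E)%E.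
Proof.
move=> mf mN he e0 hs sS.
have up n (x : R) : 0 < x ->
    (\int[P]_w (f w ^+ 2)%:E <= ((1 + x) * s n + (1 + x^-1) * e n)%:E)%E.
  by move=> x0; apply: (L2_perturb mf (mN n)) => //; rewrite hs.
have fin : (\int[P]_w (f w ^+ 2)%:E)%E \is a fin_num.
  rewrite ge0_fin_numE; first by apply: le_lt_trans (up 0%N 1 ltr01) _; exact: ltry.
  by apply: integral_ge0 => w _; rewrite lee_fin sqr_ge0.
have I0 : 0 <= fine (\int[P]_w (f w ^+ 2)%:E)%E.
  by rewrite fine_ge0// integral_ge0// => w _; rewrite lee_fin sqr_ge0.
rewrite -(fineK fin) in up *; set I := fine _ in up I0 *.
have fI : (\int[P]_w (f w ^+ 2)%:E = I%:E)%E by rewrite /I fineK.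
have lo n (x : R) : 0 < x -> s n <= (1 + x) * I + (1 + x^-1) * e n.
  move=> x0; rewrite -lee_fin -hs; apply: (L2_perturb (mN n) mf) => //; first by rewrite fI.
  by under eq_integral do rewrite -sqrrN opprB.
have cv (x a : R) (u : nat -> R) : u n @[n --> \oo] --> a ->
   (1 + x) * u n + (1 + x^-1) * e n @[n --> \oo] --> (1 + x) * a.
  move=> ua; rewrite -[X in _ --> X]addr0 -[X in _ --> _ + X](mulr0 (1 + x^-1)).
  by apply: cvgD; apply: cvgMr.
have up' (x : R) : 0 < x -> I <= (1 + x) * S.
  move=> x0; apply: (cvgr_to_ge (cv x S s sS)).
  by apply: nearW => n; rewrite -lee_fin; exact: up.
have lo' (x : R) : 0 < x -> S <= (1 + x) * I.
  move=> x0; apply: (ler_cvg_to sS (cv x I (fun=> I) (cvg_cst I))).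
  by apply: nearW => n; exact: lo.
have S0 : 0 <= S by have := up' 1 ltr01; lra.
have small (a : R) (y : R) : 0 <= a -> 0 < y -> exists2 x, 0 < x & (1 + x) * a <= a + y.
  move=> a0 y0; exists (y / (a + 1)); first by rewrite divr_gt0// ltr_wpDl.
  rewrite mulrDl mul1r lerD2l mulrAC ler_pdivrMr ?ltr_wpDl//.
  by rewrite mulrDr mulr1 lerDl ltW.
congr EFin; apply/eqP; rewrite eq_le; apply/andP; split; apply/ler_addgt0Pr => y y0.
- by have [x x0] := small S y S0 y0; apply: le_trans; exact: up'.
- by have [x x0] := small I y I0 y0; apply: le_trans; exact: lo'.
Qed.

End square_integrable.

(** * Enumeration of the binary tree by generations *)

Section tree_enumeration.

Fixpoint gen (n : nat) : seq (seq bool) :=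
  if n is n'.+1 then flatten [seq [:: rcons v true; rcons v false] | v <- gen n']
  else [:: [::]].

Lemma big_gen (V : nmodType) (f : seq bool -> V) n :
  \sum_(v <- gen n.+1) f v = \sum_(v <- gen n) (f (rcons v true) + f (rcons v false)).
Proof.
rewrite /= big_flatten big_map; apply: eq_bigr => v _.
by rewrite big_cons big_seq1.
Qed.

Lemma mem_gen n v : (v \in gen n) = (size v == n).
Proof.
elim: n v => [|n IH] v; first by rewrite inE size_eq0.
apply/flattenP/eqP => [[_ /mapP[w + ->]]|].
  rewrite IH => /eqP wn; rewrite !inE => /orP[|] /eqP ->; by rewrite size_rcons wn.
case/lastP: v => [//|v b]; rewrite size_rcons => -[vn].
exists [:: rcons v true; rcons v false]; last by case: b; rewrite !inE eqxx ?orbT.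
by apply/mapP; exists v => //; rewrite IH vn.
Qed.

Lemma gen_uniq n : uniq (gen n).
Proof.
elim: n => //= n IH; elim: (gen n) IH => //= v s IH /andP[vs us].
rewrite IH// andbT; apply/andP; split.
  rewrite inE negb_or; apply/andP; split.
    by apply/eqP => /rcons_inj[].
  apply/flattenP => -[_ /mapP[w ws ->]]; rewrite !inE => /orP[]/eqP/rcons_inj[] // e.
  by rewrite e ws in vs.
apply/flattenP => -[_ /mapP[w ws ->]]; rewrite !inE => /orP[]/eqP/rcons_inj[] // e.
by rewrite e ws in vs.
Qed.

Definition tree (n : nat) : seq (seq bool) := flatten [seq gen k | k <- iota 0 n].

Lemma big_tree (V : nmodType) (f : seq bool -> V) n :
  \sum_(v <- tree n) f v = \sum_(0 <= k < n) \sum_(v <- gen k) f v.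
Proof. by rewrite big_flatten big_map /index_iota subn0. Qed.

Lemma big_treeS (V : nmodType) (f : seq bool -> V) n :
  \sum_(v <- tree n.+1) f v = \sum_(v <- tree n) f v + \sum_(v <- gen n) f v.
Proof. by rewrite !big_tree big_nat_recr. Qed.

Lemma mem_tree n v : (v \in tree n) = (size v < n)%N.
Proof.
apply/flattenP/idP => [[_ /mapP[k + ->]]|vn].
  by rewrite mem_iota mem_gen => /andP[_ kn] /eqP ->.
by exists (gen (size v)); [apply: map_f; rewrite mem_iota|rewrite mem_gen].
Qed.

Lemma tree_uniq n : uniq (tree n).
Proof.
elim: n => // n IH; rewrite /tree -addn1 iotaD map_cat flatten_cat cat_uniq -/(tree n) IH/=.
rewrite cats0 gen_uniq andbT; apply/hasPn => v; rewrite mem_gen mem_tree => /eqP ->.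
by rewrite ltnn.
Qed.

End tree_enumeration.

(** * Pathwise identities on the splitting tree *)

Section tree_paths.
Context (R : realType) (d : nat).
Variables (E U : seq bool -> R) (W : box R d).

(** [walk] consumes a path from its first step, whereas passing from a node to its children adds a
    last step. *)
Lemma walk_rcons (pre : seq bool) (st : box R d * R) v b :
  walk E U pre st (rcons v b) =
  (split_box (walk E U pre st v).1 (choose_hyp (walk E U pre st v).1 (U (pre ++ v))) b,
   death (walk E U pre st v) (E (pre ++ v))).
Proof.
elim: v pre st => [|a v IH] pre st /=; first by rewrite cats0.
by rewrite IH cat_rcons.
Qed.

Definition cell v := (node_state E U W v).1.
Definition birth v := (node_state E U W v).2.
Definition hypv v := choose_hyp (cell v) (U v).
Definition dth v := birth v + E v / lam (cell v).

Lemma cell_nil : cell [::] = W. Proof. by []. Qed.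
Lemma birth_nil : birth [::] = 0. Proof. by []. Qed.

Lemma cell_rcons v b : cell (rcons v b) = split_box (cell v) (hypv v) b.
Proof. by rewrite /cell /node_state walk_rcons. Qed.

Hypotheses (d2 : (1 < d)%N) (E0 : forall v, 0 < E v) (U01 : forall v, 0 <= U v <= 1)
  (pW : proper_box W).

Let dp : (0 < d)%N. Proof. exact: ltnW. Qed.

Lemma cell_proper v : proper_box (cell v).
Proof.
elim/last_ind: v => [//|v b IH]; rewrite cell_rcons.
have [j [r [e rc]]] := chooseP dp IH (U01 v).
by rewrite /hypv e; exact: split_box_proper.
Qed.

Lemma hypvP v : exists j r, hypv v = Some (j, r) /\ (cell v).1 j <= r <= (cell v).2 j.
Proof. by apply: chooseP => //; exact: cell_proper. Qed.

Lemma death_dth v : death (node_state E U W v) (E v) = dth v.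
Proof. by rewrite /death /dth -/(cell v) Lam_box//; exact: cell_proper. Qed.

Lemma birth_rcons v b : birth (rcons v b) = dth v.
Proof. by rewrite /birth /node_state walk_rcons -death_dth. Qed.

Lemma birth_le_dth v : birth v <= dth v.
Proof. by rewrite lerDl divr_ge0 ?(ltW (E0 v))//; exact: lam_ge0 (cell_proper v). Qed.

Lemma birth_ge0 v : 0 <= birth v.
Proof.
elim/last_ind: v => [//|v b IH]; rewrite birth_rcons.
exact: le_trans (birth_le_dth v).
Qed.

Lemma cell_sub v k : W.1 k <= (cell v).1 k /\ (cell v).2 k <= W.2 k.
Proof.
elim/last_ind: v => [|v b [IH1 IH2]]; first by rewrite cell_nil.
have [j [r [e /andP[r1 r2]]]] := hypvP v; rewrite cell_rcons e.
by case: b => /=; case: eqVneq => [kj|_]//; split=> //; rewrite -?kj in r1 r2 *;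
  [exact: le_trans r2 _|exact: le_trans r1].
Qed.

Lemma vol_cell_rcons v : vol (cell (rcons v true)) + vol (cell (rcons v false)) = vol (cell v).
Proof.
have [j [r [e _]]] := hypvP v.
by rewrite !cell_rcons e vol_splitD.
Qed.

Definition Fv v : R := facet (cell v) (hypv v).

Lemma Fv_ge0 v : 0 <= Fv v.
Proof.
rewrite /Fv; have [j [r [-> _]]] := hypvP v.
by rewrite face_ge0//; exact: cell_proper.
Qed.

Lemma facet_vol_Fv v : facet_vol (cell v) (hypv v) = (Fv v)%:E.
Proof.
rewrite /Fv; have [j [r [-> rc]]] := hypvP v.
by rewrite facet_volE//; exact: cell_proper.
Qed.

(** The s of the overview, in units of the exponential clock; [Qv] is its Q_v(t). *)
Definition rest t v : R := Num.max (t - birth v) 0 * lam (cell v).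
Definition Qv t v : R := if rest t v < E v then Fv v - kappa (cell v) * (E v - rest t v) else 0.

Lemma rest_ge0 t v : 0 <= rest t v.
Proof. by rewrite /rest mulr_ge0 ?le_max ?lexx ?orbT// lam_ge0//; exact: cell_proper. Qed.

(** A stretch of the clock times [kappa] is d vol times the corresponding stretch of real time,
    because the clock runs at rate [lam]. The two cases are whether the cell dies by time [t] or
    later. *)
Lemma Qv_time t v : 0 <= t ->
  (if dth v <= t then Fv v else 0) -
    d%:R * (vol (cell v) * Num.max (Num.min (dth v) t - birth v) 0) =
  Qv 0 v - Qv t v.
Proof.
move=> t0; have b0 := birth_ge0 v; have e0 := E0 v.
have r0 : rest 0 v = 0 by rewrite /rest (max_idPr _) ?mul0r// sub0r oppr_le0.
rewrite /Qv r0 e0 subr0.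
have := lam_ge0 (cell_proper v); rewrite le_eqVlt => /orP[/eqP l0|l0].
  (* For a cell reduced to a point the clock has no rate, but its facet and its volume vanish as
     well. *)
  have F0 : Fv v = 0.
    rewrite /Fv; have [j [r [-> _]]] := hypvP v; rewrite /= face_eq0//.
    exact: cell_proper.
  have v0 : vol (cell v) = 0.
    by rewrite (vol_face _ (Ordinal dp)) side_eq0// ?mul0r//; exact: cell_proper.
  rewrite /kappa F0 v0 !(mul0r, mulr0, subr0) !if_same; ring.
have kE : kappa (cell v) * E v = d%:R * vol (cell v) * (dth v - birth v).
  by rewrite /kappa /dth; field; rewrite gt_eqF.
have [td|dt] := ltP t (dth v).
  have -> : rest t v < E v.
    rewrite /rest -ltr_pdivlMr// gt_max; apply/andP; split; last by rewrite divr_gt0.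
    by rewrite ltrBlDl.
  rewrite sub0r mulrBr kE /rest.
  have -> : kappa (cell v) * (Num.max (t - birth v) 0 * lam (cell v)) =
     d%:R * vol (cell v) * Num.max (t - birth v) 0.
    by rewrite /kappa; field; rewrite gt_eqF.
  by ring.
have -> : (rest t v < E v) = false.
  apply/negbTE; rewrite -leNgt /rest -ler_pdivrMr// le_max lerBrDl dt//.
rewrite (max_idPl _) ?subr_ge0 ?birth_le_dth// kE; ring.
Qed.

(** The part of the space-time volume of [W] up to time [t] that is left to the generations from [n]
    on. *)
Definition Rn t n : R := \sum_(v <- gen n) vol (cell v) * Num.max (t - birth v) 0.

(** The children of a node share its volume and are born when it dies, so what a generation does not
    fill is handed on entirely to the next one. *)
Lemma telescope_volume t n : 0 <= t ->
  \sum_(v <- tree n) vol (cell v) * Num.max (Num.min (dth v) t - birth v) 0 + Rn t n = t * vol W.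
Proof.
move=> t0; elim: n => [|n IH].
  rewrite /tree big_nil add0r /Rn /= big_seq1 cell_nil birth_nil subr0 (max_idPl t0).
  by rewrite mulrC.
rewrite -IH big_treeS -addrA; congr (_ + _).
rewrite /Rn big_gen -big_split/=; apply: eq_bigr => v _.
rewrite !birth_rcons -mulrDl vol_cell_rcons -mulrDr; congr (_ * _).
have bd := birth_le_dth v.
have [h1|h1] := leP (dth v) t.
  have h2 := le_trans bd h1.
  by rewrite !(max_idPl _) ?subr_ge0//; ring.
by rewrite [X in _ + X](max_idPr _) ?addr0// subr_le0 ltW.
Qed.

Definition Sn t n : R := \sum_(v <- tree n) (if dth v <= t then Fv v else 0).
Definition Nn t n : R := \sum_(v <- tree n) Qv t v.

(** The identity of the overview restricted to the generations below [n]. The unfilled space-time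
    volume remains as the error [d * Rn] and is shown to vanish in mean below. *)
Lemma Sn_decomposition t n : 0 <= t ->
  Sn t n - d%:R * (t * vol W) = Nn 0 n - Nn t n - d%:R * Rn t n.
Proof.
move=> t0; rewrite -(telescope_volume n t0) /Nn -sumrB.
rewrite (eq_bigr _ (fun v _ => esym (Qv_time v t0))) sumrB -mulr_sumr /Sn; ring.
Qed.

Lemma Rn_ge0 t n : 0 <= Rn t n.
Proof.
apply: sumr_ge0 => v _; rewrite mulr_ge0 ?le_max ?lexx ?orbT// vol_ge0//.
exact: cell_proper.
Qed.

(** The positive part of t - b is at most exp(t - b). The exponential is preferred because exp(-b)
    factors over the lifetimes along a path, so that its mean can be bounded one generation at a
    time. *)
Lemma Rn_le t n : Rn t n <= expR t * \sum_(v <- gen n) vol (cell v) * expR (- birth v).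
Proof.
rewrite mulr_sumr; apply: ler_sum => v _.
rewrite mulrCA ler_wpM2l ?vol_ge0//; first exact: cell_proper.
rewrite -expRD ge_max expR_ge0 andbT.
by apply: le_trans (expR_ge1Dx _); rewrite lerDr.
Qed.

(** All terms are nonnegative, so the unordered sum over nodes may be arranged by generation. *)
Lemma stit_series t : stit_surface E U W t =
  (\sum_(n <oo) (\sum_(v <- gen n) (if (dth v <= t)%R then Fv v else 0%R))%R%:E)%E.
Proof.
rewrite /stit_surface esum_mkcond.
pose f v : \bar R := (if dth v <= t then Fv v else 0)%:E.
transitivity (\esum_(v in [set: seq bool]) f v)%E.
  apply: eq_esum => v _; rewrite /f; have [/set_mem/=|/negP] := boolP (v \in _).
    by rewrite death_dth => ->; exact: facet_vol_Fv.
  rewrite inE /= death_dth => /negP/negbTE -> //.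
have f0 v : (0 <= f v)%E by rewrite lee_fin; case: ifP => // _; exact: Fv_ge0.
rewrite (_ : setT = \bigcup_n [set` gen n]); last first.
  apply/esym/seteqP; split => // v _; exists (size v) => //=; by rewrite mem_gen.
rewrite nneseries_sum_bigcup//; last first.
  apply/trivIsetP => i j _ _ ij; apply/seteqP; split => // v [/=].
  by rewrite !mem_gen => /eqP -> /eqP e; rewrite e eqxx in ij.
apply: eq_eseriesr => n _; rewrite esum_fset//; last exact: finite_seq.
by rewrite -fsbig_seq ?gen_uniq// sumEFin.
Qed.

Lemma Sn_series t n :
  (\sum_(0 <= k < n) (\sum_(v <- gen k) (if (dth v <= t)%R then Fv v else 0%R))%R%:E)%E =
  (Sn t n)%:E.
Proof. by rewrite sumEFin /Sn big_tree. Qed.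

End tree_paths.

(** * Bounds for boxes inside the unit cube *)

Section unit_box_bounds.
Context (R : realType) (d : nat).
Implicit Types c : box R d.

Definition in_unit c := forall i, 0 <= c.1 i /\ c.2 i <= 1.

Variable c : box R d.
Hypotheses (pc : proper_box c) (uc : in_unit c).

Lemma side_le1 i : side c i <= 1.
Proof. by rewrite /side; have [] := uc i; lra. Qed.

Lemma lam_le : lam c <= d%:R.
Proof.
rewrite -[X in _ <= X%:R]card_ord -sumr_const; apply: ler_sum => i _; exact: side_le1.
Qed.

Lemma face_le1 i : face c i <= 1.
Proof. by apply: prodr_ile1 => j; rewrite side_ge0// side_le1. Qed.

Lemma vol_le1 : vol c <= 1.
Proof. by apply: prodr_ile1 => j; rewrite side_ge0// side_le1. Qed.

Lemma kappa_ge0 : 0 <= kappa c.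
Proof. by rewrite /kappa divr_ge0 ?lam_ge0// mulr_ge0// vol_ge0. Qed.

Lemma kappa_le1 : kappa c <= 1.
Proof.
rewrite /kappa; have := lam_ge0 pc; rewrite le_eqVlt => /orP[/eqP <-|l0].
  by rewrite invr0 mulr0.
rewrite ler_pdivrMr// mul1r -sum_side_face; apply: ler_sum => i _.
by rewrite ler_piMr ?side_ge0// face_le1.
Qed.

Lemma beta_ge0 : 0 <= beta c.
Proof.
rewrite /beta divr_ge0 ?lam_ge0// sumr_ge0// => i _.
by rewrite mulr_ge0 ?sqr_ge0// side_ge0.
Qed.

Lemma beta_le1 : beta c <= 1.
Proof.
rewrite /beta; have := lam_ge0 pc; rewrite le_eqVlt => /orP[/eqP <-|l0].
  by rewrite invr0 mulr0.
rewrite ler_pdivrMr// mul1r; apply: ler_sum => i _.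
by rewrite ler_piMr ?side_ge0// exprn_ile1// ?face_ge0// face_le1.
Qed.

Lemma psi_ge0 : 0 <= psi c.
Proof. by rewrite mulr_ge0 ?vol_ge0 ?lam_ge0. Qed.

Lemma side_le_lam i : side c i <= lam c.
Proof. by rewrite /lam (bigD1 i)//= lerDl sumr_ge0// => j _; exact: side_ge0. Qed.

(* Dimension at least three enters here: a face has two further sides. *)
Lemma face_le_sqr_lam i : (2 < d)%N -> face c i <= lam c ^+ 2.
Proof.
move=> d3; have [j ji] : exists j : 'I_d, j != i.
  exists (if i == Ordinal (ltnW (ltnW d3)) then Ordinal (ltnW d3) else Ordinal (ltnW (ltnW d3))).
  by case: (eqVneq i) => [->|]; rewrite // eq_sym.
have [k /andP[ki kj]] : exists k : 'I_d, (k != i) && (k != j).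
  case: (pickP (fun k => (k != i) && (k != j))) => [k hk|h]; first by exists k.
  have : (#|'I_d| <= #|[set i; j]%SET|)%N.
    apply: subset_leq_card; apply/fintype.subsetP => k _.
    by have := h k => /= /negbT; rewrite negb_and !negbK !inE.
  by rewrite card_ord cards2 leqNgt eq_sym ji d3.
rewrite /face (bigD1 j)//= (bigD1 k) ?ki//= mulrA expr2.
apply: (@le_trans _ _ (side c j * side c k)).
  rewrite ler_piMr ?mulr_ge0 ?side_ge0//.
  by apply: prodr_ile1 => l; rewrite side_ge0// side_le1.
by rewrite ler_pM ?side_ge0// side_le_lam.
Qed.

(** In side_i face_i^2 one face joins the side to give [vol], and the other is at most
    [lam ^+ 2]. *)
Lemma beta_le_psi : (2 < d)%N -> beta c <= d%:R * psi c.
Proof.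
move=> d3; rewrite /beta; have := lam_ge0 pc; rewrite le_eqVlt => /orP[/eqP <-|l0].
  by rewrite invr0 mulr0 mulr_ge0// psi_ge0.
rewrite ler_pdivrMr//.
have -> : d%:R * psi c * lam c = \sum_(i < d) vol c * lam c ^+ 2.
  by rewrite sumr_const card_ord -mulr_natl /psi; ring.
apply: ler_sum => i _; rewrite expr2 mulrA -vol_face.
by rewrite ler_wpM2l ?vol_ge0// face_le_sqr_lam.
Qed.

End unit_box_bounds.

(** * Measurability along a path of the tree *)

Section measurable_tree.
Context (R : realType) (d : nat) d1 (S : measurableType d1).
Variables (E U : seq bool -> S -> R) (W : box R d).
Hypotheses (d2 : (1 < d)%N) (E0 : forall v w, 0 < E v w)
  (U01 : forall v w, 0 <= U v w <= 1) (pW : proper_box W).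

Notation cl v w := (cell (E^~ w) (U^~ w) W v).
Notation br v w := (birth (E^~ w) (U^~ w) W v).

(** Measurability is required only of the inputs at the first [n] prefixes of [v]. The lemmas below
    thus also apply to a sigma-algebra of the form [without], for which one input is missing. *)
Definition measurable_before n v := forall k, (k < n)%N ->
  measurable_fun setT (E (take k v)) /\ measurable_fun setT (U (take k v)).

Definition measurable_box (c : S -> box R d) :=
  (forall i, measurable_fun setT (fun w => (c w).1 i)) /\
  (forall i, measurable_fun setT (fun w => (c w).2 i)).

Lemma measurable_side c i : measurable_box c -> measurable_fun setT (fun w => side (c w) i).
Proof. by move=> [m1 m2]; exact: measurable_funB. Qed.

Lemma measurable_lam c : measurable_box c -> measurable_fun setT (fun w => lam (c w)).
Proof. by move=> mc; apply: measurable_sum => i; exact: measurable_side. Qed.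

Lemma measurable_vol c : measurable_box c -> measurable_fun setT (fun w => vol (c w)).
Proof. by move=> mc; apply: measurable_prod => i _; exact: measurable_side. Qed.

Lemma measurable_face c i : measurable_box c -> measurable_fun setT (fun w => face (c w) i).
Proof.
move=> mc; rewrite /face.
under eq_fun do rewrite -big_filter.
by apply: measurable_prod => j _; exact: measurable_side.
Qed.

Lemma measurable_inv (f : S -> R) : (forall w, 0 <= f w) -> measurable_fun setT f ->
  measurable_fun setT (fun w => (f w)^-1).
Proof.
move=> f0 mf; rewrite (_ : (fun w => _) = (fun w => f w `^ (-1))).
  exact: (measurableT_comp (measurable_powR (-1)) mf).
by apply/funext => w; rewrite powR_inv1.
Qed.

Lemma measurable_kappa c : (forall w, proper_box (c w)) -> measurable_box c ->
  measurable_fun setT (fun w => kappa (c w)).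
Proof.
move=> pc mc; apply: measurable_funM.
  by apply: measurable_funM => //; exact: measurable_vol.
by apply: measurable_inv; [move=> w; exact: lam_ge0|exact: measurable_lam].
Qed.

Lemma measurable_beta c : (forall w, proper_box (c w)) -> measurable_box c ->
  measurable_fun setT (fun w => beta (c w)).
Proof.
move=> pc mc; apply: measurable_funM.
  apply: measurable_sum => i; apply: measurable_funM; first exact: measurable_side.
  by apply: measurable_funX; exact: measurable_face.
by apply: measurable_inv; [move=> w; exact: lam_ge0|exact: measurable_lam].
Qed.

Lemma measurable_psi c : measurable_box c -> measurable_fun setT (fun w => psi (c w)).
Proof. by move=> mc; apply: measurable_funM; [exact: measurable_vol|exact: measurable_lam]. Qed.

Lemma measurable_in_box c (x : 'I_d -> S -> R) : measurable_box c ->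
  (forall k, measurable_fun setT (x k)) ->
  measurable_fun setT (fun w => in_box (c w) (fun k => x k w)).
Proof.
move=> [m1 m2] mx.
rewrite (_ : (fun w => _) = (fun w =>
  all (fun i => (c w).1 i <= x i w <= (c w).2 i) (enum 'I_d))); last first.
  apply/funext => w; apply/forallP/allP => [h i _|h i]; first exact: h.
  by apply: h; rewrite mem_enum.
elim: (enum 'I_d) => [|i l IH] //=.
apply: measurable_and => //; apply: measurable_and; exact: measurable_fun_ler.
Qed.

Lemma measurable_choose d3 (V : measurableType d3) (G : S -> option ('I_d * R) -> V)
    (c : S -> box R d) (u : S -> R) :
  (forall j (r : S -> R), measurable_fun setT r ->
     measurable_fun setT (fun t => G t (Some (j, r t)))) ->
  measurable_fun setT (fun t => G t None) -> measurable_box c ->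
  measurable_fun setT u -> measurable_fun setT (fun t => G t (choose_hyp (c t) (u t))).
Proof.
move=> mG mN mc mu; apply: measurable_pick => //; [exact: mc.1|exact: mc.2|].
apply: measurable_funM => //; exact: measurable_lam.
Qed.

Lemma measurable_split_box (c : S -> box R d) (u : S -> R) b :
  measurable_box c -> measurable_fun setT u ->
  measurable_box (fun w => split_box (c w) (choose_hyp (c w) (u w)) b).
Proof.
move=> mc mu; split => i.
- apply: (measurable_choose (G := fun w H => (split_box (c w) H b).1 i)) => //.
    move=> j r mr; case: b => /=; first exact: mc.1.
    by case: (i == j) => //; exact: mc.1.
  exact: mc.1.
- apply: (measurable_choose (G := fun w H => (split_box (c w) H b).2 i)) => //.
    move=> j r mr; case: b => /=; last exact: mc.2.
    by case: (i == j) => //; exact: mc.2.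
  exact: mc.2.
Qed.

Lemma cl_proper v w : proper_box (cl v w).
Proof. exact: cell_proper. Qed.

(** The walk to [v] reads the inputs at its strict prefixes only, which are the [take k v] with
    [k < size v]. *)
Lemma measurable_node v : measurable_before (size v) v ->
  measurable_box (fun w => cl v w) /\ measurable_fun setT (fun w => br v w).
Proof.
elim/last_ind: v => [|v b IH] mv.
  by split; [split => i; exact: measurable_cst|exact: measurable_cst].
have [mc mb] : measurable_box (fun w => cl v w) /\ measurable_fun setT (fun w => br v w).
  apply: IH => k kv; have := mv k; rewrite size_rcons -cats1 takel_cat; last exact: ltnW.
  by apply; rewrite ltnS ltnW.
have [mE mU] : measurable_fun setT (E v) /\ measurable_fun setT (U v).
  by have := mv (size v); rewrite size_rcons -cats1 takel_cat// take_size; exact.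
split.
  under eq_fun do rewrite cell_rcons.
  exact: measurable_split_box.
under eq_fun do rewrite birth_rcons//.
apply: measurable_funD => //; apply: measurable_funM => //.
by apply: measurable_inv; [move=> w; apply: lam_ge0; exact: cl_proper|exact: measurable_lam].
Qed.

Lemma measurable_cell v : measurable_before (size v) v -> measurable_box (fun w => cl v w).
Proof. by move=> /measurable_node[]. Qed.

Lemma measurable_rest t v : measurable_before (size v) v ->
  measurable_fun setT (fun w => rest (E^~ w) (U^~ w) W t v).
Proof.
move=> /measurable_node[mc mb]; apply: measurable_funM; last exact: measurable_lam.
by apply: measurable_maxr => //; exact: measurable_funB.
Qed.

Lemma measurable_facet c u : measurable_box c -> measurable_fun setT u ->
  measurable_fun setT (fun w => facet (c w) (choose_hyp (c w) (u w))).
Proof.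
move=> mc mu; apply: (measurable_choose (G := fun w H => facet (c w) H)) => // j r mr.
exact: measurable_face.
Qed.

Lemma measurable_Fv v : measurable_before (size v).+1 v ->
  measurable_fun setT (fun w => Fv (E^~ w) (U^~ w) W v).
Proof.
move=> mv; apply: measurable_facet.
  by apply: measurable_cell => k kv; apply: mv; exact: ltnW.
by have := mv (size v); rewrite take_size => /(_ (ltnSn _))[].
Qed.

Lemma measurable_Qv t v : measurable_before (size v).+1 v ->
  measurable_fun setT (fun w => Qv (E^~ w) (U^~ w) W t v).
Proof.
move=> mv; have mv' : measurable_before (size v) v by move=> k kv; apply: mv; exact: ltnW.
have mr := measurable_rest t mv'.
have [mE _] : measurable_fun setT (E v) /\ measurable_fun setT (U v).
  by have := mv (size v); rewrite take_size => /(_ (ltnSn _)).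
apply: measurable_fun_ifT => //; first exact: measurable_fun_ltr.
apply: measurable_funB; first exact: measurable_Fv.
apply: measurable_funM; last exact: measurable_funB.
by apply: measurable_kappa => [w|]; [exact: cl_proper|exact: measurable_cell].
Qed.

Lemma measurable_dth v : measurable_before (size v).+1 v ->
  measurable_fun setT (fun w => dth (E^~ w) (U^~ w) W v).
Proof.
move=> mv; have mv' : measurable_before (size v) v by move=> k kv; apply: mv; exact: ltnW.
have [mc mb] := measurable_node mv'.
have [mE _] : measurable_fun setT (E v) /\ measurable_fun setT (U v).
  by have := mv (size v); rewrite take_size => /(_ (ltnSn _)).
apply: measurable_funD => //; apply: measurable_funM => //.
by apply: measurable_inv; [move=> w; apply: lam_ge0; exact: cl_proper|exact: measurable_lam].
Qed.

End measurable_tree.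

(** * The random tree: averaging over the inputs of one node *)

Section tree_probability.
Context (R : realType) (d : nat) d0 (T : measurableType d0) (P : probability T R).
Variables (E U : seq bool -> T -> R) (W : box R d).
Hypotheses (d3 : (2 < d)%N) (E0 : forall v w, 0 < E v w)
  (U01 : forall v w, 0 <= U v w <= 1) (pW : proper_box W) (uW : in_unit W).
Hypotheses (mE : forall v, measurable_fun setT (E v))
  (mU : forall v, measurable_fun setT (U v)).

Definition input (z : seq bool + seq bool) : T -> R :=
  match z with inl v => E v | inr v => U v end.

Hypothesis indX : mutually_independent P input.
Hypotheses (lawE : forall v A, measurable A -> P (E v @^-1` A) = exponential_prob 1 A)
  (lawU : forall v A, measurable A -> P (U v @^-1` A) = lebesgue_measure (A `&` `[0, 1])).

Let d2 : (1 < d)%N. Proof. exact: ltnW. Qed.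

Notation cl v w := (cell (E^~ w) (U^~ w) W v).
Notation br v w := (birth (E^~ w) (U^~ w) W v).
Notation rs t v w := (rest (E^~ w) (U^~ w) W t v).
Notation Fw v w := (Fv (E^~ w) (U^~ w) W v).
Notation Qw t v w := (Qv (E^~ w) (U^~ w) W t v).

Let mX z : measurable_fun setT (input z).
Proof. by case: z => v; [exact: mE|exact: mU]. Qed.

Let clp v w : proper_box (cl v w). Proof. exact: cell_proper. Qed.

Let clu v w : in_unit (cl v w).
Proof.
move=> i; have [h1 h2] := cell_sub (E ^~ w) d2 (U01 ^~ w) pW v i.
by have [? ?] := uW i; split; [exact: le_trans h1|exact: le_trans h2 _].
Qed.

Lemma before_all n v : measurable_before E U n v.
Proof. by move=> k _; split. Qed.

(** A path that does not read the inputs of [v] keeps its measurability when [E v] is omitted. With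
    [before_U] and [take_neq], this covers the cell and the birth time of [v] itself. *)
Lemma before_E v n u : (forall k, (k < n)%N -> take k u != v) ->
  measurable_before (E : _ -> without input (inl v) -> R) (U : _ -> without input (inl v) -> R) n u.
Proof.
move=> h k kn; split.
- by apply: (@measurable_fun_without _ _ _ _ input (inl v) (inl (take k u))); apply: contra (h k kn) => /eqP[->].
- exact: (@measurable_fun_without _ _ _ _ input (inl v) (inr (take k u))).
Qed.

Lemma before_U v n u : (forall k, (k < n)%N -> take k u != v) ->
  measurable_before (E : _ -> without input (inr v) -> R) (U : _ -> without input (inr v) -> R) n u.
Proof.
move=> h k kn; split.
- exact: (@measurable_fun_without _ _ _ _ input (inr v) (inl (take k u))).
- by apply: (@measurable_fun_without _ _ _ _ input (inr v) (inr (take k u))); apply: contra (h k kn) => /eqP[->].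
Qed.

Lemma take_neq (v : seq bool) k : (k < size v)%N -> take k v != v.
Proof. by move=> kv; apply/eqP => /(congr1 size); rewrite size_take kv => e; rewrite e ltnn in kv. Qed.

Lemma integral_E v (g : R -> R) (c : R) (r Z : without input (inl v) -> R) :
  measurable_fun setT g -> (forall x, 0 <= x -> 0 <= g x) ->
  (forall s, 0 <= s -> (\int[P]_w (if s < E v w then g (E v w - s) else 0)%:E =
     (c * expR (- s))%:E)%E) ->
  measurable_fun setT r -> measurable_fun setT Z ->
  (forall w, 0 <= r w) -> (forall w, 0 <= Z w) ->
  (\int[P]_w ((if r w < E v w then g (E v w - r w) else 0) * Z w)%:E =
   \int[P]_w (c * expR (- r w) * Z w)%:E)%E.
Proof.
move=> mg g0 hg mr mZ r0 Z0.
pose F (z : without input (inl v) * R) : \bar R :=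
  ((if r z.1 < z.2 then g (z.2 - r z.1) else 0) * Z z.1)%:E.
have mr1 : measurable_fun setT (fun z : without input (inl v) * R => r z.1).
  exact: (measurableT_comp mr measurable_fst).
have mZ1 : measurable_fun setT (fun z : without input (inl v) * R => Z z.1).
  exact: (measurableT_comp mZ measurable_fst).
have mF : measurable_fun setT F.
  apply/measurable_EFinP; apply: measurable_funM => //.
  apply: measurable_fun_ifT => //; first by apply: measurable_fun_ltr => //; exact: measurable_snd.
  apply: (measurableT_comp mg); apply: measurable_funB => //; exact: measurable_snd.
have F0 z : (0 <= F z)%E.
  rewrite lee_fin mulr_ge0//; case: ifPn => // h; rewrite g0// subr_ge0; exact: ltW.
transitivity (\int[P]_w F (w, input (inl v) w))%E; first by [].
rewrite (integral_without mX indX mF F0); apply: eq_integral => w _.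
rewrite /F /= [in RHS]EFinM -hg// -ge0_integralZr//.
- apply/measurable_EFinP; apply: measurable_fun_ifT => //; first exact: measurable_fun_ltr.
  by apply: (measurableT_comp mg); exact: measurable_funB.
- by move=> w' _; rewrite lee_fin; case: ifPn => // h; rewrite g0// subr_ge0; exact: ltW.
- by rewrite lee_fin.
Qed.

(** The cell of [v] is determined by inputs other than [U v], so averaging over [U v] reduces to a
    split of one fixed box. *)
Lemma integral_pick v (G : without input (inr v) -> option ('I_d * R) -> \bar R) :
  (forall j (r : without input (inr v) * R -> R), measurable_fun setT r ->
     measurable_fun setT (fun z => G z.1 (Some (j, r z)))) ->
  measurable_fun setT (fun w => G w None) -> (forall w H, (0 <= G w H)%E) ->
  (\int[P]_w G w (choose_hyp (cl v w) (U v w)) =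
   \int[P]_w \int[P]_w' G w (choose_hyp (cl v w) (U v w')))%E /\
  measurable_fun setT (fun w : T => \int[P]_w' G w (choose_hyp (cl v w) (U v w')))%E.
Proof.
move=> mG mN G0.
pose F (z : without input (inr v) * R) : \bar R := G z.1 (choose_hyp (cl v z.1) z.2).
have [m1 m2] : measurable_box (fun w : without input (inr v) => cl v w).
  by apply: measurable_cell => //; apply: before_U => k; exact: take_neq.
have mF : measurable_fun setT F.
  apply: (measurable_choose (G := fun z H => G z.1 H) (c := fun z => cl v z.1)) => //.
  - exact: (measurableT_comp mN measurable_fst).
  - split => i; [exact: (measurableT_comp (m1 i) measurable_fst)|
      exact: (measurableT_comp (m2 i) measurable_fst)].
have mI := measurable_integral_without P mX mF (fun z => G0 _ _).
split; last exact: (measurable_fun_withoutW mX mI).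
transitivity (\int[P]_w F (w, input (inr v) w))%E; first by [].
by rewrite (integral_without mX indX mF (fun z => G0 _ _)).
Qed.

(** Two separate measurabilities, because the clock and the mark of [v] are integrated out one after
    the other. *)
Definition node_free v (Y : T -> R) :=
  measurable_fun setT (Y : without input (inl v) -> R) /\
  measurable_fun setT (Y : without input (inr v) -> R).

Lemma node_free_measurable v Y : node_free v Y -> measurable_fun setT Y.
Proof. by move=> [+ _]; exact: measurable_fun_withoutW. Qed.

Lemma rs_ge0 t v w : 0 <= rs t v w. Proof. exact: rest_ge0. Qed.

Let fact1 : (1`! = 1)%N. Proof. by []. Qed.
Let fact2 : (2`! = 2)%N. Proof. by []. Qed.

Lemma node_moment v t m k (b : box R d -> R) (Y : T -> R) :
  (m <= 2)%N ->
  (forall c, proper_box c ->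
    (\int[P]_w (facet c (choose_hyp c (U v w)) ^+ k)%:E = (b c)%:E)%E) ->
  node_free v Y -> (forall w, 0 <= Y w) ->
  (\int[P]_w ((if (rs t v w < E v w)%R then (E v w - rs t v w) ^+ m else 0) *
      (Fw v w ^+ k * Y w))%:E =
   \int[P]_w (m`!%:R * expR (- rs t v w) * (b (cl v w) * Y w))%:E)%E.
Proof.
move=> m2 hb [mY1 mY2] Y0.
have bE : measurable_before (E : _ -> without input (inl v) -> R)
    (U : _ -> without input (inl v) -> R) (size v) v.
  by apply: before_E => j; exact: take_neq.
have bU : measurable_before (E : _ -> without input (inr v) -> R)
    (U : _ -> without input (inr v) -> R) (size v) v.
  by apply: before_U => j; exact: take_neq.
have mrE := measurable_rest (S := without input (inl v)) d2 U01 pW t bE.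
have mrU := measurable_rest (S := without input (inr v)) d2 U01 pW t bU.
have mcE := measurable_cell (S := without input (inl v)) d2 U01 pW bE.
have mcU := measurable_cell (S := without input (inr v)) d2 U01 pW bU.
rewrite (@integral_E v (fun x => x ^+ m) m`!%:R _ (fun w => Fw v w ^+ k * Y w))//.
- pose G (w : without input (inr v)) (H : option ('I_d * R)) : \bar R :=
    (m`!%:R * expR (- rs t v w) * (`|facet (cl v w) H ^+ k| * Y w))%:E.
  transitivity (\int[P]_w G w (choose_hyp (cl v w) (U v w)))%E.
    apply: eq_integral => w _; rewrite /G ger0_norm//.
    by rewrite exprn_ge0//; exact: Fv_ge0.
  have me : measurable_fun setT (fun w : without input (inr v) => m`!%:R * expR (- rs t v w)).
    apply: measurable_funM => //; apply: measurableT_comp => //; exact: measurable_funN.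
  rewrite (integral_pick _ _ _).1.
  + apply: eq_integral => w _; rewrite /G.
    have fge w' : 0 <= facet (cl v w) (choose_hyp (cl v w) (U v w')) ^+ k.
      have [j [r [-> _]]] := chooseP (ltnW d2) (clp v w) (U01 v w').
      by rewrite exprn_ge0// face_ge0.
    transitivity (\int[P]_w' ((facet (cl v w) (choose_hyp (cl v w) (U v w')) ^+ k)%:E *
        (m`!%:R * expR (- rs t v w) * Y w)%:E))%E.
      by apply: eq_integral => w' _; rewrite ger0_norm// -EFinM; congr EFin; ring.
    rewrite ge0_integralZr//.
    * by rewrite hb// -EFinM; congr EFin; ring.
    * apply/measurable_EFinP; apply: measurable_funX.
      exact: (measurable_facet (c := fun=> cl v w)).
    * by move=> w' _; rewrite lee_fin.
    * by rewrite lee_fin !mulr_ge0// ?expR_ge0.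
  + move=> j r mr; apply/measurable_EFinP; apply: measurable_funM.
      exact: (measurableT_comp me measurable_fst).
    apply: measurable_funM; last exact: (measurableT_comp mY2 measurable_fst).
    apply: measurableT_comp => //; apply: measurable_funX.
    exact: (measurableT_comp (measurable_face j mcU) measurable_fst).
  + rewrite /G /facet; apply/measurable_EFinP; apply: measurable_funM => //.
    exact: measurable_funM.
  + by move=> w H; rewrite lee_fin !mulr_ge0// ?expR_ge0.
- by move=> x x0; exact: exprn_ge0.
- move=> s s0; case: m m2 => [|[|[|//]]] _.
  + by rewrite mul1r -(exponential_tail (mE v) (lawE v) s0).
  + by rewrite mul1r -(exponential_tail1 (mE v) (lawE v) s0).
  + exact: (exponential_tail2 (mE v) (lawE v)).
- apply: measurable_funM => //; apply: measurable_funX.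
  apply: (measurable_facet (S := without input (inl v)) (c := fun w => cl v w) (u := U v)) => //.
  exact: (@measurable_fun_without _ _ _ _ input (inl v) (inr v)).
- by move=> w; exact: rs_ge0.
- by move=> w; rewrite mulr_ge0// exprn_ge0//; exact: Fv_ge0.
Qed.

(** * Mean, variance and orthogonality of the node terms *)

Lemma integral_bounded (f : T -> R) (C : R) : measurable_fun setT f ->
  (forall w, 0 <= f w <= C) -> (\int[P]_w (f w)%:E)%E \is a fin_num.
Proof.
move=> mf fC; rewrite ge0_fin_numE; last first.
  by apply: integral_ge0 => w _; rewrite lee_fin; case/andP: (fC w).
apply: (@le_lt_trans _ _ C%:E); last exact: ltry.
rewrite -(integral_cst_probability P C).
apply: ge0_le_integral => //.
- by move=> w _; rewrite lee_fin; case/andP: (fC w).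
- exact/measurable_EFinP.
- by move=> w _; rewrite lee_fin; case/andP: (fC w).
Qed.

Let mcl v : measurable_box (fun w => cl v w).
Proof. by apply: measurable_cell => //; exact: before_all. Qed.

Let mrs t v : measurable_fun setT (fun w => rs t v w).
Proof. by apply: measurable_rest => //; exact: before_all. Qed.

Let mF v : measurable_fun setT (fun w => Fw v w).
Proof. by apply: measurable_Fv => //; exact: before_all. Qed.

Let mQ t v : measurable_fun setT (fun w => Qw t v w).
Proof. by apply: measurable_Qv => //; exact: before_all. Qed.

Let mbeta v : measurable_fun setT (fun w => beta (cl v w)).
Proof. by apply: measurable_beta. Qed.

Let mkappa v : measurable_fun setT (fun w => kappa (cl v w)).
Proof. by apply: measurable_kappa. Qed.

Lemma measurable_exp_rest t v : measurable_fun setT (fun w => expR (- rs t v w)).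
Proof. by apply: measurableT_comp => //; exact: measurable_funN. Qed.

Lemma exp_rest_bounds t v w : 0 <= expR (- rs t v w) <= 1.
Proof. by rewrite expR_ge0 -expR0 ler_expR oppr_le0 rs_ge0. Qed.

Lemma node_free_kappa v k (a : R) : node_free v (fun w => a * kappa (cl v w) ^+ k).
Proof.
split; apply: measurable_funM => //; apply: measurable_funX; apply: measurable_kappa => //.
- by apply: measurable_cell => //; apply: before_E => j; exact: take_neq.
- by apply: measurable_cell => //; apply: before_U => j; exact: take_neq.
Qed.

(** The variance of [Qv] at time [t], with the clock already averaged: exp(-rest) is the conditional
    probability that the node splits after [t]. *)
Definition variance_at t v : R := fine (\int[P]_w (expR (- rs t v w) * beta (cl v w))%:E).

Lemma variance_atE t v :
  (\int[P]_w (expR (- rs t v w) * beta (cl v w))%:E = (variance_at t v)%:E)%E.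
Proof.
rewrite /variance_at fineK//; apply: (integral_bounded (C := 1)).
  by apply: measurable_funM => //; exact: measurable_exp_rest.
move=> w; have /andP[e0 e1] := exp_rest_bounds t v w.
by rewrite mulr_ge0 ?beta_ge0//= mulr_ile1 ?beta_ge0 ?beta_le1.
Qed.

(** Up to the factor exp(-rest), the three terms of the square have means beta, -2 kappa^2 and 2
    kappa^2, the last 2 being the second moment of the exponential excess. *)
Lemma Qv_sqr_integral t v : (\int[P]_w (Qw t v w ^+ 2)%:E = (variance_at t v)%:E)%E.
Proof.
pose a m w : R := if rs t v w < E v w then (E v w - rs t v w) ^+ m else 0.
pose k w := kappa (cl v w).
have k0 w : 0 <= k w by exact: kappa_ge0.
have k1 w : k w <= 1 by exact: kappa_le1.
have a0 m w : 0 <= a m w.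
  by rewrite /a; case: ifPn => // h; rewrite exprn_ge0// subr_ge0 ltW.
have F0 w : 0 <= Fw v w by exact: Fv_ge0.
have ma m : measurable_fun setT (a m).
  apply: measurable_fun_ifT => //; first exact: measurable_fun_ltr.
  by apply: measurable_funX; exact: measurable_funB.
have mk : measurable_fun setT k by exact: mkappa.
have fk i (c : R) : node_free v (fun w => c * k w ^+ i) by exact: node_free_kappa.
have kE w : kappa (cl v w) = k w by [].
clearbody k.
have I2 : (\int[P]_w (a 1 w * (Fw v w ^+ 1 * (2 * k w ^+ 1)))%:E =
           \int[P]_w (expR (- rs t v w) * (2 * k w ^+ 2))%:E)%E.
  rewrite (node_moment t (b := @kappa R d) (v := v))//.
  - by apply: eq_integral => w _; congr EFin; rewrite ?(kE, fact0, fact1, fact2); ring.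
  - by move=> c pc; under eq_integral do rewrite expr1; exact: (facet_integral (mU v) (lawU v)).
  - by move=> w; rewrite mulr_ge0// exprn_ge0.
have I3 : (\int[P]_w (a 0 w * (Fw v w ^+ 2 * (1 * k w ^+ 0)))%:E =
           \int[P]_w (expR (- rs t v w) * beta (cl v w))%:E)%E.
  rewrite (node_moment t (b := @beta R d) (v := v))//.
  - by apply: eq_integral => w _; congr EFin; rewrite ?(fact0, fact1, fact2); ring.
  - by move=> c pc; exact: (facet_sqr_integral (mU v) (lawU v)).
  - by move=> w; rewrite mul1r.
have I4 : (\int[P]_w (a 2 w * (Fw v w ^+ 0 * (1 * k w ^+ 2)))%:E =
           \int[P]_w (expR (- rs t v w) * (2 * k w ^+ 2))%:E)%E.
  rewrite (node_moment t (b := fun=> 1) (v := v))//.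
  - by apply: eq_integral => w _; congr EFin; rewrite ?(kE, fact0, fact1, fact2); ring.
  - by move=> c pc; under eq_integral do rewrite expr0; exact: integral_cst_probability.
  - by move=> w; rewrite mul1r exprn_ge0.
have fin : (\int[P]_w (expR (- rs t v w) * (2 * k w ^+ 2))%:E)%E \is a fin_num.
  apply: (integral_bounded (C := 2)).
    apply: measurable_funM; first exact: measurable_exp_rest.
    by apply: measurable_funM => //; exact: measurable_funX.
  move=> w; have /andP[e0 e1] := exp_rest_bounds t v w.
  have kk : 0 <= k w ^+ 2 <= 1 by rewrite sqr_ge0 exprn_ile1.
  have /andP[p0 p1] := kk; apply/andP; split; first by rewrite !mulr_ge0.
  by have : expR (- rs t v w) * k w ^+ 2 <= 1; [rewrite mulr_ile1|rewrite mulrCA; lra].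
(* The cross term is moved to the left so that all integrands are nonnegative; it is finite and can
   be cancelled at the end. *)
have key : (\int[P]_w (Qw t v w ^+ 2)%:E + \int[P]_w (a 1 w * (Fw v w ^+ 1 * (2 * k w ^+ 1)))%:E =
  \int[P]_w (a 0 w * (Fw v w ^+ 2 * (1 * k w ^+ 0)))%:E +
  \int[P]_w (a 2 w * (Fw v w ^+ 0 * (1 * k w ^+ 2)))%:E)%E.
  rewrite -!ge0_integralD//.
  - apply: eq_integral => w _; rewrite -!EFinD; congr EFin.
    by rewrite /Qv /a kE; case: ifP => _; ring.
  - by move=> w _; rewrite lee_fin !mulr_ge0// ?exprn_ge0.
  - apply/measurable_EFinP; apply: measurable_funM => //; apply: measurable_funM.
      exact: measurable_funX.
    by apply: measurable_funM => //; exact: measurable_funX.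
  - by move=> w _; rewrite lee_fin !mulr_ge0// ?exprn_ge0.
  - apply/measurable_EFinP; apply: measurable_funM => //; apply: measurable_funM.
      exact: measurable_funX.
    by apply: measurable_funM => //; exact: measurable_funX.
  - by move=> w _; rewrite lee_fin sqr_ge0.
  - by apply/measurable_EFinP; exact: measurable_funX.
  - by move=> w _; rewrite lee_fin !mulr_ge0// ?exprn_ge0.
  - apply/measurable_EFinP; apply: measurable_funM => //; apply: measurable_funM.
      exact: measurable_funX.
    by apply: measurable_funM => //; exact: measurable_funX.
move: key; rewrite I2 I3 I4 variance_atE => /eqP.
rewrite -(fineK fin); case: (\int[P]_w (Qw t v w ^+ 2)%:E)%E => [r| |]//=.
by rewrite -!EFinD => /eqP[] /addIr ->.
Qed.

(** Given the other inputs, both terms of [Qv] have mean kappa exp(-rest): the facet volume has mean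
    [kappa], the exponential excess has mean 1. *)
Lemma ge0_Qv_free t v Y : node_free v Y -> (forall w, 0 <= Y w) ->
  P.-integrable setT (EFin \o Y) ->
  P.-integrable setT (fun w => (Qw t v w * Y w)%:E) /\
  (\int[P]_w (Qw t v w * Y w)%:E = 0)%E.
Proof.
move=> fY Y0 iY.
have mY := node_free_measurable fY.
pose a m w : R := if rs t v w < E v w then (E v w - rs t v w) ^+ m else 0.
pose k w := kappa (cl v w).
have k0 w : 0 <= k w by exact: kappa_ge0.
have k1 w : k w <= 1 by exact: kappa_le1.
have a0 m w : 0 <= a m w.
  by rewrite /a; case: ifPn => // h; rewrite exprn_ge0// subr_ge0 ltW.
have F0 w : 0 <= Fw v w by exact: Fv_ge0.
have ma m : measurable_fun setT (a m).
  apply: measurable_fun_ifT => //; first exact: measurable_fun_ltr.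
  by apply: measurable_funX; exact: measurable_funB.
have mk : measurable_fun setT k by exact: mkappa.
have fYk : node_free v (fun w => k w * Y w).
  have [h1 h2] := node_free_kappa v 1 1; have [y1 y2] := fY.
  by split; [rewrite (_ : (fun w => _) = (fun w => (1 * kappa (cl v w) ^+ 1) * Y w));
    [exact: measurable_funM|apply/funext => w; rewrite mul1r]..].
have kE w : kappa (cl v w) = k w by [].
clearbody k.
have J1 : (\int[P]_w (a 0 w * (Fw v w ^+ 1 * Y w))%:E =
           \int[P]_w (expR (- rs t v w) * (k w * Y w))%:E)%E.
  rewrite (node_moment t (b := @kappa R d) (v := v))//.
  - by apply: eq_integral => w _; congr EFin; rewrite ?(kE, fact0, fact1, fact2); ring.
  - by move=> c pc; under eq_integral do rewrite expr1; exact: (facet_integral (mU v) (lawU v)).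
have J2 : (\int[P]_w (a 1 w * (Fw v w ^+ 0 * (k w * Y w)))%:E =
           \int[P]_w (expR (- rs t v w) * (k w * Y w))%:E)%E.
  rewrite (node_moment t (b := fun=> 1) (v := v))//.
  - by apply: eq_integral => w _; congr EFin; rewrite ?(kE, fact0, fact1, fact2); ring.
  - by move=> c pc; under eq_integral do rewrite expr0; exact: integral_cst_probability.
  - by move=> w; rewrite mulr_ge0.
have fin : (\int[P]_w (expR (- rs t v w) * (k w * Y w))%:E < +oo)%E.
  have /integrableP[_] := iY; apply: le_lt_trans; apply: ge0_le_integral => //.
  - by move=> w _; rewrite lee_fin !mulr_ge0 ?expR_ge0.
  - apply/measurable_EFinP; apply: measurable_funM; first exact: measurable_exp_rest.
    exact: measurable_funM.
  - by apply: measurableT_comp => //; exact/measurable_EFinP.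
  - move=> w _; rewrite /= ger0_norm// lee_fin.
    have /andP[e0 e1] := exp_rest_bounds t v w.
    by rewrite mulrA ler_piMl// mulr_ile1.
have i1 : P.-integrable setT (fun w => (a 0 w * (Fw v w ^+ 1 * Y w))%:E).
  apply: (ge0_integrable_lty (f := fun w => a 0 w * (Fw v w ^+ 1 * Y w))).
  - by apply: measurable_funM => //; apply: measurable_funM => //; exact: measurable_funX.
  - by move=> w; rewrite expr1 !mulr_ge0.
  - by rewrite J1.
have i2 : P.-integrable setT (fun w => (a 1 w * (Fw v w ^+ 0 * (k w * Y w)))%:E).
  apply: (ge0_integrable_lty (f := fun w => a 1 w * (Fw v w ^+ 0 * (k w * Y w)))).
  - apply: measurable_funM => //; apply: measurable_funM; first exact: measurable_funX.
    exact: measurable_funM.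
  - by move=> w; rewrite expr0 mul1r !mulr_ge0.
  - by rewrite J2.
have -> : (fun w => (Qw t v w * Y w)%:E) = (fun w => (a 0 w * (Fw v w ^+ 1 * Y w))%:E -
     (a 1 w * (Fw v w ^+ 0 * (k w * Y w)))%:E)%E.
  apply/funext => w; rewrite -EFinB; congr EFin.
  by rewrite /Qv /a kE; case: ifP => _; ring.
split; first exact: integrableB.
by rewrite integralB// J1 J2 subee// -J1 integrable_fin_num.
Qed.

Lemma Qv_free t v Y : node_free v Y -> P.-integrable setT (EFin \o Y) ->
  (\int[P]_w (Qw t v w * Y w)%:E = 0)%E.
Proof.
move=> fY iY; have mY := node_free_measurable fY.
have part (Z : T -> R) : node_free v Z -> measurable_fun setT Z ->
    (forall w, `|Z w| = `|Y w|) ->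
    node_free v (fun w => Num.max (Z w) 0) /\
    P.-integrable setT (EFin \o (fun w => Num.max (Z w) 0)).
  move=> [z1 z2] mZ ZY; split; first by split; exact: measurable_maxr.
  apply: (le_integrable measurableT _ _ iY).
    by apply/measurable_EFinP; exact: measurable_maxr.
  move=> w _ /=; rewrite lee_fin -ZY; case: (leP 0 (Z w)) => // _.
  by rewrite normr0.
have [f1 i1] := part Y fY mY (fun=> erefl).
have [f2 i2] := part (fun w => - Y w)
  (conj (measurableT_comp (@oppr_measurable R setT) fY.1) (measurableT_comp (@oppr_measurable R setT) fY.2))
  (measurableT_comp (@oppr_measurable R setT) mY) (fun w => normrN (Y w)).
have max0 (x : R) : 0 <= Num.max x 0 by rewrite le_max lexx orbT.
have [j1 e1] := ge0_Qv_free t f1 (fun w => max0 _) i1.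
have [j2 e2] := ge0_Qv_free t f2 (fun w => max0 _) i2.
transitivity (\int[P]_w ((Qw t v w * Num.max (Y w) 0)%:E -
    (Qw t v w * Num.max (- Y w) 0)%:E))%E.
  apply: eq_integral => w _; rewrite -EFinB; congr EFin; rewrite -mulrBr; congr (_ * _).
  by case: (leP 0 (Y w)) => h; case: (leP 0 (- Y w)) => h'; lra.
by rewrite integralB// e1 e2 subee.
Qed.

Lemma Qv_integrable t v : P.-integrable setT (fun w => (Qw t v w)%:E).
Proof. by apply: L2_integrable => //; rewrite Qv_sqr_integral ltry. Qed.

Lemma Qv_mean0 t v : (\int[P]_w (Qw t v w)%:E = 0)%E.
Proof.
have h : node_free v (fun=> 1 : R) by split; exact: measurable_cst.
rewrite -[RHS](Qv_free t h); first by apply: eq_integral => w _; rewrite mulr1.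
by apply: (L2_integrable (f := fun=> 1)) => //; under eq_integral do rewrite expr1n;
  rewrite integral_cst_probability ltry.
Qed.

(** If [u] is not a prefix of [v], the term of [v] never reads the inputs of [u], and [Qv_free]
    applies at [u]. Two distinct nodes cannot be prefixes of each other. *)
Lemma Qv_orthogonal t u v : u != v -> (\int[P]_w (Qw t u w * Qw t v w)%:E = 0)%E.
Proof.
have free (u' v' : seq bool) : ~~ seq.prefix u' v' -> node_free u' (fun w => Qw t v' w).
  move=> nuv.
  have tk k : take k v' != u' by apply: contra nuv => /eqP <-; exact: prefix_take.
  split; apply: measurable_Qv => //.
  - by apply: before_E.
  - by apply: before_U.
move=> uv; have [puv|nuv] := boolP (seq.prefix u v); last first.
  by apply: Qv_free; [exact: free|exact: Qv_integrable].
have [pvu|nvu] := boolP (seq.prefix v u).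
  case/negP: uv; move: puv pvu; rewrite !prefixE => /eqP e1 /eqP e2.
  case: (leqP (size u) (size v)) => [h|/ltnW h].
    by rewrite -e2 take_oversize.
  by rewrite -e1 take_oversize.
under eq_integral do rewrite mulrC.
by apply: Qv_free; [exact: free|exact: Qv_integrable].
Qed.

Lemma sum_Qv_sqr t (s : seq (seq bool)) : uniq s ->
  (\int[P]_w ((\sum_(v <- s) Qw t v w) ^+ 2)%:E = (\sum_(v <- s) variance_at t v)%:E)%E.
Proof.
move=> us; apply: (sqr_sum_orthogonal (Q := fun v w => Qw t v w) us) => //.
- by move=> v; exact: Qv_sqr_integral.
- by move=> u v uv; exact: Qv_orthogonal.
Qed.

(** * Geometric decay of the variance over the generations *)

Let d0' : 0 <= 1 - (3 * d%:R)^-1 :> R.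
Proof.
rewrite subr_ge0 invf_le1 ?mulr_gt0 ?ltr0n//; last exact: ltnW (ltnW d3).
by rewrite mulr_ege1// ?ler1n// (ltnW (ltnW d3)).
Qed.

Let mpsi v : measurable_fun setT (fun w => psi (cl v w)).
Proof. exact: measurable_psi. Qed.

Let psi0 v w : 0 <= psi (cl v w). Proof. exact: psi_ge0. Qed.

Lemma psi_step v :
  (\int[P]_w (psi (cl (rcons v true) w))%:E + \int[P]_w (psi (cl (rcons v false) w))%:E <=
   (1 - (3 * d%:R)^-1)%:E * \int[P]_w (psi (cl v w))%:E)%E.
Proof.
rewrite -ge0_integralD//; last 4 first.
- by move=> w _; rewrite lee_fin.
- exact/measurable_EFinP.
- by move=> w _; rewrite lee_fin.
- exact/measurable_EFinP.
(* The absolute value makes [G] nonnegative at the hyperplanes missing the cell; on those that can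
   be chosen it changes nothing. *)
pose G (w : without input (inr v)) (H : option ('I_d * R)) : \bar R :=
  (`|psi (split_box (cl v w) H true) + psi (split_box (cl v w) H false)|)%:E.
have mc : measurable_box (fun w : without input (inr v) => cl v w).
  apply: (measurable_cell (S := without input (inr v))) => //.
  by apply: before_U => k; exact: take_neq.
have GE w w' : G w (choose_hyp (cl v w) (U v w')) =
    (psi (split_box (cl v w) (choose_hyp (cl v w) (U v w')) true) +
     psi (split_box (cl v w) (choose_hyp (cl v w) (U v w')) false))%:E.
  rewrite /G ger0_norm//; have [j [r [-> rc]]] := chooseP (ltnW d2) (clp v w) (U01 v w').
  by rewrite addr_ge0// psi_ge0//; exact: split_box_proper.
have eG : (\int[P]_w ((psi (cl (rcons v true) w))%:E + (psi (cl (rcons v false) w))%:E) =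
    \int[P]_w G w (choose_hyp (cl v w) (U v w)))%E.
  by apply: eq_integral => w _; rewrite GE !cell_rcons EFinD.
have ms b j (r : without input (inr v) * R -> R) : measurable_fun setT r ->
    measurable_fun setT (fun z : without input (inr v) * R =>
      psi (split_box (cl v z.1) (Some (j, r z)) b)).
  move=> mr; apply: measurable_psi; split => i; case: b => /=; last 2 first.
  + by case: (i == j) => //; exact: (measurableT_comp (mc.2 i) measurable_fst).
  + exact: (measurableT_comp (mc.2 i) measurable_fst).
  + exact: (measurableT_comp (mc.1 i) measurable_fst).
  + by case: (i == j) => //; exact: (measurableT_comp (mc.1 i) measurable_fst).
have mG1 j (r : without input (inr v) * R -> R) : measurable_fun setT r ->
    measurable_fun setT (fun z => G z.1 (Some (j, r z))).
  move=> mr; apply/measurable_EFinP; apply: measurableT_comp => //.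
  by apply: measurable_funD; exact: ms.
have mG2 : measurable_fun setT (fun w => G w None).
  apply/measurable_EFinP; apply: measurableT_comp => //.
  by apply: measurable_funD => //=; exact: measurable_psi.
have [e2 mi] := integral_pick mG1 mG2 (fun w H => normr_ge0 _).
rewrite eG e2 -ge0_integralZl//; last 2 first.
- exact/measurable_EFinP.
- by move=> w _; rewrite lee_fin.
apply: ge0_le_integral => //.
- by move=> w _; apply: integral_ge0 => w' _; rewrite lee_fin.
- by apply/measurable_EFinP; exact: measurable_funM.
- move=> w _; under eq_integral do rewrite GE.
  exact: (psi_split_le (mU v) (lawU v)).
Qed.

Lemma sum_psi_le n :
  (\sum_(v <- gen n) \int[P]_w (psi (cl v w))%:E <= ((1 - (3 * d%:R)^-1) ^+ n * psi W)%:E)%E.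
Proof.
elim: n => [|n IH].
  rewrite /= big_seq1 expr0 mul1r; under eq_integral do rewrite cell_nil.
  by rewrite integral_cst_probability.
rewrite big_gen exprS -mulrA EFinM.
apply: (@le_trans _ _ ((1 - (3 * d%:R)^-1)%:E * \sum_(v <- gen n) \int[P]_w (psi (cl v w))%:E)%E).
  rewrite ge0_sume_distrr; last by move=> v _; apply: integral_ge0 => w _; rewrite lee_fin.
  by apply: lee_sum => v _; exact: psi_step.
by apply: lee_wpmul2l => //; rewrite lee_fin.
Qed.

Lemma variance_at_ge0 t v : 0 <= variance_at t v.
Proof.
rewrite -lee_fin -variance_atE; apply: integral_ge0 => w _.
by rewrite lee_fin mulr_ge0 ?expR_ge0 ?beta_ge0.
Qed.

Lemma variance_at_le t v :
  ((variance_at t v)%:E <= d%:R%:E * \int[P]_w (psi (cl v w))%:E)%E.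
Proof.
rewrite -variance_atE -ge0_integralZl//; last 2 first.
- exact/measurable_EFinP.
- by move=> w _; rewrite lee_fin.
apply: ge0_le_integral => //.
- by move=> w _; rewrite lee_fin mulr_ge0 ?expR_ge0 ?beta_ge0.
- apply/measurable_EFinP; apply: measurable_funM => //; exact: measurable_exp_rest.
- by apply/measurable_EFinP; exact: measurable_funM.
- move=> w _; rewrite lee_fin; have /andP[e0 e1] := exp_rest_bounds t v w.
  by apply: le_trans (beta_le_psi _ _ d3) => //; rewrite ler_piMl// beta_ge0.
Qed.

Lemma sum_variance_le t n :
  \sum_(v <- gen n) variance_at t v <= d%:R * psi W * (1 - (3 * d%:R)^-1) ^+ n.
Proof.
rewrite -lee_fin -sumEFin; apply: (@le_trans _ _ (\sum_(v <- gen n)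
    (d%:R%:E * \int[P]_w (psi (cl v w))%:E))%E).
  by apply: lee_sum => v _; exact: variance_at_le.
rewrite -ge0_sume_distrr; last by move=> v _; apply: integral_ge0 => w _; rewrite lee_fin.
rewrite -mulrA EFinM; apply: lee_wpmul2l; first by rewrite lee_fin.
by rewrite mulrC; exact: sum_psi_le.
Qed.

(** A geometric series of ratio rho with 1 - rho = 1 / (3d), which turns the factor d of one
    generation into 3 d^2. The bound does not depend on [t]. *)
Lemma sum_variance_tail t n m : (n <= m)%N ->
  \sum_(n <= k < m) \sum_(v <- gen k) variance_at t v <=
  3 * d%:R ^+ 2 * psi W * (1 - (3 * d%:R)^-1) ^+ n.
Proof.
have dn0 : 0 < d%:R :> R by rewrite ltr0n; exact: ltnW (ltnW d3).
set rho := 1 - _; have r0 : 0 <= rho by exact: d0'.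
have rE : 1 - rho = (3 * d%:R)^-1 by rewrite /rho; ring.
have psiW : 0 <= psi W by exact: psi_ge0.
move=> nm; suff h : \sum_(n <= k < m) \sum_(v <- gen k) variance_at t v <=
    3 * d%:R ^+ 2 * psi W * (rho ^+ n - rho ^+ m).
  apply: le_trans h _; rewrite ler_wpM2l//; last by rewrite lerBlDr lerDl exprn_ge0.
  by rewrite mulr_ge0// mulr_ge0// exprn_ge0// ltW.
elim: m nm => [|m IH]; first by rewrite leqn0 => /eqP ->; rewrite big_nil subrr mulr0.
rewrite leq_eqVlt => /orP[/eqP ->|]; first by rewrite big_geq// subrr mulr0.
rewrite ltnS => nm; rewrite big_nat_recr//=.
apply: le_trans (lerD (IH nm) (sum_variance_le t m)) _.
have -> : d%:R * psi W * rho ^+ m = 3 * d%:R ^+ 2 * psi W * (rho ^+ m * (1 - rho)).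
  by rewrite rE; field; rewrite gt_eqF.
rewrite -mulrDr (_ : rho ^+ n - rho ^+ m + rho ^+ m * (1 - rho) = rho ^+ n - rho ^+ m.+1)//.
by rewrite exprS; ring.
Qed.

(** * Geometric decay of the unfilled space-time volume *)

Let mbr v : measurable_fun setT (fun w => br v w).
Proof. by have [] := measurable_node d2 U01 pW (@before_all (size v) v). Qed.

Let mvol v : measurable_fun setT (fun w => vol (cl v w)).
Proof. exact: measurable_vol. Qed.

Let vol0 v w : 0 <= vol (cl v w). Proof. exact: vol_ge0. Qed.

Lemma measurable_vol_birth v : measurable_fun setT (fun w => vol (cl v w) * expR (- br v w)).
Proof.
by apply: measurable_funM => //; apply: measurableT_comp => //; exact: measurable_funN.
Qed.

(** The children keep the total volume and are born one lifetime e / lam later. The Laplace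
    transform gives the factor lam / (1 + lam), which increases with lam and hence is at most d / (1
    + d) in the unit cube. *)
Lemma volume_step v :
  (\int[P]_w (vol (cl (rcons v true) w) * expR (- br (rcons v true) w))%:E +
   \int[P]_w (vol (cl (rcons v false) w) * expR (- br (rcons v false) w))%:E <=
   (d%:R / (1 + d%:R))%:E * \int[P]_w (vol (cl v w) * expR (- br v w))%:E)%E.
Proof.
have ve0 u w : 0 <= vol (cl u w) * expR (- br u w) by rewrite mulr_ge0 ?expR_ge0.
have mve := measurable_vol_birth.
rewrite -ge0_integralD//; last 4 first.
- by move=> w _; rewrite lee_fin.
- exact/measurable_EFinP.
- by move=> w _; rewrite lee_fin.
- exact/measurable_EFinP.
pose F (z : without input (inl v) * R) : \bar R :=
  (vol (cl v z.1) * expR (- br v z.1) * expR (- ((lam (cl v z.1))^-1 * z.2)))%:E.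
have [mc mb] : measurable_box (fun w : without input (inl v) => cl v w) /\
    measurable_fun setT (fun w : without input (inl v) => br v w).
  apply: (measurable_node (S := without input (inl v))) => //.
  by apply: before_E => k; exact: take_neq.
have mFF : measurable_fun setT F.
  apply/measurable_EFinP; apply: measurable_funM.
    apply: measurable_funM; first exact: (measurableT_comp (measurable_vol mc) measurable_fst).
    apply: measurableT_comp => //; apply: measurable_funN.
    exact: (measurableT_comp mb measurable_fst).
  apply: measurableT_comp => //; apply: measurable_funN; apply: measurable_funM => //.
  have ml : measurable_fun setT (fun z : without input (inl v) * R => lam (cl v z.1)).
    exact: (measurableT_comp (measurable_lam mc) measurable_fst).
  apply: (measurable_inv (S := (without input (inl v) * R)%type) (f := fun z => lam (cl v z.1))) => //.
  by move=> z; exact: lam_ge0.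
have F0 z : (0 <= F z)%E by rewrite lee_fin mulr_ge0 ?expR_ge0.
have mI := measurable_fun_withoutW mX (measurable_integral_without P mX mFF F0).
have -> : (\int[P]_w ((vol (cl (rcons v true) w) * expR (- br (rcons v true) w))%:E +
    (vol (cl (rcons v false) w) * expR (- br (rcons v false) w))%:E) =
    \int[P]_w F (w, input (inl v) w))%E.
  apply: eq_integral => w _; rewrite -EFinD; congr EFin.
  rewrite !birth_rcons// -mulrDl vol_cell_rcons// /dth opprD expRD mulrA.
  by congr (_ * expR (- _)); rewrite mulrC.
rewrite (integral_without mX indX mFF F0) -ge0_integralZl//; last 2 first.
- exact/measurable_EFinP.
- by move=> w _; rewrite lee_fin.
apply: ge0_le_integral => //.
- by move=> w _; exact: integral_ge0.
- by apply/measurable_EFinP; exact: measurable_funM.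
- move=> w _; rewrite /F /=; under eq_integral do rewrite EFinM.
  rewrite ge0_integralZl//; last 2 first.
  + apply/measurable_EFinP; apply: measurableT_comp => //; apply: measurable_funN.
    exact: measurable_funM.
  + by rewrite lee_fin.
  rewrite (exponential_laplace (mE v) (lawE v)); last by rewrite invr_ge0 lam_ge0.
  rewrite -!EFinM lee_fin; have := lam_ge0 (clp v w); rewrite le_eqVlt => /orP[/eqP l0|l0].
    have -> : vol (cl v w) = 0.
      by rewrite (vol_face _ (Ordinal (ltnW d2))) side_eq0// ?mul0r.
    by rewrite !mul0r mulr0.
  rewrite mulrC ler_wpM2r//.
  have -> : (1 + (lam (cl v w))^-1)^-1 = lam (cl v w) / (1 + lam (cl v w)).
    by field; rewrite !gt_eqF// ltr_wpDr// ltW.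
  have lw : 0 < 1 + lam (cl v w) by rewrite ltr_wpDr// ltW.
  rewrite ler_pdivrMr// mulrAC ler_pdivlMr ?ltr_wpDr//.
  by have := lam_le (clu v w); lra.
Qed.

Lemma sum_volume_le n :
  (\sum_(v <- gen n) \int[P]_w (vol (cl v w) * expR (- br v w))%:E <=
   ((d%:R / (1 + d%:R)) ^+ n)%:E)%E.
Proof.
elim: n => [|n IH].
  rewrite /= big_seq1 expr0; under eq_integral do rewrite cell_nil birth_nil oppr0 expR0 mulr1.
  by rewrite integral_cst_probability lee_fin vol_le1.
rewrite big_gen exprS EFinM.
apply: (@le_trans _ _ ((d%:R / (1 + d%:R))%:E *
   \sum_(v <- gen n) \int[P]_w (vol (cl v w) * expR (- br v w))%:E)%E).
  rewrite ge0_sume_distrr; last first.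
    by move=> v _; apply: integral_ge0 => w _; rewrite lee_fin mulr_ge0 ?expR_ge0.
  by apply: lee_sum => v _; exact: volume_step.
by apply: lee_wpmul2l => //; rewrite lee_fin divr_ge0// addr_ge0.
Qed.

(** * Mean of the surface and its approximation by finitely many generations *)

Notation Sw t n w := (Sn (E^~ w) (U^~ w) W t n).
Notation Rw t n w := (Rn (E^~ w) (U^~ w) W t n).
Notation Nw t n w := (Nn (E^~ w) (U^~ w) W t n).
Notation surf t w := (stit_surface (E^~ w) (U^~ w) W t).

Let dec : R := d%:R / (1 + d%:R).

Let dec0 : 0 <= dec. Proof. by rewrite /dec divr_ge0// addr_ge0. Qed.

Let mdth v : measurable_fun setT (fun w => dth (E^~ w) (U^~ w) W v).
Proof. by apply: measurable_dth => //; exact: before_all. Qed.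

Let mif t v : measurable_fun setT
  (fun w => if dth (E^~ w) (U^~ w) W v <= t then Fw v w else 0).
Proof. by apply: measurable_fun_ifT => //; exact: measurable_fun_ler. Qed.

Let if_ge0 t v w : 0 <= (if dth (E^~ w) (U^~ w) W v <= t then Fw v w else 0).
Proof. by case: ifP => // _; exact: Fv_ge0. Qed.

Let mS t n : measurable_fun setT (fun w => Sw t n w).
Proof. by apply: measurable_sum => v. Qed.

Let mN t n : measurable_fun setT (fun w => Nw t n w).
Proof. by apply: measurable_sum => v. Qed.

Let mR t n : measurable_fun setT (fun w => Rw t n w).
Proof.
apply: measurable_sum => v; apply: measurable_funM => //.
by apply: measurable_maxr => //; exact: measurable_funB.
Qed.

Lemma Rn_integral_le t n : (\int[P]_w (Rw t n w)%:E <= (expR t * dec ^+ n)%:E)%E.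
Proof.
have ve0 u w : 0 <= vol (cl u w) * expR (- br u w) by rewrite mulr_ge0 ?expR_ge0.
apply: (@le_trans _ _ (\int[P]_w ((expR t)%:E *
    \sum_(v <- gen n) (vol (cl v w) * expR (- br v w))%:E))%E).
  apply: ge0_le_integral => //.
  - by move=> w _; rewrite lee_fin Rn_ge0.
  - exact/measurable_EFinP.
  - apply: emeasurable_funM => //; apply: emeasurable_sum => v.
    by apply/measurable_EFinP; exact: measurable_vol_birth.
  - by move=> w _; rewrite sumEFin -EFinM lee_fin; exact: Rn_le.
rewrite ge0_integralZl//; last 2 first.
- by apply: emeasurable_sum => v; apply/measurable_EFinP; exact: measurable_vol_birth.
- by move=> w _; apply: sume_ge0 => v _; rewrite lee_fin.
rewrite ge0_integral_sum//; last 2 first.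
- by move=> v; apply/measurable_EFinP; exact: measurable_vol_birth.
- by move=> v w _; rewrite lee_fin.
rewrite EFinM; apply: lee_wpmul2l; first by rewrite lee_fin expR_ge0.
exact: sum_volume_le.
Qed.

Lemma Nn_integrable t n : P.-integrable setT (fun w => (Nw t n w)%:E).
Proof.
rewrite (_ : (fun w => _) = (fun w => \sum_(v <- tree n) (Qw t v w)%:E)%E).
  by apply: integrable_sum => // v _; exact: Qv_integrable.
by apply/funext => w; rewrite sumEFin.
Qed.

Lemma Nn_mean0 t n : (\int[P]_w (Nw t n w)%:E = 0)%E.
Proof.
under eq_integral do rewrite /Nn -sumEFin.
rewrite (integral_sum measurableT (fun v => Qv_integrable t v)).
by apply: big1 => v _; exact: Qv_mean0.
Qed.

Lemma Sn_Rn_integral t n : 0 <= t ->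
  (\int[P]_w (Sw t n w)%:E + d%:R%:E * \int[P]_w (Rw t n w)%:E = (d%:R * (t * vol W))%:E)%E.
Proof.
move=> t0.
have S0 w : 0 <= Sw t n w by apply: sumr_ge0.
have R0 w : 0 <= Rw t n w by exact: Rn_ge0.
rewrite -ge0_integralZl//; last 2 first.
- exact/measurable_EFinP.
- by move=> w _; rewrite lee_fin.
rewrite -ge0_integralD//; last 4 first.
- by move=> w _; rewrite lee_fin.
- exact/measurable_EFinP.
- by move=> w _; rewrite -EFinM lee_fin mulr_ge0.
- by apply/measurable_EFinP; exact: measurable_funM.
transitivity (\int[P]_w ((d%:R * (t * vol W))%:E + ((Nw 0 n w)%:E - (Nw t n w)%:E)))%E.
  apply: eq_integral => w _; rewrite -EFinM -EFinB -!EFinD; congr EFin.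
  have := Sn_decomposition d2 (E0^~ w) (U01^~ w) pW n t0.
  by move=> /eqP; rewrite subr_eq => /eqP ->; ring.
rewrite integralD//; last 2 first.
- by apply: finite_measure_integrable_cst.
- by apply: integrableB => //; exact: Nn_integrable.
rewrite integralB//; [|exact: Nn_integrable|exact: Nn_integrable].
by rewrite !Nn_mean0 subee// adde0 integral_cst_probability.
Qed.

Lemma surf_series t w : surf t w =
  (\sum_(n <oo) (\sum_(v <- gen n)
     (if (dth (E^~ w) (U^~ w) W v <= t)%R then Fw v w else 0%R))%R%:E)%E.
Proof. exact: stit_series. Qed.

Lemma surf_split t n w : surf t w = ((Sw t n w)%:E + \sum_(n <= k <oo) (\sum_(v <- gen k)
     (if (dth (E^~ w) (U^~ w) W v <= t)%R then Fw v w else 0%R))%R%:E)%E.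
Proof.
rewrite surf_series (nneseries_split 0 n)//; first by rewrite add0n Sn_series.
by move=> k _; rewrite lee_fin sumr_ge0.
Qed.

Lemma measurable_surf t : measurable_fun setT (fun w => surf t w).
Proof.
under eq_fun do rewrite surf_series.
apply: ge0_emeasurable_sum => [k w _ _|k _]; first by rewrite lee_fin sumr_ge0.
by apply/measurable_EFinP; apply: measurable_sum => v.
Qed.

(** The terms being nonnegative, mean and series commute; the partial means miss d t vol W by d
    times the mean of [Rn], which decays like [dec ^+ n]. *)
Lemma surf_integral t : 0 <= t -> (\int[P]_w surf t w = (d%:R * (t * vol W))%:E)%E.
Proof.
move=> t0; pose a k w : R := \sum_(v <- gen k)
  (if dth (E^~ w) (U^~ w) W v <= t then Fw v w else 0).
have a0 k w : 0 <= a k w by apply: sumr_ge0.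
have ma k : measurable_fun setT (a k) by apply: measurable_sum => v.
under eq_integral do rewrite surf_series.
rewrite integral_nneseries//; last 2 first.
- by move=> k; apply/measurable_EFinP; exact: ma.
- by move=> k w _; rewrite lee_fin; exact: a0.
pose r n := (\int[P]_w (Rw t n w)%:E)%E.
have r_fin n : r n \is a fin_num.
  rewrite ge0_fin_numE; last by apply: integral_ge0 => w _; rewrite lee_fin Rn_ge0.
  by apply: le_lt_trans (Rn_integral_le t n) _; exact: ltry.
apply/cvg_lim => //.
have e n : (\sum_(0 <= k < n) \int[P]_w (a k w)%:E =
    (d%:R * (t * vol W) - d%:R * fine (r n))%:E)%E.
  rewrite -ge0_integral_sum//; last 2 first.
  - by move=> k; apply/measurable_EFinP; exact: ma.
  - by move=> k w _; rewrite lee_fin.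
  rewrite (_ : (\int[P]_w _)%E = \int[P]_w (Sw t n w)%:E)%E; last first.
    by apply: eq_integral => w _; exact: Sn_series.
  have := Sn_Rn_integral n t0; rewrite -/(r n) -(fineK (r_fin n)).
  case: (\int[P]_w (Sw t n w)%:E)%E => [x| |]//.
  by rewrite -EFinM -EFinD => -[<-]; rewrite addrK.
rewrite (_ : (fun n => _) = (fun n => (d%:R * (t * vol W) - d%:R * fine (r n))%:E)); last first.
  by apply/funext => n; exact: e.
apply: cvg_EFin_comp; rewrite -[X in _ --> X]subr0; apply: cvgB; first exact: cvg_cst.
rewrite -(mulr0 d%:R); apply: cvgMr.
apply: (@squeeze_cvgr _ _ _ _ (fun=> 0) (fun n => expR t * dec ^+ n)).
- near=> n; rewrite fine_ge0 ?integral_ge0//=; last by move=> w _; rewrite lee_fin Rn_ge0.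
  by rewrite -lee_fin fineK//; exact: Rn_integral_le.
- exact: cvg_cst.
- rewrite -(mulr0 (expR t)); apply: cvgMr; apply: cvg_expr.
  by rewrite ger0_norm// /dec ltr_pdivrMr ?mul1r ?ltrDr// ltr_wpDr.
Unshelve. all: by end_near. Qed.

(** [fine] replaces an infinite value by 0, but the right side is then infinite. *)
Lemma fine_le_dist (x : \bar R) (y : R) : 0 <= y -> (y%:E <= x)%E ->
  (`|fine x - y|%:E <= x - y%:E)%E.
Proof.
move=> y0; case: x => [x yx|_|]; last by rewrite leNgt ltNyr.
  by rewrite /= -EFinB lee_fin ger0_norm// subr_ge0 -lee_fin.
by rewrite addye// leey.
Qed.

Let Sn_surf t n w : ((Sw t n w)%:E <= surf t w)%E.
Proof.
rewrite (surf_split t n) leeDl//; apply: nneseries_ge0 => k _ _.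
by rewrite lee_fin sumr_ge0.
Qed.

Let Sn_ge0 t n w : 0 <= Sw t n w. Proof. by apply: sumr_ge0. Qed.

(** The partial sums increase to the surface, so the distance in mean is at most a difference of
    means, which [Sn_Rn_integral] identifies as d times the mean of [Rn]. *)
Lemma surf_dist t n : 0 <= t ->
  (\int[P]_w (`|fine (surf t w) - Sw t n w|)%:E <= (d%:R * (expR t * dec ^+ n))%:E)%E.
Proof.
move=> t0; have ms := measurable_surf t.
apply: (@le_trans _ _ (\int[P]_w (surf t w - (Sw t n w)%:E))%E).
  apply: ge0_le_integral => //.
  - apply/measurable_EFinP; apply: measurableT_comp => //; apply: measurable_funB => //.
    exact: measurableT_comp.
  - by apply: emeasurable_funB => //; exact/measurable_EFinP.
  - by move=> w _; exact: fine_le_dist.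
have D0 w : (0 <= surf t w - (Sw t n w)%:E)%E by rewrite sube_ge0.
have key : (\int[P]_w (surf t w - (Sw t n w)%:E) + \int[P]_w (Sw t n w)%:E =
    (d%:R * (t * vol W))%:E)%E.
  rewrite -ge0_integralD//; last 3 first.
  - by apply: emeasurable_funB => //; exact/measurable_EFinP.
  - by move=> w _; rewrite lee_fin.
  - exact/measurable_EFinP.
  rewrite -(surf_integral t0); apply: eq_integral => w _.
  by rewrite subeK.
have r_fin : (\int[P]_w (Rw t n w)%:E)%E \is a fin_num.
  rewrite ge0_fin_numE; last by apply: integral_ge0 => w _; rewrite lee_fin Rn_ge0.
  by apply: le_lt_trans (Rn_integral_le t n) _; exact: ltry.
have := Sn_Rn_integral n t0; rewrite -key.
have := Rn_integral_le t n; rewrite -(fineK r_fin) lee_fin.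
case: (\int[P]_w (Sw t n w)%:E)%E key => [x| |].
- move=> key rle; case: (\int[P]_w (surf t w - (Sw t n w)%:E))%E key => [y| |]//= key.
  rewrite -EFinM -!EFinD => -[]; rewrite addrC => /addIr <-.
  by rewrite lee_fin ler_wpM2l.
- by case: (\int[P]_w (surf t w - (Sw t n w)%:E))%E.
- by case: (\int[P]_w (surf t w - (Sw t n w)%:E))%E.
Qed.

Lemma surf_integrable t : 0 <= t -> P.-integrable setT (fun w => surf t w).
Proof.
move=> t0; apply/integrableP; split; first exact: measurable_surf.
rewrite (_ : (\int[P]_w _)%E = \int[P]_w (surf t w))%E; first by rewrite surf_integral// ltry.
apply: eq_integral => w _; rewrite gee0_abs//.
by apply: le_trans (Sn_surf t 0 w); rewrite lee_fin.
Qed.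

Lemma fine_surf_integral t : 0 <= t ->
  (\int[P]_w (fine (surf t w))%:E = (d%:R * (t * vol W))%:E)%E.
Proof.
move=> t0; rewrite -(surf_integral t0); apply: ae_eq_integral => //.
- by apply/measurable_EFinP; apply: measurableT_comp => //; exact: measurable_surf.
- exact: measurable_surf.
have := integrable_ae measurableT (surf_integrable t0).
by apply: filterS => w /= h _; rewrite fineK// h.
Qed.

Lemma big_tree_range (V : nmodType) (f : seq bool -> V) n m :
  \sum_(v <- tree m | (n <= size v)%N) f v = \sum_(n <= k < m) \sum_(v <- gen k) f v.
Proof.
have e k : \sum_(v <- gen k) (if (n <= size v)%N then f v else 0) =
    if (n <= k)%N then \sum_(v <- gen k) f v else 0.
  rewrite (eq_big_seq (fun v => if (n <= k)%N then f v else 0)).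
    by case: (n <= k)%N => //; rewrite big1.
  by move=> v; rewrite mem_gen => /eqP ->.
rewrite big_mkcond; elim: m => [|m IH]; first by rewrite big_geq// /tree big_nil.
rewrite big_treeS IH e; case: (leqP n m) => nm; first by rewrite big_nat_recr.
by rewrite !big_geq ?addr0// ltnW.
Qed.

(** * The limit variable and its moments *)

Let rho : R := 1 - (3 * d%:R)^-1.
Let C : R := 3 * d%:R ^+ 2 * psi W.

Let rho_gt0 : 0 < rho.
Proof.
have d1 : (1 : R) <= d%:R by rewrite ler1n (ltnW (ltnW d3)).
by rewrite subr_gt0 invf_lt1 ?mulr_gt0//; lra.
Qed.

Let rho_lt1 : rho < 1.
Proof. by rewrite ltrBlDr ltrDl invr_gt0 mulr_gt0// ltr0n (ltnW (ltnW d3)). Qed.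

Let C_ge0 : 0 <= C.
Proof. by rewrite /C mulr_ge0 ?psi_ge0// mulr_ge0 ?exprn_ge0. Qed.

Let cvg_rho (K : R) : K * rho ^+ n @[n --> \oo] --> 0.
Proof. by rewrite -(mulr0 K); apply: cvgMr; apply: cvg_expr; rewrite ger0_norm. Qed.

Lemma Nn_increment t n m : (n <= m)%N ->
  (\int[P]_w ((Nw t m w - Nw t n w) ^+ 2)%:E <= (C * rho ^+ n)%:E)%E.
Proof.
move=> nm; rewrite (_ : (\int[P]_w _)%E = (\sum_(n <= k < m) \sum_(v <- gen k) variance_at t v)%:E).
  by rewrite lee_fin; exact: sum_variance_tail.
rewrite -big_tree_range -big_filter -sum_Qv_sqr ?filter_uniq ?tree_uniq//.
apply: eq_integral => w _; congr (_ ^+ 2)%:E.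
by rewrite big_filter big_tree_range /Nn !big_tree (big_cat_nat (leq0n n) nm)//= addrAC subrr add0r.
Qed.

Lemma Nn_sqr t n : (\int[P]_w (Nw t n w ^+ 2)%:E = (\sum_(v <- tree n) variance_at t v)%:E)%E.
Proof. exact: sum_Qv_sqr (tree_uniq n). Qed.

Lemma cell_U_only (E1 E2 V : seq bool -> R) v : cell E1 V W v = cell E2 V W v.
Proof. by elim/last_ind: v => [//|v b IH]; rewrite !cell_rcons /hypv IH. Qed.

Lemma Qv0E v w : Qw 0 v w = Fw v w - kappa (cl v w) * E v w.
Proof.
have r0 : rs 0 v w = 0.
  by rewrite /rest (max_idPr _) ?mul0r// sub0r oppr_le0 birth_ge0.
by rewrite /Qv r0 E0 subr0.
Qed.

(* The cells only depend on the marks [U], so [E [::]] enters the root term alone. *)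
Lemma measurable_Qv0_without_root v : v != [::] ->
  measurable_fun setT (fun w : without input (inl [::]) => Qw 0 v w).
Proof.
move=> vn; have mUw u : measurable_fun setT (U u : without input (inl [::]) -> R).
  exact: (@measurable_fun_without _ _ _ _ input (inl [::]) (inr u)).
have mEw : measurable_fun setT (E v : without input (inl [::]) -> R).
  by apply: (@measurable_fun_without _ _ _ _ input (inl [::]) (inl v)); apply: contra vn => /eqP[->].
pose E1 (_ : seq bool) (_ : without input (inl [::])) : R := 1.
have mb n : measurable_before E1 (U : _ -> without input (inl [::]) -> R) n v.
  by move=> k _; split => //; exact: measurable_cst.
have mc : measurable_box (fun w : without input (inl [::]) => cl v w).
  rewrite (_ : (fun w => _) = (fun w : without input (inl [::]) => cell (E1^~ w) (U^~ w) W v)).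
    exact: (measurable_cell (S := without input (inl [::]))).
  by apply/funext => w; exact: cell_U_only.
rewrite (_ : (fun w => _) = (fun w : without input (inl [::]) =>
    facet (cl v w) (choose_hyp (cl v w) (U v w)) - kappa (cl v w) * E v w)); last first.
  by apply/funext => w; exact: Qv0E.
apply: measurable_funB.
  exact: (measurable_facet (S := without input (inl [::])) (c := fun w => cl v w) (u := U v)).
apply: measurable_funM => //.
by apply: (measurable_kappa (S := without input (inl [::])) (c := fun w => cl v w)) => // w.
Qed.

(** The limit M without its root term. Taking the limit superior of sums free of [E [::]], rather
    than subtracting from a limit, keeps it measurable in the remaining inputs. *)
Definition limit_rest (w : T) : R :=
  L2_lim (fun n w => \sum_(v <- tree n.+1 | v != [::]) Qw 0 v w) w.

Definition limit_var (w : T) : R := Qw 0 [::] w + limit_rest w.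

Let rest_sum n w : \sum_(v <- tree n.+1 | v != [::]) Qw 0 v w = Nw 0 n.+1 w - Qw 0 [::] w.
Proof.
rewrite /Nn (bigD1_seq [::]) ?tree_uniq ?mem_tree//=.
by rewrite [RHS]addrAC subrr add0r.
Qed.

Lemma measurable_limit_rest :
  measurable_fun setT (limit_rest : without input (inl [::]) -> R).
Proof.
apply: (measurable_L2_lim (T := without input (inl [::]))
  (N := fun n w => \sum_(v <- tree n.+1 | v != [::]) Qw 0 v w)) => n.
rewrite (_ : (fun w => _) = (fun w : without input (inl [::]) =>
    \sum_(v <- tree n.+1) if v != [::] then Qw 0 v w else 0)); last first.
  by apply/funext => w; rewrite big_mkcond.
apply: measurable_sum => v; have [->|vn] := eqVneq v [::]; first exact: measurable_cst.
exact: measurable_Qv0_without_root.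
Qed.

Let mlim_rest : measurable_fun setT limit_rest.
Proof. exact: (measurable_fun_withoutW mX measurable_limit_rest). Qed.

Lemma measurable_limit_var : measurable_fun setT limit_var.
Proof. exact: measurable_funD. Qed.

(** Adding the root term back cancels in the difference, so this is [L2_lim_le] for the sums without
    the root; [tree n.+1] always contains the root. *)
Lemma limit_var_dist n : (\int[P]_w ((limit_var w - Nw 0 n.+1 w) ^+ 2)%:E <= (C * rho ^+ n)%:E)%E.
Proof.
pose Z n w := \sum_(v <- tree n.+1 | v != [::]) Qw 0 v w.
have mZ k : measurable_fun setT (Z k).
  rewrite (_ : Z k = fun w => Nw 0 k.+1 w - Qw 0 [::] w); first exact: measurable_funB.
  by apply/funext => w; exact: rest_sum.
have hZ k m : (k <= m)%N -> (\int[P]_w ((Z m w - Z k w) ^+ 2)%:E <= (C * rho ^+ k)%:E)%E.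
  move=> km; rewrite (_ : (\int[P]_w _)%E = \int[P]_w ((Nw 0 m.+1 w - Nw 0 k.+1 w) ^+ 2)%:E)%E.
    have km1 : (k.+1 <= m.+1)%N by rewrite ltnS.
    apply: le_trans (Nn_increment 0 km1) _.
    by rewrite lee_fin ler_wpM2l// exprS ler_piMl ?exprn_ge0// ltW.
  by apply: eq_integral => w _; rewrite /Z !rest_sum; congr (_ ^+ 2)%:E; ring.
rewrite (_ : (\int[P]_w _)%E = \int[P]_w ((L2_lim Z w - Z n w) ^+ 2)%:E)%E.
  exact: (L2_lim_le mZ C_ge0 rho_gt0 rho_lt1 hZ).
apply: eq_integral => w _; congr (_ ^+ 2)%:E.
rewrite /limit_var /limit_rest -/Z [Z n w]rest_sum; ring.
Qed.

Lemma limit_var_mean0 : (\int[P]_w (limit_var w)%:E = 0)%E.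
Proof.
apply: (L2_mean0 (N := fun n w => Nw 0 n.+1 w) (e := fun n => C * rho ^+ n)) => //.
- exact: measurable_limit_var.
- by move=> n; rewrite Nn_sqr ltry.
- by move=> n; exact: Nn_mean0.
- exact: limit_var_dist.
Qed.

Lemma limit_var_sqr :
  (\int[P]_w (limit_var w ^+ 2)%:E = \sum_(n <oo) (\sum_(v <- gen n) variance_at 0 v)%:E)%E.
Proof.
pose s n := \sum_(v <- tree n.+1) variance_at 0 v.
have s_nd : nondecreasing_seq s.
  apply/nondecreasing_seqP => n; rewrite /s [X in _ <= X]big_treeS lerDl sumr_ge0// => v _.
  exact: variance_at_ge0.
have s_ub n : s n <= C.
  rewrite /s big_tree; apply: le_trans (sum_variance_tail 0 (leq0n _)) _.
  by rewrite expr0 mulr1.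
have s_cvg : cvgn s.
  apply: nondecreasing_is_cvgn => //; exists C => _ [n _ <-]; exact: s_ub.
rewrite (L2_norm_cvg (N := fun n w => Nw 0 n.+1 w) (e := fun n => C * rho ^+ n) (s := s)
  (S := limn s)) => //.
- apply/esym/cvg_lim => //; rewrite -(cvg_shiftS _).
  rewrite (_ : (fun n => _) = EFin \o s); last first.
    by apply/funext => n; rewrite /= sumEFin /s big_tree.
  exact: cvg_EFin_comp.
- exact: measurable_limit_var.
- exact: limit_var_dist.
- by move=> n; exact: Nn_sqr.
Qed.

(** * Convergence of the centred surface in mean *)

Lemma variance_at_mono s t v : s <= t -> variance_at t v <= variance_at s v.
Proof.
move=> st; rewrite -lee_fin -!variance_atE; apply: ge0_le_integral => //.
- by move=> w _; rewrite lee_fin mulr_ge0 ?expR_ge0 ?beta_ge0.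
- by apply/measurable_EFinP; apply: measurable_funM => //; exact: measurable_exp_rest.
- by apply/measurable_EFinP; apply: measurable_funM => //; exact: measurable_exp_rest.
- move=> w _; rewrite lee_fin ler_wpM2r ?beta_ge0// ler_expR lerN2 ler_wpM2r ?lam_ge0//.
  by rewrite ge_max le_max lerB// le_max lexx orbT.
Qed.

(** Dominated convergence with bound 1: the rest grows without limit unless [lam = 0], in which case
    [beta] is 0. Integer times suffice, because of [variance_at_mono]. *)
Lemma variance_at_cvg v : variance_at n%:R v @[n --> \oo] --> 0.
Proof.
pose f n w : \bar R := (expR (- rs n%:R v w) * beta (cl v w))%:E.
have mf n : measurable_fun setT (f n).
  by apply/measurable_EFinP; apply: measurable_funM => //; exact: measurable_exp_rest.
have fcvg w : f n w @[n --> \oo] --> (cst 0 : T -> \bar R) w.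
  apply: cvg_EFin_comp; have := lam_ge0 (clp v w); rewrite le_eqVlt => /orP[/eqP l0|l0].
    rewrite /beta -l0 invr0 mulr0; under eq_fun do rewrite mulr0; exact: cvg_cst.
  apply/cvgr0Pnorm_le => e e0; near=> n.
  rewrite ger0_norm; last by rewrite mulr_ge0 ?expR_ge0 ?beta_ge0.
  apply: (@le_trans _ _ (expR (- rs n%:R v w))).
    by rewrite ler_piMr ?expR_ge0 ?beta_le1.
  (* [e] is the tolerance: exp(-r) <= e as soon as r >= 1/e, since exp(r) >= r. *)
  have h : (e^-1 / lam (cl v w)) + br v w <= n%:R by near: n; exact: nbhs_infty_ger.
  have r1 : e^-1 <= rs n%:R v w.
    by rewrite /rest -ler_pdivrMr// le_max lerBrDr h.
  have e1 : 0 < e^-1 by rewrite invr_gt0.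
  rewrite expRN invf_ple ?posrE ?expR_gt0//; apply: le_trans r1 _.
  by apply: le_trans (expR_ge1Dx _); rewrite lerDr.
have ae1 : {ae P, forall w, setT w -> f ^~ w @ \oo --> (cst 0 : T -> \bar R) w}.
  by apply: aeW => w _; exact: fcvg.
have dom : {ae P, forall w n, setT w -> (`|f n w| <= (cst 1 : T -> \bar R) w)%E}.
  apply: aeW => w n _; rewrite /f abse_EFin lee_fin ger0_norm; last first.
    by rewrite mulr_ge0 ?expR_ge0 ?beta_ge0.
  have /andP[e0 e1] := exp_rest_bounds n%:R v w.
  by rewrite mulr_ile1 ?beta_ge0 ?beta_le1.
have ig : P.-integrable setT (fun=> 1%R%:E) by apply: finite_measure_integrable_cst.
have m0 : measurable_fun setT (cst 0 : T -> \bar R) by exact: measurable_cst.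
have [_ _] := dominated_convergence measurableT mf m0 ae1 ig dom.
rewrite integral0 => /fine_cvg; rewrite /variance_at; exact: cvg_trans.
Unshelve. all: by end_near. Qed.

Definition centered t w : R := fine (surf t w) - d%:R * (t * vol W).

Lemma measurable_centered t : measurable_fun setT (centered t).
Proof.
by apply: measurable_funB => //; apply: measurableT_comp => //; exact: measurable_surf.
Qed.

Let dec_cvg (K : R) : K * dec ^+ n.+1 @[n --> \oo] --> 0.
Proof.
rewrite -(mulr0 K); apply: cvgMr; rewrite (cvg_shiftS (fun n => dec ^+ n)); apply: cvg_expr.
by rewrite ger0_norm// /dec ltr_pdivrMr ?mul1r ?ltrDr// ltr_wpDr.
Qed.

(** Four errors: truncating the surface, the unfilled volume, truncating M, and N(t). As n grows the
    first two vanish and the third leaves e/2. The mean square of N(t) is split at generation [n0]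
    into a finite sum and a uniform tail, whose total [q] contributes (e + q/e) / 2. *)
Lemma centered_dist t (e : R) n0 : 0 <= t -> 0 < e ->
  (\int[P]_w (`|centered t w - limit_var w|)%:E <=
   (e + (\sum_(v <- tree n0) variance_at t v + C * rho ^+ n0) / (2 * e))%:E)%E.
Proof.
move=> t0 e0; set q := _ + C * _.
have mM := measurable_limit_var; have mc := measurable_centered t.
pose K := d%:R * expR t.
pose b n := (K * dec ^+ n.+1 + K * dec ^+ n.+1) + ((e + C * rho ^+ n / e) / 2 + (e + q / e) / 2).
have le_b n : (n0 <= n)%N -> (\int[P]_w (`|centered t w - limit_var w|)%:E <= (b n)%:E)%E.
  move=> nn0.
  pose f1 w := `|fine (surf t w) - Sw t n.+1 w|; pose f2 w := d%:R * Rw t n.+1 w.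
  pose f3 w := `|limit_var w - Nw 0 n.+1 w|; pose f4 w := `|Nw t n.+1 w|.
  have f20 w : 0 <= f2 w by rewrite mulr_ge0// Rn_ge0.
  have [f10 f30 f40] : [/\ forall w, 0 <= f1 w, forall w, 0 <= f3 w & forall w, 0 <= f4 w].
    by split => w; exact: normr_ge0.
  have m1 : measurable_fun setT f1.
    apply: measurableT_comp => //; apply: measurable_funB => //.
    by apply: measurableT_comp => //; exact: measurable_surf.
  have m2 : measurable_fun setT f2 by exact: measurable_funM.
  have m3 : measurable_fun setT f3 by apply: measurableT_comp => //; exact: measurable_funB.
  have m4 : measurable_fun setT f4 by exact: measurableT_comp.
  apply: (@le_trans _ _ (\int[P]_w (((f1 w)%:E + (f2 w)%:E) + ((f3 w)%:E + (f4 w)%:E)))%E).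
    apply: ge0_le_integral => //.
    - by apply/measurable_EFinP; apply: measurableT_comp => //; exact: measurable_funB.
    - by apply: emeasurable_funD; apply: emeasurable_funD; exact/measurable_EFinP.
    - move=> w _; rewrite -!EFinD lee_fin /centered.
      have := Sn_decomposition d2 (E0^~ w) (U01^~ w) pW n.+1 t0 => hS.
      have -> : fine (surf t w) - d%:R * (t * vol W) - limit_var w =
        (fine (surf t w) - Sw t n.+1 w) - f2 w - (limit_var w - Nw 0 n.+1 w) - Nw t n.+1 w.
        by rewrite /f2; lra.
      apply: le_trans (ler_normB _ _) _; rewrite addrA lerD2r.
      apply: le_trans (ler_normB _ _) _; rewrite lerD2r.
      by apply: le_trans (ler_normB _ _) _; rewrite lerD2l ger0_norm.
  rewrite ge0_integralD//; last 4 first.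
  - by move=> w _; rewrite -EFinD lee_fin addr_ge0.
  - by apply: emeasurable_funD; exact/measurable_EFinP.
  - by move=> w _; rewrite -EFinD lee_fin addr_ge0.
  - by apply: emeasurable_funD; exact/measurable_EFinP.
  rewrite !ge0_integralD//; try exact/measurable_EFinP; try by move=> w _; rewrite lee_fin.
  rewrite /b [X in (_ <= X)%E]EFinD leeD//.
    rewrite [X in (_ <= X)%E]EFinD leeD//.
      by rewrite /K -mulrA; exact: surf_dist.
    under eq_integral do rewrite EFinM.
    rewrite ge0_integralZl//; last 2 first.
    - exact/measurable_EFinP.
    - by move=> w _; rewrite lee_fin Rn_ge0.
    by rewrite /K -mulrA [X in (_ <= X)%E]EFinM lee_wpmul2l// ?lee_fin//; exact: Rn_integral_le.
  rewrite [X in (_ <= X)%E]EFinD leeD//.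
    apply: L1_le_L2 => //; first exact: measurable_funB.
    exact: limit_var_dist.
  apply: L1_le_L2 => //.
  rewrite Nn_sqr lee_fin /q !big_tree (big_cat_nat (leq0n n0) (leqW nn0))//= lerD2l.
  exact: sum_variance_tail (leqW nn0).
have fin : (\int[P]_w (`|centered t w - limit_var w|)%:E)%E \is a fin_num.
  rewrite ge0_fin_numE; first by apply: le_lt_trans (le_b n0 (leqnn _)) _; exact: ltry.
  by apply: integral_ge0 => w _; rewrite lee_fin.
rewrite -(fineK fin) lee_fin.
have b_cvg : b n @[n --> \oo] --> e + q / (2 * e).
  have -> : e + q / (2 * e) = (0 + 0) + ((e + 0 / e) / 2 + (e + q / e) / 2).
    by field; rewrite gt_eqF.
  apply: cvgD; first by apply: cvgD; exact: dec_cvg.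
  apply: cvgD; last exact: cvg_cst.
  apply: cvgMl; apply: cvgD; first exact: cvg_cst.
  by apply: cvgMl; exact: cvg_rho.
apply: (cvgr_to_ge b_cvg); near=> n; rewrite -lee_fin fineK//; apply: le_b.
by near: n; exact: nbhs_infty_ge.
Unshelve. all: by end_near. Qed.

Lemma centered_cvg_L1 :
  (\int[P]_w (`|centered t w - limit_var w|)%:E @[t --> +oo%R] --> 0)%E.
Proof.
pose D t := (\int[P]_w (`|centered t w - limit_var w|)%:E)%E.
have D0 t : (0 <= D t)%E by apply: integral_ge0 => w _; rewrite lee_fin.
have fin t : 0 <= t -> D t \is a fin_num.
  move=> t0; rewrite ge0_fin_numE//.
  by apply: le_lt_trans (centered_dist 0 t0 ltr01) _; exact: ltry.
apply: (@cvg_EFin _ _ _ _ D 0).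
  by near=> t; apply: fin; near: t; apply: nbhs_pinfty_ge; exact: num_real.
apply/cvgr0Pnorm_le => e e0.
(* [centered_dist] is applied with e/2: two halves of [q], each at most e^2/4, give e/2 + q/e <=
   e. *)
have e4 : 0 < e ^+ 2 / 4 by rewrite divr_gt0// exprn_gt0.
have [n0 hn0] : exists n0, C * rho ^+ n0 <= e ^+ 2 / 4.
  near \oo => n; exists n; near: n; have /cvgr0Pnorm_le/(_ _ e4) := cvg_rho C.
  by apply: filterS => n; apply: le_trans; exact: ler_norm.
have [n1 hn1] : exists n1, \sum_(v <- tree n0) variance_at n1%:R v <= e ^+ 2 / 4.
  have h : \sum_(v <- tree n0) variance_at n%:R v @[n --> \oo] --> (0 : R).
    elim: (tree n0) => [|v l IH]; first by under eq_fun do rewrite big_nil; exact: cvg_cst.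
    rewrite (_ : (fun n => _) = (fun n => variance_at n%:R v +
      \sum_(u <- l) variance_at n%:R u)); last by apply/funext => n; rewrite big_cons.
    by rewrite -[X in _ --> X]addr0; apply: cvgD => //; exact: variance_at_cvg.
  near \oo => n; exists n; near: n; have /cvgr0Pnorm_le/(_ _ e4) := h.
  by apply: filterS => n; apply: le_trans; exact: ler_norm.
near=> t; have t0 : 0 <= t by near: t; apply: nbhs_pinfty_ge; exact: num_real.
have t1 : n1%:R <= t by near: t; apply: nbhs_pinfty_ge; exact: num_real.
have e2 : 0 < e / 2 by rewrite divr_gt0.
rewrite /= ger0_norm ?fine_ge0// -lee_fin fineK ?fin//.
apply: le_trans (centered_dist n0 t0 e2) _; rewrite lee_fin.
have : \sum_(v <- tree n0) variance_at t v <= e ^+ 2 / 4.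
  by apply: le_trans hn1; apply: ler_sum => v _; exact: variance_at_mono.
rewrite (_ : 2 * (e / 2) = e); last by field.
set x := \sum_(_ <- _) _ => hx; have : (x + C * rho ^+ n0) / e <= e / 2.
  by rewrite ler_pdivrMr// (_ : e / 2 * e = e ^+ 2 / 2); [lra|ring].
by lra.
Unshelve. all: by end_near. Qed.

(** For each fixed value of the other inputs the integral over [E [::]] is infinite, because the
    remaining factor exp(-1 - limit_rest) is a positive real. *)
Lemma limit_var_exp : (forall w, Fw [::] w = 1) -> kappa W = 1 ->
  (\int[P]_w (expR (- limit_var w))%:E = +oo)%E.
Proof.
move=> F1 k1; have mr := measurable_limit_rest.
pose F (z : without input (inl [::]) * R) : \bar R :=
  (expR z.2 * expR (- 1 - limit_rest z.1))%:E.
have mF1 : measurable_fun setT F.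
  apply/measurable_EFinP; apply: measurable_funM.
    by apply: measurableT_comp => //; exact: measurable_snd.
  apply: measurableT_comp => //; apply: measurable_funB => //.
  exact: (measurableT_comp mr measurable_fst).
transitivity (\int[P]_w F (w, input (inl [::]) w))%E.
  apply: eq_integral => w _; rewrite /F /= -expRD; congr (expR _)%:E.
  by rewrite /limit_var Qv0E F1 cell_nil k1; ring.
rewrite (integral_without mX indX mF1); last by move=> z; rewrite lee_fin mulr_ge0 ?expR_ge0.
transitivity (\int[P]_w (cst +oo w))%E; last first.
  by rewrite integral_cst// [X in (_ * X)%E](_ : _ = 1%E) ?mule1//; exact: probability_setT.
apply: eq_integral => w _; rewrite /F /=; under eq_integral do rewrite EFinM.
rewrite ge0_integralZr//; try by move=> *; rewrite lee_fin expR_ge0.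
  by rewrite (exponential_moment_infinite (mE [::]) (lawE [::])) gt0_mulye// lte_fin expR_gt0.
by apply/measurable_EFinP; exact: measurableT_comp.
Qed.

(** * The pair kernel summed over all generations *)

Section pair_kernel.
Variables x y : 'I_d -> R.
Hypothesis xy : x <> y.

Definition both_in c : R := (in_box c x && in_box c y)%:R.

Let D : R := \sum_i `|x i - y i|.

Let D_gt0 : 0 < D.
Proof.
rewrite lt_neqAle sumr_ge0 ?andbT//; apply/eqP => /esym D0; apply: xy; apply/funext => i.
have /eqP := D0; rewrite psumr_eq0// => /allP/(_ i).
by rewrite mem_index_enum => /(_ isT); rewrite normr_eq0 subr_eq0 => /eqP.
Qed.

Let dist_le_lam c : in_box c x && in_box c y -> D <= lam c.
Proof.
move=> /andP[/forallP xc /forallP yc]; apply: ler_sum => i _.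
have /andP[x1 x2] := xc i; have /andP[y1 y2] := yc i.
by rewrite /side ler_norml; apply/andP; split; lra.
Qed.

Lemma measurable_both_in d1 (S : measurableType d1) (c : S -> box R d) :
  measurable_box c -> measurable_fun setT (fun w => both_in (c w)).
Proof.
move=> mc; rewrite (_ : (fun w => _) = (fun w =>
    if in_box (c w) x && in_box (c w) y then 1 else 0)); last first.
  by apply/funext => w; rewrite /both_in; case: (_ && _).
apply: measurable_fun_ifT => //; apply: measurable_and.
- exact: (measurable_in_box (x := fun k _ => x k)).
- exact: (measurable_in_box (x := fun k _ => y k)).
Qed.

Let both_in_bounds c : 0 <= both_in c <= 1.
Proof. by rewrite /both_in ler0n lern1 leq_b1. Qed.

Let mboth v : measurable_fun setT (fun w => both_in (cl v w)).
Proof. exact: measurable_both_in. Qed.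

Definition pair_inv v w : R := both_in (cl v w) / lam (cl v w).

Lemma measurable_pair_inv v : measurable_fun setT (pair_inv v).
Proof.
apply: measurable_funM => //; apply: measurable_inv => [w|]; first exact: lam_ge0.
exact: measurable_lam.
Qed.

Lemma pair_inv_ge0 v w : 0 <= pair_inv v w.
Proof. by rewrite divr_ge0 ?lam_ge0//; case/andP: (both_in_bounds (cl v w)). Qed.

Let pair_inv_le v w : pair_inv v w <= D^-1.
Proof.
rewrite /pair_inv /both_in; case: (boolP (_ && _)) => h; last by rewrite mul0r invr_ge0 ltW.
have Dl := dist_le_lam h.
by rewrite mul1r lef_pV2 ?posrE// (lt_le_trans D_gt0).
Qed.

Let pair_inv_lam v w : D * pair_inv v w <= both_in (cl v w).
Proof.
rewrite /pair_inv /both_in; case: (boolP (_ && _)) => h; last by rewrite mul0r mulr0.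
by rewrite mul1r ler_pdivrMr ?mul1r ?(dist_le_lam h)// (lt_le_trans D_gt0)// dist_le_lam.
Qed.

Let split_sub (c : box R d) j r b z : proper_box c -> c.1 j <= r <= c.2 j ->
  in_box (split_box c (Some (j, r)) b) z -> in_box c z.
Proof.
move=> pc /andP[r1 r2] /forallP h; apply/forallP => k; have {h} := h k.
case: b => /=; case: eqVneq => [->|//] /andP[h1 h2]; apply/andP; split => //.
- exact: le_trans r2.
- exact: le_trans h1.
Qed.

(** [same_cell_integral] with the mark of [v] averaged out. The term lost by separation stands on
    the left, which avoids a subtraction of extended reals. *)
Lemma both_in_step v :
  (\int[P]_w (both_in (cl (rcons v true) w))%:E + \int[P]_w (both_in (cl (rcons v false) w))%:E +
   D%:E * \int[P]_w (pair_inv v w)%:E = \int[P]_w (both_in (cl v w))%:E)%E.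
Proof.
have b0 c : 0 <= both_in c by case/andP: (both_in_bounds c).
rewrite -ge0_integralD//; try exact/measurable_EFinP; try by move=> w _; rewrite lee_fin.
pose G (w : without input (inr v)) (H : option ('I_d * R)) : \bar R :=
  (both_in (split_box (cl v w) H true) + both_in (split_box (cl v w) H false))%:E.
have mc : measurable_box (fun w : without input (inr v) => cl v w).
  apply: (measurable_cell (S := without input (inr v))) => //.
  by apply: before_U => k; exact: take_neq.
have ms b j (r : without input (inr v) * R -> R) : measurable_fun setT r ->
    measurable_fun setT (fun z : without input (inr v) * R =>
      both_in (split_box (cl v z.1) (Some (j, r z)) b)).
  move=> mr; apply: measurable_both_in; split => i; case: b => /=; last 2 first.
  + by case: (i == j) => //; exact: (measurableT_comp (mc.2 i) measurable_fst).
  + exact: (measurableT_comp (mc.2 i) measurable_fst).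
  + exact: (measurableT_comp (mc.1 i) measurable_fst).
  + by case: (i == j) => //; exact: (measurableT_comp (mc.1 i) measurable_fst).
have mG1 j (r : without input (inr v) * R -> R) : measurable_fun setT r ->
    measurable_fun setT (fun z => G z.1 (Some (j, r z))).
  by move=> mr; apply/measurable_EFinP; apply: measurable_funD; exact: ms.
have mG2 : measurable_fun setT (fun w => G w None).
  by apply/measurable_EFinP; apply: measurable_funD => //=; exact: measurable_both_in.
have G0 w H : (0 <= G w H)%E by rewrite lee_fin addr_ge0.
have [e2 _] := integral_pick mG1 mG2 G0.
have -> : (\int[P]_w ((both_in (cl (rcons v true) w))%:E +
    (both_in (cl (rcons v false) w))%:E) = \int[P]_w G w (choose_hyp (cl v w) (U v w)))%E.
  by apply: eq_integral => w _; rewrite !cell_rcons.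
have e3 w : (\int[P]_w' G w (choose_hyp (cl v w) (U v w')) =
    (both_in (cl v w) - D * pair_inv v w)%:E)%E.
  (* If a point is outside the cell it is outside both parts, and both sides are 0. Otherwise [lam]
     is at least [D], hence positive. *)
  rewrite /pair_inv /both_in; case: (boolP (_ && _)) => h; last first.
    rewrite mul0r mulr0 subr0 integral0_eq// => w' _; rewrite /G.
    have [j [r [-> rc]]] := chooseP (ltnW d2) (clp v w) (U01 v w').
    have z b : both_in (split_box (cl v w) (Some (j, r)) b) = 0.
      rewrite /both_in; case: (boolP (_ && _)) => // /andP[h1 h2]; case/negP: h.
      by rewrite (split_sub (clp v w) rc h1) (split_sub (clp v w) rc h2).
    by rewrite !z addr0.
  have l0 : 0 < lam (cl v w) by rewrite (lt_le_trans D_gt0)// dist_le_lam.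
  have /andP[hx hy] := h.
  rewrite mul1r -(same_cell_integral (mU v) (lawU v) (clp v w) l0 hx hy).
  by apply: eq_integral => w' _; rewrite /G !big_cons big_nil addr0.
rewrite e2; under eq_integral do rewrite e3.
have mp := measurable_pair_inv v.
rewrite -ge0_integralZl//; last 3 first.
- exact/measurable_EFinP.
- by move=> w _; rewrite lee_fin pair_inv_ge0.
- by rewrite lee_fin ltW.
rewrite -ge0_integralD//.
- by apply: eq_integral => w _; rewrite -EFinM -EFinD subrK.
- by move=> w _; rewrite lee_fin subr_ge0.
- by apply/measurable_EFinP; apply: measurable_funB => //; exact: measurable_funM.
- by move=> w _; rewrite -EFinM lee_fin mulr_ge0 ?pair_inv_ge0// ltW.
- by apply/measurable_EFinP; exact: measurable_funM.
Qed.

Let qv v : R := fine (\int[P]_w (both_in (cl v w))%:E)%E.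
Let pv v : R := fine (\int[P]_w (pair_inv v w)%:E)%E.

Let qvE v : (\int[P]_w (both_in (cl v w))%:E)%E = (qv v)%:E.
Proof. by rewrite /qv fineK//; apply: (integral_bounded (C := 1)). Qed.

Let pvE v : (\int[P]_w (pair_inv v w)%:E)%E = (pv v)%:E.
Proof.
rewrite /pv fineK//; apply: (integral_bounded (C := D^-1)); first exact: measurable_pair_inv.
by move=> w; rewrite pair_inv_ge0 pair_inv_le.
Qed.

Let qv_ge0 v : 0 <= qv v.
Proof.
rewrite /qv fine_ge0// integral_ge0// => w _.
by rewrite lee_fin; case/andP: (both_in_bounds (cl v w)).
Qed.

Let qv_le_pv v : qv v / d%:R <= pv v.
Proof.
have dn0 : 0 < d%:R :> R by rewrite ltr0n; exact: ltnW (ltnW d3).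
have mp := measurable_pair_inv v.
rewrite ler_pdivrMr// mulrC -lee_fin EFinM -qvE -pvE -ge0_integralZl//; last 2 first.
- exact/measurable_EFinP.
- by move=> w _; rewrite lee_fin pair_inv_ge0.
apply: ge0_le_integral => //.
- by move=> w _; rewrite lee_fin; case/andP: (both_in_bounds (cl v w)).
- exact/measurable_EFinP.
- by apply/measurable_EFinP; exact: measurable_funM.
- move=> w _; rewrite -EFinM lee_fin /pair_inv /both_in.
  case: (boolP (_ && _)) => h; last by rewrite mul0r mulr0.
  have l0 : 0 < lam (cl v w) by rewrite (lt_le_trans D_gt0)// dist_le_lam.
  by rewrite mul1r ler_pdivlMr// mul1r lam_le.
Qed.

Let q n : R := \sum_(v <- gen n) qv v.
Let pp n : R := \sum_(v <- gen n) pv v.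

Let q_step n : q n.+1 + D * pp n = q n.
Proof.
rewrite /q big_gen mulr_sumr -big_split/=; apply: eq_bigr => v _.
have := both_in_step v; rewrite !qvE pvE -EFinM -!EFinD => -[<-] //.
Qed.

Let q_ge0 n : 0 <= q n. Proof. by apply: sumr_ge0. Qed.

(** As [lam <= d] in the unit cube, p_n >= q_n / d, so each generation loses D p_n >= (D/d) q_n.
    This is what leaves no remainder in the telescoping sum. *)
Let q_le n : in_box W x -> in_box W y -> q n <= (1 - D / d%:R) ^+ n.
Proof.
move=> xW yW; have dn0 : 0 < d%:R :> R by rewrite ltr0n; exact: ltnW (ltnW d3).
have Dd : D <= d%:R.
  by apply: (@le_trans _ _ (lam W)); [apply: dist_le_lam; rewrite xW|exact: lam_le].
elim: n => [|n IH].
  rewrite /q /= big_seq1 expr0 -lee_fin -qvE; under eq_integral do rewrite cell_nil.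
  by rewrite integral_cst_probability lee_fin; case/andP: (both_in_bounds W).
rewrite exprS; apply: (@le_trans _ _ ((1 - D / d%:R) * q n)); last first.
  by rewrite ler_wpM2l// subr_ge0 ler_pdivrMr// mul1r.
have : q n / d%:R <= pp n by rewrite /q mulr_suml; apply: ler_sum => v _; exact: qv_le_pv.
move=> /(ler_wpM2l (ltW D_gt0)); have := q_step n.
have -> : (1 - D / d%:R) * q n = q n - D * (q n / d%:R) by ring.
by lra.
Qed.

Lemma pair_series : in_box W x -> in_box W y ->
  (\sum_(n <oo) \int[P]_w (\sum_(v <- gen n) pair_inv v w)%:E = (D^-1)%:E)%E.
Proof.
move=> xW yW; have dn0 : 0 < d%:R :> R by rewrite ltr0n; exact: ltnW (ltnW d3).
have Dd : D <= d%:R.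
  by apply: (@le_trans _ _ (lam W)); [apply: dist_le_lam; rewrite xW|exact: lam_le].
have e n : (\int[P]_w (\sum_(v <- gen n) pair_inv v w)%:E = (pp n)%:E)%E.
  rewrite /pp -sumEFin; under eq_integral do rewrite -sumEFin.
  rewrite ge0_integral_sum//; last 2 first.
  - by move=> v; apply/measurable_EFinP; exact: measurable_pair_inv.
  - by move=> v w _; rewrite lee_fin pair_inv_ge0.
  by apply: eq_bigr => v _; exact: pvE.
have s n : \sum_(0 <= k < n) pp k = (1 - q n) / D.
  elim: n => [|n IH].
    rewrite big_geq// /q /= big_seq1 (_ : qv [::] = 1) ?subrr ?mul0r//.
    apply: EFin_inj; rewrite -qvE; under eq_integral do rewrite cell_nil /both_in xW yW.
    by rewrite integral_cst_probability.
  rewrite big_nat_recr//= IH; have := q_step n => <-.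
  by field; rewrite gt_eqF.
apply/cvg_lim => //.
rewrite (_ : (fun n => _) = (fun n => ((1 - q n) / D)%:E)); last first.
  by apply/funext => n; rewrite -s -sumEFin; apply: eq_bigr => k _; exact: e.
apply: cvg_EFin_comp; rewrite -[X in _ --> X]mul1r; apply: cvgMl.
rewrite -[X in _ --> X]subr0; apply: cvgB; first exact: cvg_cst.
apply: (@squeeze_cvgr _ _ _ _ (fun=> 0) (fun n => (1 - D / d%:R) ^+ n)).
- by apply: nearW => n; rewrite q_ge0 q_le.
- exact: cvg_cst.
- apply: cvg_expr; rewrite ger0_norm; first by rewrite ltrBlDr ltrDl divr_gt0.
  by rewrite subr_ge0 ler_pdivrMr// mul1r.
Qed.

Let cell_in v w z : in_box (cl v w) z -> in_box W z.
Proof.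
move=> /forallP h; apply/forallP => k; have /andP[h1 h2] := h k.
have [l1 l2] := cell_sub (E^~ w) d2 (U01^~ w) pW v k.
by rewrite (le_trans l1 h1) (le_trans h2 l2).
Qed.

Lemma pair_kernelE :
  (\sum_(n <oo) \int[P]_w (\sum_(v <- gen n) pair_inv v w)%:E =
   (\1_(box_set W) x)%:E * (\1_(box_set W) y)%:E * (Lam (hits (segment x y)))^-1)%E.
Proof.
(* Distinct points keep the extended inverse away from its value at 0, which is infinite. *)
rewrite Lam_segment -/D !indic_box_set inver gt_eqF//.
case: (boolP (in_box W x)) => xW; case: (boolP (in_box W y)) => yW.
- by rewrite pair_series// !mul1e.
- rewrite mule0 mul0e eseries0// => n _ _; rewrite integral0_eq// => w _.
  rewrite big1// => v _; rewrite /pair_inv /both_in.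
  case: (boolP (in_box (cl v w) y)) => [/cell_in|_]; first by rewrite (negbTE yW).
  by rewrite andbF mul0r.
- rewrite !mul0e eseries0// => n _ _; rewrite integral0_eq// => w _.
  rewrite big1// => v _; rewrite /pair_inv /both_in.
  case: (boolP (in_box (cl v w) x)) => [/cell_in|_]; first by rewrite (negbTE xW).
  by rewrite mul0r.
- rewrite !mul0e eseries0// => n _ _; rewrite integral0_eq// => w _.
  rewrite big1// => v _; rewrite /pair_inv /both_in.
  case: (boolP (in_box (cl v w) x)) => [/cell_in|_]; first by rewrite (negbTE xW).
  by rewrite mul0r.
Qed.

End pair_kernel.

(** * The variance as an integral over hyperplanes *)

Lemma coord_measurable2_pair_inv v :
  coord_measurable2 (fun w y x => (pair_inv x y v w)%:E).
Proof.
move=> d' T' p y x mp my mx; apply/measurable_EFinP.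
have mc : measurable_box (fun t => cl v (p t)).
  by split => i; [exact: (measurableT_comp ((mcl v).1 i) mp)|exact: (measurableT_comp ((mcl v).2 i) mp)].
rewrite /pair_inv; apply: measurable_funM.
  rewrite (_ : (fun t => _) = (fun t => if in_box (cl v (p t)) (x^~ t) && in_box (cl v (p t)) (y^~ t)
      then 1 else 0)); last first.
    by apply/funext => t; rewrite /both_in; case: (_ && _).
  apply: measurable_fun_ifT => //; apply: measurable_and; exact: measurable_in_box.
apply: (measurable_inv (f := fun t => lam (cl v (p t)))) => [t|]; first exact: lam_ge0.
exact: measurable_lam.
Qed.

Definition base_point (i : 'I_d) (r : R) (k : 'I_d) : R := if k == i then r else 0.

Lemma coord_measurable_indic d1 (S : measurableType d1) (c : box R d) :
  coord_measurable (fun (_ : S) x => (\1_(box_set c) x)%:E : \bar R).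
Proof.
move=> d' T' p x mp mx; apply/measurable_EFinP.
rewrite (_ : (fun t => _) = (fun t => if in_box c (x^~ t) then 1 else 0)); last first.
  by apply/funext => t; rewrite indic_box_set; case: (in_box _ _).
apply: measurable_fun_ifT => //; exact: (measurable_in_box (c := fun=> c)).
Qed.

Local Notation others i := [seq j <- enum 'I_d | j != i].

(** The kernel is a product of two indicators divided by [lam]; each indicator integrates to the
    face when the hyperplane meets the cell, and to 0 otherwise. *)
Lemma pair_inv_section i r v w :
  iter_int2 (others i) (fun y x => (pair_inv x y v w)%:E) (base_point i r) =
  ((((cl v w).1 i <= r <= (cl v w).2 i)%R%:R) * (face (cl v w) i ^+ 2 / lam (cl v w)))%:E.
Proof.
set c := cl v w; pose k := face c i * (c.1 i <= r <= c.2 i)%R%:R.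
have fc : 0 <= face c i by apply: face_ge0; exact: clp.
have lc : 0 <= (lam c)^-1 by rewrite invr_ge0 lam_ge0//; exact: clp.
have k0 : 0 <= k by rewrite mulr_ge0.
have hk : iter_int (others i) (fun x => (\1_(box_set c) x)%:E) (base_point i r) = k%:E.
  by rewrite -(hyp_int_box i r (clp v w)).
have mi := coord_measurable_indic (S := measurableTypeR R) c.
have i0 (w' : measurableTypeR R) z : (0 <= (\1_(box_set c) z)%:E :> \bar R)%E.
  by rewrite lee_fin indic_box_set.
rewrite /iter_int2 (_ : iter_int _ _ _ =
    iter_int (others i) (fun y => (k / lam c)%:E * (\1_(box_set c) y)%:E)%E (base_point i r)).
  rewrite (@iter_intZl R d _ _ (others i) _ (0 : measurableTypeR R) _ _ mi i0); last by rewrite mulr_ge0.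
  by rewrite hk -EFinM /k; case: (_ <= _ <= _)%R; congr EFin; rewrite /=; ring.
apply: iter_int_ext => y _.
rewrite (_ : iter_int _ _ _ = iter_int (others i)
    (fun x => ((\1_(box_set c) y / lam c)%:E * (\1_(box_set c) x)%:E))%E (base_point i r)).
  rewrite (@iter_intZl R d _ _ (others i) _ (0 : measurableTypeR R) _ _ mi i0); last by rewrite mulr_ge0// indic_box_set.
  by rewrite hk -!EFinM; congr EFin; ring.
apply: iter_int_ext => x _; rewrite -EFinM /pair_inv /both_in !indic_box_set -/c.
by congr EFin; case: (in_box c x); case: (in_box c y); rewrite /=; ring.
Qed.

Lemma beta_pair_inv v w : (beta (cl v w))%:E =
  (\sum_i \int[lebesgue_measure]_(r in [set: R])
     iter_int2 (others i) (fun y x => (pair_inv x y v w)%:E) (base_point i r))%E.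
Proof.
set c := cl v w; rewrite /beta mulr_suml -sumEFin; apply: eq_bigr => i _.
under eq_integral do rewrite pair_inv_section -/c.
rewrite (_ : (\int[_]_(r in setT) _)%E =
    (\int[lebesgue_measure]_(r in `[c.1 i, c.2 i]) (face c i ^+ 2 / lam c)%:E)%E).
  by rewrite integral_itv_cst ?clp// /side; congr EFin; ring.
rewrite [RHS]integral_mkcond; apply: eq_integral => r _; rewrite patchE.
have -> : (r \in `[c.1 i, c.2 i]%classic) = (c.1 i <= r <= c.2 i)%R.
  by apply/idP/idP; rewrite inE/= in_itv/=.
by case: (_ <= _ <= _)%R; rewrite ?mul1r ?mul0r.
Qed.

(** The first argument is a dummy that supplies the parameter space of [coord_measurable2]; [z0]
    fills it. *)
Let Pv v (_ : measurableTypeR R) (y x : 'I_d -> R) : \bar R :=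
  (\int[P]_w (pair_inv x y v w)%:E)%E.

Let pair_inv0 v w y x : (0 <= (pair_inv x y v w)%:E)%E.
Proof. by rewrite lee_fin; exact: pair_inv_ge0. Qed.

Let Pv0 v s y x : (0 <= Pv v s y x)%E. Proof. by apply: integral_ge0 => w _. Qed.

Let mPv v : coord_measurable2 (Pv v).
Proof. by apply: coord_measurable2_integral => //; exact: coord_measurable2_pair_inv. Qed.

Let z0 : measurableTypeR R := 0.

Lemma measurable_base_point i k :
  measurable_fun setT (fun r : measurableTypeR R => base_point i r k).
Proof. by rewrite /base_point; case: (k == i); [exact: measurable_id|exact: measurable_cst]. Qed.

(** At time 0 no clock has run, so the variance of the node is the mean of [beta]; Tonelli moves the
    expectation inside the integrals over the hyperplane and the two points. *)
Lemma variance_at_pair v : (variance_at 0 v)%:E =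
  (\sum_i \int[lebesgue_measure]_(r in [set: R])
     iter_int2 (others i) (Pv v z0) (base_point i r))%E.
Proof.
pose F i (z : T * measurableTypeR R) :=
  iter_int2 (others i) (fun y x => (pair_inv x y v z.1)%:E) (base_point i z.2).
have mFi i : measurable_fun setT (F i).
  apply: (measurable_iter_int2 (p := fst) (b := fun k z => base_point i z.2 k)
    (others i) (coord_measurable2_pair_inv v)) => //.
  by move=> k; exact: (measurableT_comp (measurable_base_point i k) measurable_snd).
have Fi0 i z : (0 <= F i z)%E by apply: iter_int2_ge0.
rewrite -variance_atE (_ : (\int[P]_w _)%E =
    \int[P]_w (\sum_i \int[lebesgue_measure]_(r in [set: R]) F i (w, r)))%E; last first.
  apply: eq_integral => w _; rewrite -beta_pair_inv; congr EFin.
  rewrite (_ : rs 0 v w = 0) ?oppr0 ?expR0 ?mul1r//.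
  by rewrite /rest (max_idPr _) ?mul0r// sub0r oppr_le0 birth_ge0.
rewrite ge0_integral_sum//; last 2 first.
- by move=> i; apply: (@measurable_fun_fubini_tonelli_F _ _ _ _ _ lebesgue_measure (F i)) => // z.
- by move=> i w _; apply: integral_ge0.
apply: eq_bigr => i _; rewrite (fubini_tonelli (F i))//.
apply: eq_integral => r _; rewrite /F /= iter_int2_tonelli//.
exact: coord_measurable2_pair_inv.
Qed.

Let K (y x : 'I_d -> R) : \bar R :=
  ((\1_(box_set W) x)%:E * (\1_(box_set W) y)%:E * (Lam (hits (segment x y)))^-1)%E.

Let K0 y x : (0 <= K y x)%E.
Proof.
rewrite /K !indic_box_set mule_ge0// ?mule_ge0// ?lee_fin// Lam_segment inver.
case: ifP => // _.
by rewrite lee_fin invr_ge0 sumr_ge0.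
Qed.

Let mK y : coord_measurable (fun (_ : measurableTypeR R) x => K y x).
Proof.
move=> d' T' p x mp mx; rewrite /K; apply: emeasurable_funM.
  apply: emeasurable_funM => //.
  exact: (coord_measurable_indic (S := measurableTypeR R) W mp mx).
under eq_fun do rewrite Lam_segment inver.
have mD : measurable_fun setT (fun t => \sum_i `|x i t - y i|).
  by apply: measurable_sum => i; apply: measurableT_comp => //; exact: measurable_funB.
apply: measurable_fun_ifT => //; first exact: measurable_fun_eqr.
apply/measurable_EFinP; apply: measurable_inv => // t; exact: sumr_ge0.
Qed.

(** The series was identified with the kernel for distinct points only. Excluding equality in one
    free coordinate of the hyperplane removes a null set containing the diagonal. *)
Lemma series_pair_iter i b :
  iter_int2 (others i) (fun y x => \sum_(n <oo) \sum_(v <- gen n) Pv v z0 y x)%E b =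
  iter_int2 (others i) K b.
Proof.
have [j [s' es]] : exists j s', others i = j :: s'.
  have [j ji] : exists j : 'I_d, j != i.
    exists (if i == Ordinal (ltnW d2) then Ordinal d2 else Ordinal (ltnW d2)).
    by case: (eqVneq i) => [->|]; rewrite // eq_sym.
  have : j \in others i by rewrite mem_filter ji mem_enum.
  by case: (others i) => // a l _; exists a, l.
have us : uniq (j :: s') by rewrite -es filter_uniq// enum_uniq.
rewrite /iter_int2 es; apply: iter_int_ext => y _.
pose F (_ : measurableTypeR R) x := (\sum_(n <oo) \sum_(v <- gen n) Pv v z0 y x)%E.
have mFy : coord_measurable F.
  move=> d' T' p x mp mx; apply: ge0_emeasurable_sum => [n t _ _|n _].
    by apply: sume_ge0 => v _.
  apply: emeasurable_sum => v; exact: (coord_measurable2_slice y (mPv v) mp mx).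
have F0 w z : (0 <= F w z)%E by apply: nneseries_ge0 => n _ _; apply: sume_ge0 => v _.
apply: (@iter_int_ext_off R d _ (measurableTypeR R) j s' F (fun _ x => K y x) z0 b (y j)) => //.
move=> z _ zy; have xy : z <> y by move=> e; rewrite e eqxx in zy.
rewrite /F /K -(pair_kernelE xy); apply: eq_eseriesr => n _.
under [RHS]eq_integral do rewrite -sumEFin.
rewrite ge0_integral_sum// => v; apply/measurable_EFinP; exact: measurable_pair_inv.
Qed.

Lemma limit_var_sqr_formula :
  (\int[P]_w (limit_var w ^+ 2)%:E)%E = var_formula (box_set W).
Proof.
have mh i v : measurable_fun setT (fun r : measurableTypeR R =>
    iter_int2 (others i) (Pv v z0) (base_point i r)).
  apply: (measurable_iter_int2 (p := fun=> z0) (b := fun k r => base_point i r k)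
    (others i) (mPv v)) => // k; exact: measurable_base_point.
have h0 i v r : (0 <= iter_int2 (others i) (Pv v z0) (base_point i r))%E.
  exact: iter_int2_ge0.
rewrite limit_var_sqr.
transitivity (\sum_(n <oo) \sum_i \sum_(v <- gen n) \int[lebesgue_measure]_(r in [set: R])
     iter_int2 (others i) (Pv v z0) (base_point i r))%E.
  apply: eq_eseriesr => n _; rewrite exchange_big/= -sumEFin.
  by apply: eq_bigr => v _; exact: variance_at_pair.
rewrite nneseries_sum; last first.
  by move=> i n _; apply: sume_ge0 => v _; apply: integral_ge0.
rewrite /var_formula /Lam_int; apply: eq_bigr => i _.
transitivity (\int[lebesgue_measure]_(r in [set: R]) iter_int2 (others i) K (base_point i r))%E.
  transitivity (\sum_(n <oo) \int[lebesgue_measure]_(r in [set: R])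
      \sum_(v <- gen n) iter_int2 (others i) (Pv v z0) (base_point i r))%E.
    by apply: eq_eseriesr => n _; rewrite ge0_integral_sum.
  rewrite -integral_nneseries//.
  - apply: eq_integral => r _; rewrite -series_pair_iter.
    rewrite (iter_int2_nneseries (f := fun n w y x => (\sum_(v <- gen n) Pv v w y x)%E)).
    + apply: eq_eseriesr => n _; by rewrite (@iter_int2_sum R d _ _ _ (gen n) Pv).
    + move=> n d' T' p y x mp my mx; apply: emeasurable_sum => v; exact: mPv.
    + by move=> n w y x; apply: sume_ge0 => v _.
  - by move=> n; apply: emeasurable_sum => v; exact: mh.
  - by move=> n r _; apply: sume_ge0 => v _.
(* [var_formula] integrates over the hyperplanes hitting [W]. On the others every point lies outside
   [W] and the kernel is 0. *)
rewrite [RHS]integral_mkcond; apply: eq_integral => r _; rewrite patchE.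
case: ifPn => // rW; rewrite /iter_int2.
have out z : (forall k, k \notin others i -> z k = base_point i r k) -> \1_(box_set W) z = 0 :> R.
  move=> hz; rewrite indicE; case: (boolP (z \in box_set W)) => // zW.
  case/negP: rW; rewrite inE; exists z; split => /=; last by rewrite inE in zW.
  by rewrite /hyp /= hz ?mem_filter ?eqxx// /base_point eqxx.
rewrite -[RHS](iter_int0 (others i) (base_point i r)).
apply: iter_int_ext => y _; rewrite -[RHS](iter_int0 (others i) (base_point i r)).
by apply: iter_int_ext => x hx; rewrite /K out// !mul0e.
Qed.

End tree_probability.

(** * Scaling of the construction *)

Section scaling.
Context (R : realType) (d : nat).
Variables (E U : seq bool -> R) (L : R).
Hypothesis L0 : 0 < L.

Definition scale_box (c : box R d) : box R d := (fun k => L * c.1 k, fun k => L * c.2 k).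

Definition scale_hyp (H : option ('I_d * R)) : option ('I_d * R) :=
  if H is Some (j, r) then Some (j, L * r) else None.

Lemma pick_scale c l s : pick (scale_box c) l (L * s) = scale_hyp (pick c l s).
Proof.
elim: l s => [//|j l IH] s /=.
rewrite -!mulrBr ltr_pM2l//; case: ifP => _; last exact: IH.
by rewrite /= mulrDr.
Qed.

Lemma lam_scale c : lam (scale_box c) = L * lam c.
Proof. by rewrite /lam mulr_sumr; apply: eq_bigr => i _; rewrite /side mulrBr. Qed.

Lemma choose_scale c u : choose_hyp (scale_box c) u = scale_hyp (choose_hyp c u).
Proof.
rewrite /choose_hyp -/(lam (scale_box c)) lam_scale -pick_scale; congr pick.
by rewrite mulrCA.
Qed.

Lemma split_scale c H b : split_box (scale_box c) (scale_hyp H) b = scale_box (split_box c H b).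
Proof.
case: H => [[j r]|//]; rewrite /scale_box; case: b => /=; congr pair;
  by apply/funext => k; case: (k == j).
Qed.

Lemma face_scale c i : face (scale_box c) i = L ^+ (d - 1) * face c i.
Proof.
rewrite /face; under eq_bigr do rewrite /side -mulrBr.
rewrite big_split/=; congr (_ * _).
by rewrite (eq_bigl (mem (predC1 i)))// prodr_const cardC1 card_ord subn1.
Qed.

Variable W : box R d.
Hypotheses (d2 : (1 < d)%N) (U01 : forall v, 0 <= U v <= 1) (pW : proper_box W).

Lemma proper_scale : proper_box (scale_box W).
Proof. by move=> i; rewrite ler_pM2l. Qed.

Lemma cell_scale v : cell E U (scale_box W) v = scale_box (cell E U W v).
Proof.
elim/last_ind: v => [//|v b IH].
by rewrite !cell_rcons /hypv IH choose_scale split_scale.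
Qed.

Lemma birth_scale v : birth E U (scale_box W) v = birth E U W v / L.
Proof.
elim/last_ind: v => [|v b IH]; first by rewrite !birth_nil mul0r.
rewrite !birth_rcons//; last exact: proper_scale.
by rewrite /dth IH cell_scale lam_scale mulrDl invfM; congr (_ + _); ring.
Qed.

Lemma dth_scale v : dth E U (scale_box W) v = dth E U W v / L.
Proof. by rewrite /dth birth_scale cell_scale lam_scale mulrDl invfM; congr (_ + _); ring. Qed.

Lemma Fv_scale v : Fv E U (scale_box W) v = L ^+ (d - 1) * Fv E U W v.
Proof.
rewrite /Fv /hypv cell_scale choose_scale; case: choose_hyp => [[j r]|] /=.
  exact: face_scale.
by rewrite mulr0.
Qed.

(** With the same inputs, cells and rates are multiplied by L, times are divided by L, and facets
    are multiplied by L^(d-1). The scaling thus holds path by path and not only in law. *)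
Lemma stit_scale t :
  stit_surface E U (scale_box W) t = ((L ^+ (d - 1))%:E * stit_surface E U W (L * t))%E.
Proof.
rewrite !stit_series//; last exact: proper_scale.
rewrite -nneseriesZl//; last first.
  move=> n _; rewrite lee_fin sumr_ge0// => v _; case: ifP => // _; exact: Fv_ge0.
apply: eq_eseriesr => n _; rewrite -EFinM mulr_sumr; congr EFin; apply: eq_bigr => v _.
rewrite dth_scale Fv_scale ler_pdivrMr// [t * L]mulrC.
by case: ifP => _; rewrite ?mulr0.
Qed.

End scaling.

Import HBNNSimple.

(** * Changing an integrand on a null set *)

Section null_sets.
Context d (T : measurableType d) (R : realType) (P : probability T R).
Variable N : set T.
Hypotheses (mN : measurable N) (N0 : P N = 0%E).

(** This covers functions not known to be measurable, such as the surface built from the unclamped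
    inputs: a nonnegative integral is a supremum over simple functions below the integrand, and
    these may be set to 0 on [N]. *)
Let ge0_integral_off_null (f g : T -> \bar R) : (forall w, 0 <= f w)%E ->
  (forall w, 0 <= g w)%E -> (forall w, ~ N w -> f w = g w) ->
  (\int[P]_w f w <= \int[P]_w g w)%E.
Proof.
move=> f0 g0 fg; rewrite !ge0_integralTE//; apply: ge_ereal_sup => _ [h hf <-].
pose h' := proj_nnsfun h (measurableC mN).
have -> : sintegral P h = sintegral P h'.
  rewrite -!integralT_nnsfun; apply: ae_eq_integral => //.
  - by apply/measurable_EFinP; exact: measurable_funP.
  - by apply/measurable_EFinP; exact: measurable_funP.
  exists N; split => // w /= hw; apply: contrapT => nw; apply: hw => _.
  by rewrite mindicE mem_set// mulr1.
apply: ereal_sup_ubound; exists h' => //= w.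
rewrite mindicE; case: (boolP (w \in ~` N)) => [|_]; last by rewrite mulr0.
by rewrite inE mulr1 => /= nw; rewrite -fg.
Qed.

Lemma integral_off_null (f g : T -> \bar R) : (forall w, ~ N w -> f w = g w) ->
  (\int[P]_w f w = \int[P]_w g w)%E.
Proof.
move=> fg; rewrite integralE [RHS]integralE; congr (_ - _)%E; apply/eqP;
  rewrite eq_le; apply/andP; split; apply: ge0_integral_off_null => // w /fg e;
  by rewrite ?funeposE ?funenegE e.
Qed.

End null_sets.

(** * Clamping the inputs into their ranges *)

Section clamping.
Context (R : realType) d0 (T : measurableType d0) (P : probability T R).

(** The laws place clocks in the positive reals and marks in [0, 1] only almost surely, whereas
    cells remain proper boxes only if this holds at every node. Clamping enforces it everywhere
    without changing the laws. *)
Definition clamp_pos (x : R) : R := if 0 < x then x else 1.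
Definition clamp_unit (x : R) : R := Num.min (Num.max x 0) 1.

Lemma clamp_pos_gt0 x : 0 < clamp_pos x.
Proof. by rewrite /clamp_pos; case: ifPn => // _; exact: ltr01. Qed.

Lemma clamp_unit01 x : 0 <= clamp_unit x <= 1.
Proof. by rewrite /clamp_unit le_min le_max lexx orbT ler01/= ge_min lexx orbT. Qed.

Lemma clamp_unit_id x : 0 <= x <= 1 -> clamp_unit x = x.
Proof. by move=> /andP[x0 x1]; rewrite /clamp_unit (max_idPl x0) (min_idPl x1). Qed.

Lemma measurable_clamp_pos : measurable_fun setT clamp_pos.
Proof. by apply: measurable_fun_ifT => //; exact: measurable_fun_ltr. Qed.

Lemma measurable_clamp_unit : measurable_fun setT clamp_unit.
Proof. by apply: measurable_minr => //; exact: measurable_maxr. Qed.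

Lemma law_off_null (X : T -> R) (f : R -> R) (B A : set R) : measurable_fun setT X ->
  measurable_fun setT f -> measurable B -> P (X @^-1` B) = 0%E ->
  (forall x, ~ B x -> f x = x) -> measurable A ->
  P ((fun w => f (X w)) @^-1` A) = P (X @^-1` A).
Proof.
move=> mX mf mB B0 fid mA.
have mpre (Y : T -> R) C : measurable_fun setT Y -> measurable C -> measurable (Y @^-1` C).
  by move=> mY mC; rewrite -[X in measurable X]setTI; exact: mY.
have mfX : measurable_fun setT (fun w => f (X w)) by exact: measurableT_comp.
have PE C : measurable C -> P C = (\int[P]_w (\1_C w)%:E)%E.
  by move=> mC; rewrite integral_indic// setIT.
rewrite !PE//; try exact: mpre.
apply: (integral_off_null (N := X @^-1` B)) => //; first exact: mpre.
move=> w nB; rewrite !indicE; congr (nat_of_bool _)%:R%:E.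
by apply/idP/idP; rewrite !inE /preimage /= fid.
Qed.

End clamping.

(** * The limit theorem on the unit cube *)

Section unit_cube.
Context (R : realType) (d : nat).
Hypothesis d3 : (2 < d)%N.

Local Notation cube := (@cube_box R d 1).

Lemma side_cube i : side cube i = 1. Proof. by rewrite /side subr0. Qed.

Lemma face_cube i : face cube i = 1.
Proof. by apply: big1 => j _; exact: side_cube. Qed.

Lemma vol_cube : vol cube = 1.
Proof. by apply: big1 => j _; exact: side_cube. Qed.

Lemma lam_cube : lam cube = d%:R.
Proof.
rewrite /lam (eq_bigr (fun=> 1)); last by move=> i _; exact: side_cube.
by rewrite sumr_const card_ord.
Qed.

Lemma kappa_cube : kappa cube = 1.
Proof.
by rewrite /kappa vol_cube lam_cube mulr1 divff// pnatr_eq0 -lt0n (ltnW (ltnW d3)).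
Qed.

Lemma proper_cube : proper_box cube. Proof. by move=> i; exact: ler01. Qed.

Lemma in_unit_cube : in_unit cube. Proof. by move=> i; split. Qed.

Lemma scale_cube (L : R) : scale_box L cube = cube_box d L.
Proof.
by rewrite /scale_box /cube_box /=; congr pair; apply/funext => k; rewrite ?mulr0 ?mulr1.
Qed.

Lemma Fv_cube (E U : seq bool -> R) : (forall v, 0 <= U v <= 1) -> Fv E U cube [::] = 1.
Proof.
move=> U01; rewrite /Fv; have [j [r [-> _]]] :=
  hypvP E (ltnW d3) U01 proper_cube [::].
by rewrite /= cell_nil face_cube.
Qed.

Context d0 (T : measurableType d0) (P : probability T R) (E U : seq bool -> T -> R).
Hypotheses (E0 : forall v w, 0 < E v w) (U01 : forall v w, 0 <= U v w <= 1)
  (mE : forall v, measurable_fun setT (E v)) (mU : forall v, measurable_fun setT (U v))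
  (indX : mutually_independent P (input E U))
  (lawE : forall v A, measurable A -> P (E v @^-1` A) = exponential_prob 1 A)
  (lawU : forall v A, measurable A -> P (U v @^-1` A) = lebesgue_measure (A `&` `[0, 1])).

Lemma cube_limit_law : exists mu : probability R R,
  [/\ forall f : R -> R, continuous f -> (exists M, forall x, `|f x| <= M) ->
        (\int[P]_w (f (centered E U cube t w))%:E)%E @[t --> +oo] -->
          (\int[mu]_x (f x)%:E)%E,
      (\int[mu]_x (x ^+ 2)%:E < +oo)%E,
      (forall m s : R, s != 0 ->
         ~ (forall A, measurable A -> mu A = normal_prob m s A)) &
      variance_of mu = var_formula (box_set cube)].
Proof.
have pW := proper_cube; have uW := in_unit_cube.
pose M := limit_var E U cube.
have mM : measurable_fun setT M by exact: measurable_limit_var.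
pose gm : {RV P >-> R} := mfun_Sub (mem_set mM).
pose mu : probability R R := distribution P gm.
have M2 : (\int[P]_w (M w ^+ 2)%:E < +oo)%E.
  have mN : measurable_fun setT (fun w => Nn (E^~ w) (U^~ w) cube 0 1).
    apply: measurable_sum => v; by apply: measurable_Qv => //; first [exact: ltnW|exact: before_all].
  have N2 := Nn_sqr d3 U01 pW uW mE mU indX lawE lawU 0 1.
  have dist := limit_var_dist d3 U01 pW uW mE mU indX lawE lawU 0.
  by apply: le_lt_trans (L2_perturb mM mN ltr01 _ dist) (ltry _); rewrite N2.
have iM : P.-integrable setT (EFin \o M) by exact: L2_integrable.
have ge0 f : measurable_fun setT f -> (forall x, 0 <= f x)%E ->
    (\int[mu]_x f x = \int[P]_w f (M w))%E.
  by move=> mf f0; rewrite (ge0_integral_distribution gm).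
exists mu; split.
- move=> f cf [K fK].
  have mf : measurable_fun setT f by exact: continuous_measurable_fun.
  have -> : (\int[mu]_x (f x)%:E = \int[P]_w (f (M w))%:E)%E.
    rewrite (integral_distribution (X := gm) (f := EFin \o f))//.
      exact/measurable_EFinP.
    have iK : P.-integrable setT (fun=> K%:E) by apply: finite_measure_integrable_cst.
    apply: (le_integrable measurableT _ _ iK).
      by apply/measurable_EFinP; exact: measurableT_comp.
    move=> w _ /=; rewrite lee_fin; apply: le_trans (fK _) _; exact: ler_norm.
  apply: cvg_in_law_of_L1 => //; last by exists K.
  - by move=> t; exact: measurable_centered.
  - by have /integrableP[] := iM.
  - exact: centered_cvg_L1.
- rewrite ge0//; last by move=> x; rewrite lee_fin sqr_ge0.
  by apply/measurable_EFinP; exact: measurable_funX.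
- move=> m s s0 muE; have := normal_exp_moment m s0.
  have mM' : measurable_fun setT (M : T -> measurableTypeR R) by exact: mM.
  pose gm' : {mfun T >-> measurableTypeR R} :=
    @mfun_Sub _ _ T (measurableTypeR R) _ (mem_set mM').
  rewrite (eq_measure_integral (distribution P gm')); last by move=> A mA _; exact/esym/muE.
  rewrite (ge0_integral_distribution gm')//.
  + by rewrite limit_var_exp// ?kappa_cube// => w; exact: Fv_cube.
  + by apply/measurable_EFinP; apply: measurableT_comp => //; exact: measurable_funN.
- rewrite /variance_of.
  have -> : (\int[mu]_y y%:E = 0)%E.
    rewrite (integral_distribution (X := gm) (f := EFin))//.
    exact: limit_var_mean0.
  rewrite /= ge0//.
  + under eq_integral do rewrite subr0.
    exact: limit_var_sqr_formula.
  + by apply/measurable_EFinP; apply: measurable_funX; exact: measurable_funB.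
  + by move=> x; rewrite lee_fin sqr_ge0.
Qed.

End unit_cube.

(** What remains is to transfer [cube_limit_law] from the clamped inputs on the unit cube at time L
    to the given inputs on the cube of side L at time 1: by scaling, outside a null set. *)
Theorem theorem3 (R : realType) (d : nat) (d0 : measure_display)
  (T : measurableType d0) (P : probability T R) (E U : seq bool -> T -> R) :
  (2 < d)%N ->
  (forall v, measurable_fun [set: T] (E v)) ->
  (forall v, measurable_fun [set: T] (U v)) ->
  mutually_independent P
    (fun z : seq bool + seq bool => match z with inl v => E v | inr v => U v end) ->
  (forall v A, measurable A -> P (E v @^-1` A) = exponential_prob 1 A) ->
  (forall v A, measurable A -> P (U v @^-1` A) = lebesgue_measure (A `&` `[0, 1])) ->
  let V (L : R) (w : T) :=
    fine (stit_surface (d := d) (fun v => E v w) (fun v => U v w) (cube_box d L) 1) in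
  let X (L : R) (w : T) := L ^- (d - 1) * (V L w - fine ('E_P[V L])%E) in
  exists mu : probability R R,
    [/\ forall f : R -> R, continuous f -> (exists M, forall x, `|f x| <= M) ->
          ('E_P[f \o X L])%E @[L --> +oo] --> (\int[mu]_x (f x)%:E)%E,
        (\int[mu]_x (x ^+ 2)%:E < +oo)%E,
        (forall m s : R, s != 0 ->
           ~ (forall A, measurable A -> mu A = normal_prob m s A)) &
        variance_of mu = var_formula (box_set (cube_box d 1))].
Proof.
move=> d3 mE mU ind lawE lawU V X; have d2 : (1 < d)%N := ltnW d3.
have pW : proper_box (cube_box d (1 : R)) := @proper_cube R d.
have uW : in_unit (cube_box d (1 : R)) := @in_unit_cube R d.
pose E' v w := clamp_pos (E v w); pose U' v w := clamp_unit (U v w).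
have E0' v w : 0 < E' v w by exact: clamp_pos_gt0.
have U01' v w : 0 <= U' v w <= 1 by exact: clamp_unit01.
have mE' v : measurable_fun setT (E' v).
  exact: (measurableT_comp (@measurable_clamp_pos R) (mE v)).
have mU' v : measurable_fun setT (U' v).
  exact: (measurableT_comp (@measurable_clamp_unit R) (mU v)).
pose BE : set R := [set x | x <= 0]; pose BU : set R := ~` [set` `[0, 1]].
have mBE : measurable BE by rewrite /BE -set_itvNyc; exact: measurable_itv.
have mBU : measurable BU by apply: measurableC; exact: measurable_itv.
have nE v : P (E v @^-1` BE) = 0%E.
  have := exponential_tail (mE v) (lawE v) (lexx 0); rewrite oppr0 expR0 => h.
  have mA : measurable (E v @^-1` BE) by rewrite -[X in measurable X]setTI; exact: mE.
  have : (P (~` (E v @^-1` BE)) = 1)%E.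
    rewrite -h (_ : P _ = \int[P]_w (\1_(~` (E v @^-1` BE)) w)%:E)%E; last first.
      by rewrite integral_indic ?setIT//; exact: measurableC.
    apply: eq_integral => w _; rewrite indicE in_setC; congr (_%:E).
    by have [w0|w0] := ltP 0 (E v w); [rewrite memNset//= /BE/= leNgt w0|rewrite mem_set].
  rewrite probability_setC// -(fineK (fin_num_measure P _ mA)) -EFinB => -[e].
  by congr EFin; lra.
have nU v : P (U v @^-1` BU) = 0%E by rewrite lawU// setICl measure0.
have lawE' v A : measurable A -> P (E' v @^-1` A) = exponential_prob 1 A.
  move=> mA; rewrite -(lawE v)// (law_off_null (mE v) (@measurable_clamp_pos R) mBE (nE v))// => x.
  by rewrite /BE /= /clamp_pos => /negP; rewrite -ltNge => ->.
have lawU' v A : measurable A -> P (U' v @^-1` A) = lebesgue_measure (A `&` `[0, 1]).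
  move=> mA; rewrite -(lawU v)// (law_off_null (mU v) (@measurable_clamp_unit R) mBU (nU v))// => x.
  by move=> /contrapT; rewrite /= in_itv/=; exact: clamp_unit_id.
have ind' : mutually_independent P (input E' U').
  move=> J B uJ mB.
  pose B' (z : seq bool + seq bool) := match z with
    | inl _ => @clamp_pos R @^-1` B z | inr _ => @clamp_unit R @^-1` B z end.
  have mB' z : measurable (B' z).
    case: z => v; rewrite /B' -[X in measurable X]setTI.
      exact: measurable_clamp_pos.
    exact: measurable_clamp_unit.
  have e z : input E' U' z @^-1` B z = input E U z @^-1` B' z by case: z.
  transitivity (P (\bigcap_(j in [set j | j \in J]) (input E U j @^-1` B' j))).
    by congr (P _); apply: eq_bigcapr => j _; exact: e.
  by rewrite ind//; apply: eq_bigr => j _; rewrite -e.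
(* The tree is countable, so a single null set serves all nodes at once; [unpickle] enumerates
   them. *)
have [N [mN N0 good]] : exists N, [/\ measurable N, P N = 0%E &
    forall w, ~ N w -> forall v, E' v w = E v w /\ U' v w = U v w].
  pose ok (o : option (seq bool)) w :=
    if o is Some v then E' v w = E v w /\ U' v w = U v w else True.
  have aeok o : {ae P, forall w, ok o w}.
    case: o => [v|]; last exact: aeW.
    have m1 : measurable (E v @^-1` BE) by rewrite -[X in measurable X]setTI; exact: mE.
    have m2 : measurable (U v @^-1` BU) by rewrite -[X in measurable X]setTI; exact: mU.
    exists (E v @^-1` BE `|` U v @^-1` BU); split.
    - exact: measurableU.
    - apply/eqP; rewrite eq_le measure_ge0 andbT.
      have add0_le (x y : \bar R) : x = 0%E -> y = 0%E -> (x + y <= 0)%E.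
        by move=> -> ->; rewrite adde0.
      exact: le_trans (measureU2 P m1 m2) (add0_le _ _ (nE v) (nU v)).
    - move=> w /= h; apply: contrapT => /not_orP[h1 h2]; apply: h; split.
        by rewrite /E' /clamp_pos; move: h1 => /negP; rewrite -ltNge => ->.
      by rewrite /U' clamp_unit_id//; move: h2 => /contrapT; rewrite /= in_itv.
  have : {ae P, forall w, forall n, ok (unpickle n) w} by apply: ae_foralln => n; exact: aeok.
  move=> [N [mN N0 sub]]; exists N; split => // w nN v.
  have := contrapT (fun h => nN (sub w h)) (pickle v).
  by rewrite pickleK.
have [mu [cmu m2 ng var]] := cube_limit_law d3 E0' U01' mE' mU' ind' lawE' lawU'.
exists mu; split => // f cf bf.
have VE L w : 0 < L -> ~ N w -> V L w = L ^+ (d - 1) *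
    fine (stit_surface (E'^~ w) (U'^~ w) (cube_box d 1) L).
  move=> L0 nN; rewrite /V -(scale_cube d L).
  have -> : (fun v => E v w) = E'^~ w by apply/funext => v; have [] := good w nN v.
  have -> : (fun v => U v w) = U'^~ w by apply/funext => v; have [] := good w nN v.
  rewrite stit_scale// mulr1.
  (* An infinite surface is sent to 0 by [fine] on both sides. *)
  case: (stit_surface _ _ _ _) => [x| |]//=.
  - by rewrite gt0_muley ?lte_fin ?exprn_gt0//= mulr0.
  - by rewrite gt0_muleNy ?lte_fin ?exprn_gt0//= mulr0.
have EV L : 0 < L -> fine ('E_P[V L])%E = L ^+ (d - 1) * (d%:R * L).
  move=> L0; rewrite unlock.
  rewrite (integral_off_null mN N0 (g := fun w => ((L ^+ (d - 1))%:E *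
     (fine (stit_surface (E'^~ w) (U'^~ w) (cube_box d 1) L))%:E)%E)); last first.
    by move=> w nN; rewrite VE// EFinM.
  rewrite integralZl//.
    rewrite fine_surf_integral ?(ltW L0)//.
    by rewrite vol_cube mulr1 -EFinM.
  apply: ge0_integrable_lty.
  - apply: measurableT_comp => //.
    exact: (measurable_surf d3 U01' pW mE' mU').
  - move=> w; rewrite fine_ge0//; apply: esum_ge0 => v _.
    rewrite (facet_vol_Fv (E'^~ w) d2 (U01'^~ w) pW) lee_fin.
    exact: Fv_ge0.
  - rewrite fine_surf_integral ?(ltW L0)// ltry//.
apply: cvg_trans; last exact: cmu f cf bf.
apply: near_eq_cvg; near=> L.
have L0 : 0 < L by near: L; apply: nbhs_pinfty_gt; exact: num_real.
rewrite unlock; apply: (integral_off_null mN N0) => w nN; congr (f _)%:E.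
rewrite /X EV// VE// /centered vol_cube mulr1 -mulrBr mulKf//.
by rewrite expf_neq0// gt_eqF.
Unshelve. all: by end_near. Qed.
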